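(* Let $(X,\mathsf{c})$ be a network, let $P$ be its transition operator on $\ell^2(X^0,\mathsf{m}^0)$ and let $A$ be its averaging operator on $L^2(X^1,\mathsf{m}^1)$. Then the spectrum of $A$ is $$ \operatorname{spec}(A)=\{0\}\cup\left\{\frac{\sin\omega}{\omega} : \omega\in\mathbb{R}\setminus\{0\},\ \cos\omega\in\operatorname{spec}(P)\right\}\cup\{1 : 1\in\operatorname{spec}(P)\}, $$ where the last set means $\{1\}$ if $1\in\operatorname{spec}(P)$ and $\emptyset$ otherwise.
   Context: Network: $X$ is a countable (finite or infinite) connected graph with symmetric neighbourhood relation $\sim$, without loops or multiple edges, and with at least one edge; $X^0$ is its vertex set. Each edge $[x,y]=[y,x]$ is viewed as a copy of the unit interval, edges being glued together at common endpoints, and $X^1$ is the resulting one-skeleton: its points are $(xy,t)$ with $x\sim y$, $0\le t\le 1$, the point at distance $t$ from $x$ on $[x,y]$, so that $(xy,0)=x$ and $(xy,t)=(yx,1-t)$. Each edge has a conductance $\mathsf{c}(xy)=\mathsf{c}(yx)>0$, and $\mathsf{m}^0(x)=\sum_{y:y\sim x}\mathsf{c}(xy)$ is assumed finite for every $x\in X^0$; $\mathsf{m}^0$ is regarded as a discrete measure on $X^0$. The measure $\mathsf{m}^1$ on $X^1$ is $\mathsf{c}(xy)\,dt$ on the interior of each edge $[x,y]$, and the vertex set has $\mathsf{m}^1$-measure $0$. Hilbert spaces (complex): $\ell^2(X^0,\mathsf{m}^0)$ has inner product $\langle g_1,g_2\rangle=\sum_{x\in X^0}g_1(x)\overline{g_2(x)}\,\mathsf{m}^0(x)$;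 $L^2(X^1,\mathsf{m}^1)$ has inner product $\langle F_1,F_2\rangle=\frac12\sum_{x\in X^0}\sum_{y\sim x}\mathsf{c}(xy)\int_0^1F_1(xy,t)\overline{F_2(xy,t)}\,dt$. Operators: $Pg(x)=\frac{1}{\mathsf{m}^0(x)}\sum_{y\sim x}\mathsf{c}(xy)g(y)$ and $$AF(xy,t)=\frac{1}{\mathsf{m}^0(x)}\sum_{u\sim x}\mathsf{c}(xu)\int_0^{1-t}F(xu,s)\,ds+\frac{1}{\mathsf{m}^0(y)}\sum_{v\sim y}\mathsf{c}(yv)\int_0^{t}F(yv,s)\,ds .$$ $P$ and $A$ are self-adjoint with norm at most $1$ on these spaces. *)

(* Defs.v *)
From mathcomp Require Import all_boot all_order all_algebra.
From mathcomp Require Import complex.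
From mathcomp Require Import all_classical all_reals all_analysis.
Set Implicit Arguments.
Unset Strict Implicit.
Unset Printing Implicit Defensive.
Import Order.TTheory GRing.Theory Num.Theory.
Import numFieldNormedType.Exports.
Local Open Scope classical_set_scope.
Local Open Scope complex_scope.
Local Open Scope ring_scope.

Record network (R : realType) (X : countType) := Network {
  adj : rel X;
  cond : X -> X -> R;
  adj_sym : forall x y, adj x y = adj y x;
  adj_irr : forall x, ~~ adj x x;
  adj_connected : forall x y, exists p : seq X, path adj x p /\ last x p = y;
  adj_edge : exists x y, adj x y;
  cond_sym : forall x y, adj x y -> cond x y = cond y x;
  cond_gt0 : forall x y, adj x y -> 0 < cond x y;
  cond_summable : forall x,
    (\esum_(y in [set y | adj x y]) (cond x y)%:E < +oo)%E }.

(* Unordered sum; meaningful when [f] is absolutely summable over [D]. *)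
Definition rsum (R : realType) (I : choiceType) (D : set I) (f : I -> R) : R :=
  fine (esum D (fun i => (f i)%:E)^\+%E) - fine (esum D (fun i => (f i)%:E)^\-%E).

Definition csum (R : realType) (I : choiceType) (D : set I) (f : I -> R[i]) :
    R[i] :=
  rsum D (fun i => complex.Re (f i)) +i* rsum D (fun i => complex.Im (f i)).

(* Integral over [[a, b]] against Lebesgue measure; it is 0 when [b < a]. *)
Definition cint (R : realType) (a b : R) (f : R -> R[i]) : R[i] :=
  (\int[@lebesgue_measure R]_(t in `[a, b]) complex.Re (f t)) +i*
  (\int[@lebesgue_measure R]_(t in `[a, b]) complex.Im (f t)).

(* A normed space of classes of complex functions on [T], given by its
   representatives [fmem] and their seminorm [fnorm]; representatives at
   seminorm distance 0 are identified. *)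
Record funspace (R : realType) (T : Type) := Funspace {
  fmem : set (T -> R[i]);
  fnorm : (T -> R[i]) -> \bar R }.

Section spectrum.
Variables (R : realType) (T : Type) (H : funspace R T).
Implicit Types (f g : T -> R[i]) (A S : (T -> R[i]) -> (T -> R[i])).

Definition feq f g : Prop := fnorm H (fun p => f p - g p) = 0%E.

(* [linear] and [bounded] together make [S] compatible with [feq], so that it
   induces a bounded linear operator on the quotient. *)
Definition bounded_operator S : Prop :=
  [/\ forall f, fmem H f -> fmem H (S f),
      forall (a : R[i]) f g, fmem H f -> fmem H g ->
        feq (S (fun p => a * f p + g p)) (fun p => a * S f p + S g p) &
      exists M : R, forall f, fmem H f ->
        (fnorm H (S f) <= M%:E * fnorm H f)%E].

Definition shift A (lambda : R[i]) f : T -> R[i] :=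
  fun p => A f p - lambda * f p.

Definition resolvent_set A : set R[i] :=
  [set lambda | exists S, bounded_operator S /\
    forall f, fmem H f ->
      feq (S (shift A lambda f)) f /\ feq (shift A lambda (S f)) f].

Definition spec A : set R[i] := ~` resolvent_set A.

End spectrum.

Section network_operators.
Variables (R : realType) (X : countType) (N : network R X).

Definition nbhd (x : X) : set X := [set y | adj N x y].

Definition m0 (x : X) : R := fine (\esum_(y in nbhd x) (cond N x y)%:E)%E.

Definition l2_norm (g : X -> R[i]) : \bar R :=
  ((\esum_(x in [set: X]) ((Normc.normc (g x)) ^+ 2 * m0 x)%:E) `^ 2^-1)%E.

Definition l2X0 : funspace R X :=
  Funspace [set g | (l2_norm g < +oo)%E] l2_norm.

(* The value [F (x, y, t)] stands for F(xy,t).  A function on the one-skeleton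
   is a family of functions on the oriented edges which respects the gluing;
   its values at triples with [x], [y] not adjacent or [t] outside [[0, 1]] are
   irrelevant. *)
Definition X1_function (F : X * X * R -> R[i]) : Prop :=
  (forall x y t, adj N x y -> 0 <= t <= 1 -> F (x, y, t) = F (y, x, 1 - t)) /\
  (forall x y z, adj N x y -> adj N x z -> F (x, y, 0) = F (x, z, 0)).

Definition X1_measurable (F : X * X * R -> R[i]) : Prop :=
  forall x y, adj N x y ->
    measurable_fun `[(0 : R), 1] (fun t => complex.Re (F (x, y, t))) /\
    measurable_fun `[(0 : R), 1] (fun t => complex.Im (F (x, y, t))).

(* The factor 1/2 compensates for each edge being counted in both
   orientations. *)
Definition L2_norm (F : X * X * R -> R[i]) : \bar R :=
  (((2^-1)%:E *
    \esum_(x in [set: X]) \esum_(y in nbhd x)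
      ((cond N x y)%:E *
       \int[@lebesgue_measure R]_(t in `[0%R, 1%R])
         ((Normc.normc (F (x, y, t))) ^+ 2)%:E)) `^ 2^-1)%E.

Definition L2X1 : funspace R (X * X * R) :=
  Funspace [set F | [/\ X1_function F, X1_measurable F & (L2_norm F < +oo)%E]]
           L2_norm.

Definition transition (g : X -> R[i]) : X -> R[i] := fun x =>
  ((m0 x)^-1)%:C * csum (nbhd x) (fun y => (cond N x y)%:C * g y).

Definition averaging (F : X * X * R -> R[i]) : X * X * R -> R[i] :=
  fun '(x, y, t) =>
    ((m0 x)^-1)%:C *
      csum (nbhd x) (fun u =>
        (cond N x u)%:C * cint 0 (1 - t) (fun s => F (x, u, s))) +
    ((m0 y)^-1)%:C *
      csum (nbhd y) (fun v =>
        (cond N y v)%:C * cint 0 t (fun s => F (y, v, s))).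

Definition specP : set R[i] := spec l2X0 transition.

Definition specA : set R[i] := spec L2X1 averaging.

End network_operators.

(* Main.v *)
Require Import Defs.
From HB Require Import structures.
From mathcomp Require Import all_boot all_order all_algebra.
From mathcomp Require Import complex.
From mathcomp Require Import all_classical all_reals all_analysis.
From mathcomp Require Import measurable_realfun.
From mathcomp Require Import ring lra.
Set Implicit Arguments.
Unset Strict Implicit.
Unset Printing Implicit Defensive.
Import Order.TTheory GRing.Theory Num.Theory.
Import numFieldNormedType.Exports.
Local Open Scope classical_set_scope.
Local Open Scope complex_scope.
Local Open Scope ring_scope.

(** Both operators are real, symmetric and bounded on complete spaces, so a point [z] lies in the
    spectrum exactly when it is real and [Op - z] is not bounded below on real functions
    ([spec_symmetricP]).  Hence the theorem is a comparison of lower bounds for [A - l] and [P - p].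

    Write [k h t] for the integral of [h] over [[0, 1 - t]], and [m F (x, t)] for the mean of
    [F (x, y, t)] over the random neighbour [y] of [x].  Then [A F] is the function
    [m (k F) (x, t) + m (k F) (y, 1 - t)].  Consequently, for [l] nonzero, [A - l] is bounded below as
    soon as [B - l] is, where [B h (x, t) = k h (x, t) + k (P h) (x, 1 - t)] acts on functions of a
    vertex and of [t] ([avg_bounded_below]); here [P] acts on the vertex alone, so it commutes with
    [B].

    If [P] were multiplication by a number [p], then [(B - l) h = - r] would be the fiber problem
    [l h(t) = \int_0^{1-t} h + p \int_0^t h + r(t)] on the unit interval.  Gronwall's inequality
    bounds [h] by [r] and by the total integral of [h]; the latter is found by pairing the equation
    with a function [eta] which the adjoint operator maps to a nonzero constant
    ([fiber_problem_bound]).  Such an [eta] is an explicit trigonometric function, and it fails to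
    exist only if [l = sin w / w] with [cos w = p], or if [l = p = 1] ([fiber_dual_exists]).
    The actual operator [P] is handled by localization ([spectral_localization]): [B - l] is bounded
    below if, for each number [p], either [P - p] is bounded below or the fiber problem with
    parameter [p] is.  This substitute for the spectral theorem shows that the spectrum of [A] has no
    further points.

    Conversely, let [S] solve [\int_0^{1-t} S(1 - s) ds + p \int_0^{1-t} S = l S(1 - t)] with
    [S 0 = 0] and [S 1] nonzero.  A function [g] on the vertices extends to the skeleton by
    [g(x) S(1 - t) + g(y) S(t)], and [A - l] applied to the extension is controlled by [P g - p g].
    So approximate eigenvectors of [P] for [p] become approximate eigenvectors of [A] for [l]
    ([vtrans_bounded_below]).  The functions [sin (w t)] and [t] give the points
    [sin w / w] and [1].  Finally [0] always belongs to the spectrum, because [A] integrates along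
    the edges: it nearly annihilates the indicator function of a short interval inside one edge
    ([avg_not_bounded_below]). *)

(** * Symmetric operators for a semi-definite form *)

(** The form may have null vectors, because functions that agree almost everywhere are not
    identified.  Vectors [u], [v] count as equal when [sqn b (u - v) = 0]. *)
Record semi_ip (R : realType) (V : lmodType R) := SemiIp {
  dot :> V -> V -> R;
  dotC : forall u v, dot u v = dot v u;
  dotP : forall a u v w, dot (a *: u + v) w = a * dot u w + dot v w;
  dot_ge0 : forall u, 0 <= dot u u }.

Section semi_ip_theory.
Variables (R : realType) (V : lmodType R) (b : semi_ip V).
Implicit Types (u v w : V).

Definition sqn u := b u u.

Lemma sqn_ge0 u : 0 <= sqn u. Proof. exact: dot_ge0. Qed.

Lemma dotDl u v w : b (u + v) w = b u w + b v w.
Proof. by have := dotP b 1 u v w; rewrite scale1r mul1r. Qed.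

Lemma dot0l w : b 0 w = 0.
Proof. by have := dotDl 0 0 w; rewrite addr0 => ?; lra. Qed.

Lemma dotZl a u w : b (a *: u) w = a * b u w.
Proof. by have := dotP b a u 0 w; rewrite addr0 dot0l addr0. Qed.

Lemma dotNl u w : b (- u) w = - b u w.
Proof. by rewrite -scaleN1r dotZl mulN1r. Qed.

Lemma dotBl u v w : b (u - v) w = b u w - b v w.
Proof. by rewrite dotDl dotNl. Qed.

Lemma dotDr u v w : b w (u + v) = b w u + b w v.
Proof. by rewrite dotC dotDl !(dotC b w). Qed.

Lemma dotZr a u w : b w (a *: u) = a * b w u.
Proof. by rewrite dotC dotZl dotC. Qed.

Lemma dotNr u w : b w (- u) = - b w u.
Proof. by rewrite dotC dotNl dotC. Qed.

Lemma dotBr u v w : b w (u - v) = b w u - b w v.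
Proof. by rewrite dotDr dotNr. Qed.

Definition dotE := (dotDl, dotBl, dotZl, dotNl, dotDr, dotBr, dotZr, dotNr).

Lemma sqnZ a u : sqn (a *: u) = a ^+ 2 * sqn u.
Proof. by rewrite /sqn !dotE; ring. Qed.

Lemma sqn0 : sqn 0 = 0. Proof. exact: dot0l. Qed.

Lemma sqnN u : sqn (- u) = sqn u.
Proof. by rewrite /sqn !dotE; ring. Qed.

Lemma sqnD_le u v : sqn (u + v) <= 2 * sqn u + 2 * sqn v.
Proof.
have := sqn_ge0 (u - v); rewrite /sqn !dotE (dotC b v u); lra.
Qed.

Lemma sqnB_le u v : sqn (u - v) <= 2 * sqn u + 2 * sqn v.
Proof. by have := sqnD_le u (- v); rewrite sqnN. Qed.

Lemma dot_le u v : 2 * b u v <= sqn u + sqn v.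
Proof.
have := sqn_ge0 (u - v); rewrite /sqn !dotE (dotC b v u); lra.
Qed.

Lemma dot_ge u v : - (sqn u + sqn v) <= 2 * b u v.
Proof. by have := dot_le (- u) v; rewrite sqnN dotNl; lra. Qed.

Lemma cauchy_schwarz u v : b u v ^+ 2 <= sqn u * sqn v.
Proof.
have h (t : R) : 0 <= sqn u - 2 * t * b u v + t ^+ 2 * sqn v.
  by have := sqn_ge0 (u - t *: v); rewrite /sqn !dotE (dotC b v u); lra.
have := sqn_ge0 v; rewrite le_eqVlt => /orP[/eqP v0|v0].
  have [->|uv] := eqVneq (b u v) 0; first by rewrite -v0 expr0n mulr0.
  have := h ((sqn u + 1) / (2 * b u v)); rewrite -v0 mulr0 addr0.
  have -> : 2 * ((sqn u + 1) / (2 * b u v)) * b u v = sqn u + 1 by field.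
  by lra.
have := h (b u v / sqn v).
have -> : sqn u - 2 * (b u v / sqn v) * b u v + (b u v / sqn v) ^+ 2 * sqn v
   = (sqn u * sqn v - b u v ^+ 2) / sqn v by field; rewrite gt_eqF.
by rewrite pmulr_lge0 ?invr_gt0// subr_ge0.
Qed.

Lemma dot_eq0l u w : sqn u = 0 -> b u w = 0.
Proof.
move=> u0; have := cauchy_schwarz u w; rewrite u0 mul0r => h.
by apply/eqP; rewrite -sqrf_eq0 eq_le h sqr_ge0.
Qed.

Lemma sqn_eq0P u : sqn u = 0 <-> forall w, b u w = 0.
Proof. by split=> [u0 w|h]; [exact: dot_eq0l|exact: h]. Qed.

Lemma dot_eql u v w : sqn (u - v) = 0 -> b u w = b v w.
Proof.
by move=> h; apply/eqP; rewrite -subr_eq0 -dotBl; apply/eqP; exact: dot_eq0l.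
Qed.

Lemma sqn_eq u v : sqn (u - v) = 0 -> sqn u = sqn v.
Proof.
by move=> h; rewrite /sqn (dot_eql _ h) dotC (dot_eql _ h).
Qed.

(** Equality modulo null vectors can be tested weakly.  Symmetric operators are moved to the test
    vector, which makes their compatibility with null vectors automatic. *)
Lemma sqn_eqP u v : sqn (u - v) = 0 <-> forall w, b u w = b v w.
Proof.
split=> [h w|h]; first exact: dot_eql.
by apply/sqn_eq0P => w; rewrite dotBl h subrr.
Qed.

Definition symmetric_op (T : V -> V) := forall u v, b (T u) v = b u (T v).

(** A symmetric map is linear modulo null vectors, so linearity is never required of operators. *)
Lemma symmetric_opP T a u v w : symmetric_op T ->
  b (T (a *: u + v)) w = a * b (T u) w + b (T v) w.
Proof. by move=> Ts; rewrite Ts !dotE -!Ts. Qed.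

Definition bounded_op (T : V -> V) (C : R) := forall u, sqn (T u) <= C * sqn u.

End semi_ip_theory.

Section localization.
Variables (R : realType) (V : lmodType R) (b q : semi_ip V) (P : V -> V).
Hypothesis Psym : symmetric_op b P.
Hypothesis Pb : bounded_op b P 1.
Hypothesis Pq : bounded_op q P 1.

Section form.
Variables (p K : R).
Hypothesis pK : forall u, p * sqn b u <= b (P u) u + K * sqn q u.

(** Positivity of this form is the operator inequality [p <= P + K q]. *)
Definition shifted_form u v := b (P u) v - p * b u v + K * q u v.

Fact shifted_formC u v : shifted_form u v = shifted_form v u.
Proof. by rewrite /shifted_form Psym (dotC b u) (dotC q u) (dotC b u v). Qed.

Fact shifted_formP a u v w :
  shifted_form (a *: u + v) w = a * shifted_form u w + shifted_form v w.
Proof. by rewrite /shifted_form (symmetric_opP _ _ _ _ Psym) !dotE; ring. Qed.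

Fact shifted_form_ge0 u : 0 <= shifted_form u u.
Proof. by have := pK u; rewrite /shifted_form /sqn; lra. Qed.

Definition shifted_form_ip := SemiIp shifted_formC shifted_formP shifted_form_ge0.

(** Where the positive form is small on [u], Cauchy-Schwarz makes it small against the defect
    [P u - p u] as well, and that value dominates the square of the defect. *)
Lemma shifted_form_defect u : `|p| <= 2 -> 0 <= K ->
  sqn b (P u - p *: u) <= 3 * shifted_form_ip u u + 16 * K * sqn q u.
Proof.
move=> /ler_normlP[p2 p2'] K0; pose d := P u - p *: u.
have h1 : shifted_form_ip u d = sqn b d + K * q u d.
  by rewrite /= /shifted_form /sqn {3}/d (dotBl b) (dotZl b).
have hqd : sqn q d <= 10 * sqn q u.
  apply: le_trans (sqnB_le _ _ _) _; rewrite sqnZ.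
  have := Pq u; rewrite mul1r => hP.
  have : p ^+ 2 <= 4.
    have : 0 <= (2 - p) * (2 + p) by apply: mulr_ge0; lra.
    by lra.
  by have := sqn_ge0 q u; nra.
have h2 : shifted_form_ip d d <= 3 * sqn b d + K * (10 * sqn q u).
  rewrite /= /shifted_form.
  have := dot_le b (P d) d; have := Pb d; rewrite mul1r => hP hd.
  have hp : - p * sqn b d <= 2 * sqn b d.
    by rewrite ler_wpM2r// ?sqn_ge0//; lra.
  have := ler_wpM2l K0 hqd; rewrite -/(sqn b d) -/(sqn q d); nra.
have h3 : - (6 * sqn q u) <= q u d.
  by have := dot_ge q u d; have := sqn_ge0 q u; lra.
(* As [|P| <= 1] and [|p| <= 2], the form on [d] is at most [3 * sqn b d] up to a multiple of [q],
   which makes [3^-1] the best step. *)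
have := sqn_ge0 shifted_form_ip (u - 3^-1 *: d).
rewrite -/d {1}/sqn (dotBl shifted_form_ip) !(dotBr shifted_form_ip) !(dotZl shifted_form_ip)
  !(dotZr shifted_form_ip).
rewrite (dotC shifted_form_ip d u) h1.
have := ler_wpM2l K0 h3; have := mulr_ge0 K0 (sqn_ge0 q u).
by move: (shifted_form_ip u u) (shifted_form_ip d d) (sqn b d) (sqn q u) (q u d) h2 => ? ? ? ? ?;
  lra.
Qed.

End form.

(** If no multiple of [q] dominates [b], then the numbers [p] with [p <= P + K q] for some [K] have a
    supremum.  Near it, the hypothesis for the supremum and [shifted_form_defect] improve [p] by an
    amount that does not depend on how close [p] is: a contradiction.  That [P] contracts [q] replaces
    the commutation of [P] with a spectral projection. *)
Theorem spectral_localization :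
  (forall p, exists2 e, 0 < e &
     forall u, e * sqn b u <= sqn q u + sqn b (P u - p *: u)) ->
  exists2 e, 0 < e & forall u, e * sqn b u <= sqn q u.
Proof.
move=> H; apply: contrapT => nH.
pose S := [set p | exists2 K, 0 <= K &
                   forall u, p * sqn b u <= b (P u) u + K * sqn q u].
have S1 : S (-1).
  exists 0 => // u; have := dot_ge b (P u) u; have := Pb u; lra.
have Sub : ubound S 2.
  move=> p [K K0 pK]; rewrite leNgt; apply/negP => p2; apply: nH.
  exists (K + 1)^-1 => [|u]; first by rewrite invr_gt0 ltr_wpDl.
  rewrite mulrC ler_pdivrMr ?ltr_wpDl//.
  have := pK u; have := dot_le b (P u) u; have := Pb u.
  by have := sqn_ge0 b u; have := sqn_ge0 q u; nra.
have hS : has_sup S by split; [exists (-1)|exists 2].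
pose al := sup S.
have al1 : -1 <= al by exact: sup_ubound hS.2 _ S1.
have al2 : al <= 2 by apply: ge_sup => //; exists (-1).
have [e e0 he] := H al.
(* For [p] within [eta] of the supremum, the gain [(e - 2 * eta ^+ 2) / 6] below exceeds [eta]. *)
pose eta := Num.min 1 (e / 10).
have eta0 : 0 < eta by rewrite lt_min ltr01 divr_gt0.
have eta1 : eta <= 1 by rewrite ge_min lexx.
have etae : eta <= e / 10 by rewrite ge_min lexx orbT.
have [p [K K0 pK] alp] := sup_adherent eta0 hS.
rewrite -/al in alp.
have pal : p <= al by apply: sup_ubound hS.2 _ _; exists K.
have p2 : `|p| <= 2 by rewrite ler_norml; apply/andP; split; lra.
have : S (p + (e - 2 * eta ^+ 2) / 6).
  exists ((38 * K + 1) / 6) => [|u]; first by rewrite divr_ge0// addr_ge0// mulr_ge0.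
  have hd := shifted_form_defect pK u p2 K0.
  rewrite [shifted_form_ip pK u u]/(shifted_form p K u u) /shifted_form in hd.
  have h1 : sqn b (P u - al *: u) <=
      2 * sqn b (P u - p *: u) + 2 * (eta ^+ 2 * sqn b u).
    have -> : P u - al *: u = (P u - p *: u) - (al - p) *: u.
      by rewrite scalerBl opprB addrA subrK.
    apply: le_trans (sqnB_le _ _ _) _; rewrite sqnZ lerD2l ler_pM2l//.
    by rewrite ler_wpM2r ?sqn_ge0// ler_sqr ?nnegrE; lra.
  have := he u; rewrite -/(sqn b u) -/(sqn q u) in hd *.
  by move: (sqn b u) (sqn q u) (b (P u) u) (sqn b (P u - p *: u)) hd h1 => ? ? ? ?; nra.
move=> /(sup_ubound hS.2); rewrite -/al => h.
have : eta ^+ 2 <= eta by rewrite expr2 ger_pMl.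
by move: h; lra.
Qed.

End localization.

(** * Lower bounds and Neumann series *)

Section completeness.
Variables (R : realType) (V : lmodType R) (b : semi_ip V).

(** Completeness for sequences with geometrically decreasing increments, which is what a Neumann
    series produces. *)
Definition geometrically_complete := forall (u : nat -> V) (C r : R),
  0 <= r < 1 -> (forall k, sqn b (u k.+1 - u k) <= C * r ^+ k) ->
  exists v, forall e, 0 < e ->
    exists N, forall k, (N <= k)%N -> sqn b (u k - v) <= e.

Definition bounded_below (T : V -> V) :=
  exists2 d, 0 < d & forall u, d * sqn b u <= sqn b (T u).

Lemma geometric_small (C r e : R) : 0 <= C -> 0 <= r < 1 -> 0 < e ->
  exists N, forall k, (N <= k)%N -> C * r ^+ k <= e.
Proof.
move=> C0 /andP[r0 r1] e0.
have : (fun k => C * r ^+ k) @ \oo --> (0 : R).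
  rewrite -(mulr0 C); apply: cvgM; first exact: cvg_cst.
  by apply: cvg_expr; rewrite ger0_norm.
move=> /cvgrPdist_le /(_ e e0)[N _ hN]; exists N => k Nk.
have := hN k Nk; rewrite sub0r normrN ger0_norm//.
by rewrite mulr_ge0// exprn_ge0.
Qed.

Section neumann.
Hypothesis complete : geometrically_complete.
Variables (T : V -> V) (d C : R).
Hypotheses (Tsym : symmetric_op b T) (d0 : 0 < d) (C0 : 0 <= C).
Hypothesis Tge : forall u, d * sqn b u <= b (T u) u.
Hypothesis Tle : forall u, b (T u) u <= C * sqn b u.

Let tau := (C + d)^-1.
Let r := C * tau.
Let G u := u - tau *: T u.

Let tau0 : 0 < tau. Proof. by rewrite invr_gt0 ltr_wpDl. Qed.
Let tauE : tau * (C + d) = 1.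
Proof. by rewrite mulVf// gt_eqF// ltr_wpDl. Qed.
Let r01 : 0 <= r < 1.
Proof.
apply/andP; split; first by rewrite mulr_ge0// ltW.
by rewrite /r mulrC -tauE ltr_pM2l// ltrDl.
Qed.

Let Gsym : symmetric_op b G.
Proof. by move=> u v; rewrite /G !dotE Tsym. Qed.

Let g_dotC u v : b (G u) v = b (G v) u.
Proof. by rewrite Gsym dotC. Qed.
Let g_dotP a u v w : b (G (a *: u + v)) w = a * b (G u) w + b (G v) w.
Proof. exact: symmetric_opP. Qed.
Let g_ge0 u : 0 <= b (G u) u.
Proof.
rewrite /G !dotE subr_ge0 -/(sqn b u).
have h : tau * b (T u) u <= tau * (C * sqn b u) by rewrite ler_pM2l.
apply: le_trans h _; rewrite mulrA ler_piMl ?sqn_ge0// -tauE ler_pM2l//.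
by rewrite lerDl ltW.
Qed.
Let g := SemiIp g_dotC g_dotP g_ge0.

Let g_le u : sqn g u <= r * sqn b u.
Proof.
rewrite /sqn/= /G !dotE -/(sqn b u).
have : tau * (d * sqn b u) <= tau * b (T u) u by rewrite ler_pM2l.
have -> : r = 1 - tau * d by rewrite -tauE /r; ring.
by lra.
Qed.

(** With the step [(C + d)^-1], the form of [G = 1 - tau T] lies between [0] and [r] times [b];
    Cauchy-Schwarz for this form turns the bound on the form into a bound on the operator. *)
Lemma neumann_contraction u : sqn b (G u) <= r * sqn b u.
Proof.
have /andP[r0 r1] := r01.
have h := cauchy_schwarz g u (G u).
have hu := sqn_ge0 b u.
have := sqn_ge0 b (G u); rewrite le_eqVlt => /orP[/eqP <-|y0].
  by rewrite mulr_ge0.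
have h2 : sqn b (G u) ^+ 2 <= (r * sqn b u) * (r * sqn b (G u)).
  apply: le_trans h _; apply: ler_pM; rewrite ?sqn_ge0//; exact: g_le.
rewrite expr2 mulrA ler_pM2r// in h2.
apply: (le_trans h2).
by rewrite ler_piMr// ?mulr_ge0// ltW.
Qed.

(** The inverse is the sum of the series [tau G^k], chosen for each vector separately. *)
Lemma neumann_inverse : exists S : V -> V, forall u, sqn b (T (S u) - u) = 0.
Proof.
suff H u : exists v, sqn b (T v - u) = 0 by have [S hS] := choice H; exists S.
have /andP[r0 r1] := r01.
pose s k := \sum_(i < k) iter i G u.
have hG k : sqn b (iter k G u) <= sqn b u * r ^+ k.
  elim: k => [|k IH]; first by rewrite expr0 mulr1.
  apply: (le_trans (neumann_contraction _)).
  by rewrite exprS mulrCA ler_wpM2l.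
have [v hv] : exists v, forall e, 0 < e ->
    exists N, forall k, (N <= k)%N -> sqn b (s k - v) <= e.
  apply: (complete (C := sqn b u) r01) => k.
  by rewrite /s big_ord_recr/= addrAC subrr add0r.
exists (tau *: v); apply/sqn_eqP => w.
(* The telescoping sum, with [1 - G] moved to the test vector. *)
have sE k : b (s k) (w - G w) = b u w - b (iter k G u) w.
  elim: k => [|k IH]; first by rewrite /s big_ord0 dot0l subrr.
  rewrite /s big_ord_recr/= dotDl IH dotBr -Gsym; lra.
have TE : b (T (tau *: v)) w = b v (w - G w).
  rewrite Tsym dotZl -dotZr; congr (b v _).
  by rewrite /G opprB addrC subrK.
rewrite TE; apply/eqP; rewrite -subr_eq0 -normr_le0.
apply/ler_addgt0Pr => e e0; rewrite add0r.
pose W := sqn b (w - G w) + sqn b w + 1.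
have W0 : 0 < W by rewrite ltr_wpDl// addr_ge0// sqn_ge0.
have e20 : 0 < e ^+ 2 / (4 * W) by rewrite divr_gt0 ?exprn_gt0// mulr_gt0.
have [N1 h1] := hv _ e20.
have [N2 h2] := geometric_small (sqn_ge0 b u) r01 e20.
pose k := maxn N1 N2.
have {}h1 := h1 k (leq_maxl _ _).
have {}h2 := le_trans (hG k) (h2 k (leq_maxr _ _)).
have half x y : sqn b x <= e ^+ 2 / (4 * W) -> sqn b y <= W -> `|b x y| <= e / 2.
  move=> hx hy; have e2 : 0 <= e / 2 by rewrite divr_ge0// ltW.
  rewrite -(@ler_pXn2r _ 2)// ?nnegrE//.
  rewrite real_normK ?num_real//.
  apply: (le_trans (cauchy_schwarz b x y)).
  apply: (@le_trans _ _ (e ^+ 2 / (4 * W) * W)).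
    by apply: ler_pM; rewrite ?sqn_ge0.
  by rewrite le_eqVlt; apply/orP; left; apply/eqP; field; rewrite gt_eqF.
have -> : b v (w - G w) - b u w = - b (s k - v) (w - G w) - b (iter k G u) w.
  by rewrite dotBl sE; ring.
apply: (le_trans (ler_normB _ _)); rewrite normrN (splitr e) lerD//; apply: half => //.
  by rewrite /W -addrA lerDl addr_ge0// sqn_ge0.
by rewrite /W addrAC lerDr addr_ge0// sqn_ge0.
Qed.

End neumann.
End completeness.

(** Expand the square and bound the cross term by [2 * `|b (T u) u| <= sqn b (T u) + sqn b u]. *)
Lemma contraction_bounded_below (R : realType) (V : lmodType R) (b : semi_ip V)
    (T : V -> V) (p : R) : bounded_op b T 1 -> 1 < `|p| ->
  bounded_below b (fun u => T u - p *: u).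
Proof.
move=> Tb p1; exists ((`|p| - 1) ^+ 2) => [|u].
  by rewrite exprn_even_gt0//= subr_eq0 gt_eqF.
have h := Tb u; have h0 := sqn_ge0 b u.
have -> : sqn b (T u - p *: u) = sqn b (T u) - 2 * p * b (T u) u + p ^+ 2 * sqn b u.
  by rewrite /sqn !(dotBl b) !(dotBr b) !(dotZl b) !(dotZr b) (dotC b u (T u)); ring.
rewrite mul1r in h.
have h1 : 2 * p * b (T u) u <= `|p| * (sqn b (T u) + sqn b u).
  have [p0|p0] := leP 0 p.
    by rewrite ger0_norm// mulrAC [leLHS]mulrC ler_wpM2l// dot_le.
  have -> : 2 * p * b (T u) u = - p * - (2 * b (T u) u) by ring.
  by rewrite ltr0_norm// ler_wpM2l ?oppr_ge0 ?(ltW p0)// lerNl dot_ge.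
have h2 : (`|p| - 1) * sqn b (T u) <= (`|p| - 1) * sqn b u.
  by rewrite ler_wpM2l// subr_ge0 ltW.
have -> : p ^+ 2 = `|p| ^+ 2 by rewrite real_normK// num_real.
have -> : (`|p| - 1) ^+ 2 * sqn b u =
  `|p| ^+ 2 * sqn b u - `|p| * sqn b u - (`|p| - 1) * sqn b u by ring.
move: h1 h2; rewrite mulrDr !mulrBl !mul1r => h1 h2.
lra.
Qed.

(** * Resolvents of complexified symmetric operators *)

Section complexification.
Variables (R : realType) (T : Type) (H : funspace R T).
Variables (V : lmodType R) (b : semi_ip V) (rep : V -> T -> R) (D : set T).

(** Complex functions are described by pairs of real vectors.  The set [D] is where the values of a
    representative are relevant; elsewhere they are arbitrary. *)
Definition represents (f : T -> R[i]) (uv : V * V) :=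
  forall p, D p -> f p = rep uv.1 p +i* rep uv.2 p.

Hypothesis repP : forall a u v p, rep (a *: u + v) p = a * rep u p + rep v p.
Hypothesis fmemP : forall f, fmem H f <-> exists uv, represents f uv.
Hypothesis fnormP : forall f uv, represents f uv ->
  fnorm H f = (Num.sqrt (sqn b uv.1 + sqn b uv.2))%:E.

Variables (Op : (T -> R[i]) -> T -> R[i]) (A : V -> V) (C : R).
Hypothesis OpP : forall f uv, represents f uv -> represents (Op f) (A uv.1, A uv.2).
Hypothesis Asym : symmetric_op b A.
Hypothesis Abd : bounded_op b A C.
Hypothesis complete : geometrically_complete b.

Let repD u v p : rep (u + v) p = rep u p + rep v p.
Proof. by rewrite -[u]scale1r repP mul1r scale1r. Qed.
Let rep0 p : rep 0 p = 0.
Proof. by have := repD 0 0 p; rewrite addr0 => ?; lra. Qed.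
Let repZ a u p : rep (a *: u) p = a * rep u p.
Proof. by rewrite -[a *: u]addr0 repP rep0 addr0. Qed.
Let repN u p : rep (- u) p = - rep u p.
Proof. by rewrite -scaleN1r repZ mulN1r. Qed.

Lemma representsB f g uv wz : represents f uv -> represents g wz ->
  represents (fun p => f p - g p) (uv.1 - wz.1, uv.2 - wz.2).
Proof. by move=> hf hg p Dp; rewrite hf// hg//= !repD !repN. Qed.

Lemma represents_lin (c : R[i]) f g uv wz : represents f uv -> represents g wz ->
  represents (fun p => c * f p + g p)
    (complex.Re c *: uv.1 - complex.Im c *: uv.2 + wz.1,
     complex.Re c *: uv.2 + complex.Im c *: uv.1 + wz.2).
Proof.
move=> hf hg p Dp; rewrite hf// hg//=; case: c => c1 c2 /=.
by rewrite !repD !repN !repZ.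
Qed.

Lemma feqP f g uv wz : represents f uv -> represents g wz ->
  feq H f g <-> sqn b (uv.1 - wz.1) = 0 /\ sqn b (uv.2 - wz.2) = 0.
Proof.
move=> hf hg; rewrite /feq (fnormP (representsB hf hg))/=.
have h1 := sqn_ge0 b (uv.1 - wz.1); have h2 := sqn_ge0 b (uv.2 - wz.2).
split=> [[/eqP]|[-> ->]]; last by rewrite addr0 sqrtr0.
rewrite sqrtr_eq0 => h.
by split; apply/eqP; rewrite eq_le ?h1 ?h2 andbT; lra.
Qed.

Lemma represents_uniq f uv wz : represents f uv -> represents f wz ->
  sqn b (uv.1 - wz.1) = 0 /\ sqn b (uv.2 - wz.2) = 0.
Proof.
move=> h1 h2; apply/(feqP h1 h2).
rewrite /feq (fnormP (representsB h1 h1))/= !subrr.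
by rewrite !sqn0 addr0 sqrtr0.
Qed.

Section shifted.
Variables (z : R[i]).
Let x := complex.Re z.
Let y := complex.Im z.
Variable B : V -> V.
Hypothesis BE : forall u, B u = A u - x *: u.

Let Bsym : symmetric_op b B.
Proof. by move=> u v; rewrite !BE !dotE Asym. Qed.

Lemma shift_represents f uv : represents f uv ->
  represents (Defs.shift Op z f) (B uv.1 + y *: uv.2, B uv.2 - y *: uv.1).
Proof.
move=> hf p Dp; rewrite /Defs.shift hf// (OpP hf)//=.
rewrite !BE !repD !repN !repZ /x /y; case: z => a c /=.
by apply/eqP; rewrite eq_complex/=; apply/andP; split; apply/eqP; ring.
Qed.

Let Bd u : sqn b (B u) <= (2 * C + 2 * x ^+ 2) * sqn b u.
Proof.
rewrite BE; apply: (le_trans (sqnB_le _ _ _)); rewrite sqnZ.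
by have := Abd u; lra.
Qed.

(** The inverse of [A - z = B - i y] is [(B + i y) (B^2 + y^2)^-1], and [B^2 + y^2] is a positive
    operator which the Neumann series inverts. *)
Lemma resolvent_of_bounded_below :
  (exists2 d, 0 < d & forall u, d * sqn b u <= sqn b (B u) + y ^+ 2 * sqn b u) ->
  resolvent_set H Op z.
Proof.
move=> [d d0 hd].
pose T1 u := B (B u) + y ^+ 2 *: u.
have T1E u w : b (T1 u) w = b (B u) (B w) + y ^+ 2 * b u w.
  by rewrite /T1 !dotE Bsym.
have T1sym : symmetric_op b T1.
  by move=> u v; rewrite T1E dotC (dotC b u v) -T1E dotC.
have C0 : 0 <= `|C| by [].
have [S0 hS0] : exists S0, forall u, sqn b (T1 (S0 u) - u) = 0.
  apply: (neumann_inverse complete (d := d)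
    (C := 2 * `|C| + 2 * x ^+ 2 + y ^+ 2)) => //.
  - have := sqr_ge0 x; have := sqr_ge0 y; lra.
  - by move=> u; rewrite T1E; exact: hd.
  - move=> u; rewrite T1E mulrDl lerD2r; apply: le_trans (Bd u) _.
    by rewrite ler_wpM2r ?sqn_ge0// lerD2r ler_pM2l// ler_norm.
have S0E u w : b (T1 (S0 u)) w = b u w by exact: dot_eql.
have T1inj w : b (T1 w) w = 0 -> sqn b w = 0.
  rewrite T1E => h; have := hd w; rewrite /sqn h -/(sqn b w).
  by have := sqn_ge0 b w; rewrite (pmulr_rle0 _ d0) => ? ?; apply/le_anti/andP.
have BT1 u w : b (T1 (B u)) w = b (T1 u) (B w).
  by rewrite !T1E (Bsym (B u) (B w)) (Bsym u w).
have S0b u : sqn b (S0 u) <= d ^- 2 * sqn b u.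
  have h1 : d * sqn b (S0 u) <= b u (S0 u) by rewrite -S0E T1E; exact: hd.
  have h2 := cauchy_schwarz b u (S0 u).
  have := sqn_ge0 b (S0 u); rewrite le_eqVlt => /orP[/eqP <-|s0].
    by rewrite mulr_ge0 ?sqn_ge0// invr_ge0 exprn_ge0// ltW.
  have h3 : (d * sqn b (S0 u)) ^+ 2 <= sqn b u * sqn b (S0 u).
    apply: le_trans h2; rewrite ler_sqr// nnegrE; first by rewrite mulr_ge0 ?ltW.
    by apply: le_trans h1; rewrite mulr_ge0 ?ltW.
  rewrite mulrC ler_pdivlMr ?exprn_gt0//.
  rewrite exprMn [_ ^+ 2 in X in _ * X <= _]expr2 mulrA ler_pM2r// in h3.
  by rewrite mulrC.
have S0lin a u v : sqn b (S0 (a *: u + v) - (a *: S0 u + S0 v)) = 0.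
  apply: T1inj; set w := _ - _.
  rewrite {1}/w -scaleN1r addrC (symmetric_opP _ _ _ _ T1sym).
  by rewrite (symmetric_opP _ _ _ _ T1sym) !S0E !dotE; ring.
have [rp hrp] : {rp : (T -> R[i]) -> V * V | forall f, fmem H f -> represents f (rp f)}.
  apply: cid; suff /choice[rp] : forall f, exists uv, fmem H f -> represents f uv.
    by exists rp.
  move=> f; have [/fmemP[uv huv]|nf] := pselect (fmem H f); first by exists uv.
  by exists (0, 0).
have [s1 s1D] : exists s1, forall uv : V * V, s1 uv = B (S0 uv.1) - y *: S0 uv.2.
  by eexists.
have [s2 s2D] : exists s2, forall uv : V * V, s2 uv = B (S0 uv.2) + y *: S0 uv.1.
  by eexists.
(* [s1] and [s2] are the real and imaginary parts of [(B + i y) (B^2 + y^2)^-1]. *)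
pose S f p := rep (s1 (rp f)) p +i* rep (s2 (rp f)) p.
have Srep f : represents (S f) (s1 (rp f), s2 (rp f)) by move=> p Dp.
have s1E uv w : b (s1 uv) w = b (S0 uv.1) (B w) - y * b (S0 uv.2) w.
  by rewrite s1D dotBl dotZl Bsym.
have s2E uv w : b (s2 uv) w = b (S0 uv.2) (B w) + y * b (S0 uv.1) w.
  by rewrite s2D dotDl dotZl Bsym.
exists S; split.
  split.
  - by move=> f fH; apply/fmemP; exists (s1 (rp f), s2 (rp f)).
  - move=> a f g fH gH.
    have hfg := represents_lin a (hrp _ fH) (hrp _ gH).
    have h : fmem H (fun p => a * f p + g p) by apply/fmemP; eexists; exact: hfg.
    have [e1 e2] := represents_uniq (hrp _ h) hfg.
    have S0eq u v w : sqn b (u - v) = 0 -> b (S0 u) w = b (S0 v) w.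
      move=> uv; apply: dot_eql; apply: T1inj; set k := _ - _.
      rewrite {1}/k -scaleN1r addrC (symmetric_opP _ _ _ _ T1sym) !S0E.
      by rewrite (dot_eql _ uv); ring.
    have S0D u v w : b (S0 (u + v)) w = b (S0 u) w + b (S0 v) w.
      by rewrite -{1}[u]scale1r (dot_eql _ (S0lin _ _ _)) !dotE mul1r.
    have S00 w : b (S0 0) w = 0.
      by have := S0D 0 0 w; rewrite addr0 => ?; lra.
    have S0Z c u w : b (S0 (c *: u)) w = c * b (S0 u) w.
      by rewrite -[c *: u]addr0 (dot_eql _ (S0lin _ _ _)) !dotE S00 addr0.
    have S0N u w : b (S0 (- u)) w = - b (S0 u) w.
      by rewrite -scaleN1r S0Z mulN1r.
    apply/(feqP (Srep _) (represents_lin a (Srep _) (Srep _))) => /=.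
    split; apply/sqn_eqP => w; rewrite ?s1E ?s2E;
      rewrite !(S0eq _ _ _ e1) !(S0eq _ _ _ e2)/= !(S0D, S0N, S0Z);
      rewrite !(dotDl, dotBl, dotZl, dotNl) !(s1E, s2E)/=; ring.
  - pose M := (8 * (`|C| + x ^+ 2 + y ^+ 2 + 1)) * d ^- 2.
    have M0 : 0 <= M.
      rewrite mulr_ge0 ?invr_ge0 ?sqr_ge0//.
      by have := sqr_ge0 x; have := sqr_ge0 y; lra.
    exists (Num.sqrt M) => f fH; rewrite (fnormP (Srep f)) (fnormP (hrp _ fH))/=.
    rewrite -EFinM lee_fin -sqrtrM// ler_wsqrtr//.
    case: (rp f) => u v /=.
    have hB w : sqn b (B (S0 w)) <= (2 * `|C| + 2 * x ^+ 2) * (d ^- 2 * sqn b w).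
      apply: le_trans (Bd _) _.
      apply: (@le_trans _ _ ((2 * `|C| + 2 * x ^+ 2) * sqn b (S0 w))).
        by rewrite ler_wpM2r ?sqn_ge0// lerD2r ler_pM2l// ler_norm.
      by rewrite ler_wpM2l//; have := sqr_ge0 x; have := normr_ge0 C; lra.
    have h1 : sqn b (s1 (u, v)) <= 2 * sqn b (B (S0 u)) + 2 * (y ^+ 2 * sqn b (S0 v)).
      by rewrite -sqnZ s1D; exact: sqnB_le.
    have h2 : sqn b (s2 (u, v)) <= 2 * sqn b (B (S0 v)) + 2 * (y ^+ 2 * sqn b (S0 u)).
      by rewrite -sqnZ s2D; exact: sqnD_le.
    have hy w : y ^+ 2 * sqn b (S0 w) <= y ^+ 2 * (d ^- 2 * sqn b w).
      by rewrite ler_wpM2l// sqr_ge0.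
    have := hB u; have := hB v; have := hy u; have := hy v.
    have -> : M * (sqn b u + sqn b v) = 8 * (`|C| + x ^+ 2 + y ^+ 2 + 1) *
        (d ^- 2 * sqn b u + d ^- 2 * sqn b v) by rewrite /M; ring.
    have k0 w : 0 <= d ^- 2 * sqn b w.
      by rewrite mulr_ge0 ?sqn_ge0// invr_ge0 sqr_ge0.
    move: (k0 u) (k0 v) h1 h2.
    move: (d ^- 2 * sqn b u) (d ^- 2 * sqn b v) => k l kp lp.
    have := mulr_ge0 (normr_ge0 C) kp; have := mulr_ge0 (normr_ge0 C) lp.
    have := mulr_ge0 (sqr_ge0 x) kp; have := mulr_ge0 (sqr_ge0 x) lp.
    have := mulr_ge0 (sqr_ge0 y) kp; have := mulr_ge0 (sqr_ge0 y) lp.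
    lra.
move=> f fH; have hf := hrp _ fH; split.
  have hs := shift_represents hf.
  have sH : fmem H (Defs.shift Op z f) by apply/fmemP; eexists; exact: hs.
  have [e1 e2] := represents_uniq (hrp _ sH) hs.
  move: (rp (Defs.shift Op z f)) e1 e2 (Srep (Defs.shift Op z f)) => uv /= e1 e2 hS.
  have BS0 u w : b (S0 u) (B (T1 w)) = b u (B w).
    by rewrite -Bsym -T1sym BT1 S0E.
  have T1s1 w : b (T1 (s1 uv)) w = b uv.1 (B w) - y * b uv.2 w.
    by rewrite T1sym s1E BS0 -T1sym S0E.
  have T1s2 w : b (T1 (s2 uv)) w = b uv.2 (B w) + y * b uv.1 w.
    by rewrite T1sym s2E BS0 -T1sym S0E.
  have T1B u v w : b (T1 (u - v)) w = b (T1 u) w - b (T1 v) w.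
    by rewrite T1sym dotBl -!T1sym.
  apply/(feqP hS hf) => /=; split; apply: T1inj; rewrite T1B ?T1s1 ?T1s2;
    rewrite !(dot_eql _ e1) !(dot_eql _ e2) !dotDl !dotNl !dotZl.
    by rewrite !Bsym; ring.
  by rewrite !Bsym; ring.
have hs := shift_represents (Srep f).
have S0T u w : b (S0 u) (B (B w)) + y ^+ 2 * b (S0 u) w = b u w.
  by rewrite -[RHS]S0E T1sym /T1 dotDr dotZr.
apply/(feqP hs hf) => /=; split; apply/sqn_eqP => w.
  by rewrite dotDl dotZl Bsym s1E s2E -[RHS]S0T; ring.
by rewrite dotBl dotZl Bsym s1E s2E -[RHS]S0T; ring.
Qed.

(** The resolvent recovers a real vector [u] from [(A - z) u], so its norm bounds [u]. *)
Lemma bounded_below_of_resolvent : resolvent_set H Op z ->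
  exists2 d, 0 < d & forall u, d * sqn b u <= sqn b (B u) + y ^+ 2 * sqn b u.
Proof.
move=> [S [[S1 S2 [M hM]] hS]].
exists ((M ^+ 2 + 1)^-1) => [|u]; first by rewrite invr_gt0 ltr_wpDl// sqr_ge0.
pose f p := rep u p +i* rep 0 p.
have hf : represents f (u, 0) by [].
have fH : fmem H f by apply/fmemP; exists (u, 0).
have hs := shift_represents hf.
have sH : fmem H (Defs.shift Op z f) by apply/fmemP; eexists; exact: hs.
have /fmemP[wz hwz] := S1 _ sH.
have [/(feqP hwz hf)[e1 e2] _] := hS _ fH.
have B0 : sqn b (B 0) = 0.
  apply/eqP; rewrite eq_le sqn_ge0 andbT.
  by have := Bd 0; rewrite sqn0 mulr0.
have := hM _ sH; rewrite (fnormP hwz) (fnormP hs)/=.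
rewrite (sqn_eq e1) (sqn_eq e2) sqn0 addr0 -EFinM lee_fin scaler0 addr0 => h.
have {h} : sqn b u <= M ^+ 2 * (sqn b (B u) + sqn b (B 0 - y *: u)).
  have n0 : 0 <= sqn b (B u) + sqn b (B 0 - y *: u) by rewrite addr_ge0 ?sqn_ge0.
  rewrite -[leLHS]sqr_sqrtr ?sqn_ge0// -[X in _ * X]sqr_sqrtr// -exprMn.
  rewrite ler_sqr// ?nnegrE ?sqrtr_ge0//.
  by apply: le_trans h; rewrite sqrtr_ge0.
rewrite (@sqn_eq _ _ b (B 0 - y *: u) (- (y *: u))); last by rewrite opprK subrK.
rewrite sqnN sqnZ => h.
rewrite mulrC ler_pdivrMr ?ltr_wpDl ?sqr_ge0//.
apply: (le_trans h); rewrite [leRHS]mulrC ler_wpM2r ?lerDl//.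
by apply: addr_ge0; [|apply: mulr_ge0]; rewrite ?sqn_ge0 ?sqr_ge0.
Qed.

End shifted.

(** For [z] off the real axis [y ^+ 2] is a lower bound for [B^2 + y^2]; on the real axis a lower
    bound for [B^2] is the square of one for [B]. *)
Theorem spec_symmetricP z : Defs.spec H Op z <->
  complex.Im z = 0 /\ ~ bounded_below b (fun u => A u - complex.Re z *: u).
Proof.
split=> [nres|[y0 nb] res].
  split.
    apply/eqP; apply: contrapT => /negP y0; apply: nres.
    apply: (resolvent_of_bounded_below (fun=> erefl)).
    exists (complex.Im z ^+ 2) => [|u]; first by rewrite lt_def sqrf_eq0 y0 sqr_ge0.
    by rewrite lerDr sqn_ge0.
  move=> [d d0 hd]; apply: nres; apply: (resolvent_of_bounded_below (fun=> erefl)).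
  exists d => // u; apply: (le_trans (hd u)).
  by rewrite lerDl mulr_ge0 ?sqr_ge0 ?sqn_ge0.
apply: nb; have [d d0 hd] := bounded_below_of_resolvent (fun=> erefl) res.
by exists d => // u; have := hd u; rewrite y0 expr0n/= mul0r addr0.
Qed.

End complexification.

(** * Real square integrable functions *)

Fact le12 (R : realType) : (1 <= 2%:E :> \bar R)%E.
Proof. by rewrite lee_fin ler1n. Qed.

Notation L2 mu := (LfunType mu (le12 _)).

Section L2.
Context d (T : measurableType d) (R : realType).
Variable mu : {measure set T -> \bar R}.

Lemma Lfun2P (f : T -> R) : f \in Lfun mu 2%:E <->
  measurable_fun setT f /\ (\int[mu]_x (f x ^+ 2)%:E < +oo)%E.
Proof.
split=> [fL|[mf hf]].
  have /integrableP[_ h] := Lfun2_integrable_sqr fL.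
  split; first by move: fL; rewrite inE => /andP[]; rewrite inE.
  apply: le_lt_trans h; rewrite le_eqVlt; apply/orP; left; apply/eqP.
  by apply: eq_integral => x _ /=; rewrite ger0_norm// sqr_ge0.
rewrite inE; apply/andP; split; first by rewrite inE.
rewrite inE /finite_norm unlock /Lnorm/=.
apply: poweR_lty; apply: le_lt_trans hf.
rewrite le_eqVlt; apply/orP; left; apply/eqP.
by apply: eq_integral => x _ /=; rewrite powR_mulrn// real_normK// num_real.
Qed.

Lemma L2_measurable (u : L2 mu) : measurable_fun setT u.
Proof. by have /Lfun2P[] := LfunP u. Qed.

Lemma L2_finite (u : L2 mu) : (\int[mu]_x (u x ^+ 2)%:E < +oo)%E.
Proof. by have /Lfun2P[] := LfunP u. Qed.

Definition L2mk (f : T -> R) (mf : measurable_fun setT f)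
    (ff : (\int[mu]_x (f x ^+ 2)%:E < +oo)%E) : L2 mu :=
  Lfun_Sub (le12 R) ((Lfun2P f).2 (conj mf ff)).

Lemma L2_mul_integrable (u v : L2 mu) :
  mu.-integrable setT (EFin \o (fun x => u x * v x)).
Proof.
by have /Lfun1_integrable := Lfun2_mul_Lfun1 (LfunP u) (LfunP v).
Qed.

Lemma L2_sqr_integrable (u : L2 mu) :
  mu.-integrable setT (EFin \o (fun x => u x ^+ 2)).
Proof. exact: (L2_mul_integrable u u). Qed.

Definition l2_dot (u v : L2 mu) : R := \int[mu]_x (u x * v x).

Fact l2_dotC u v : l2_dot u v = l2_dot v u.
Proof. by apply: eq_Rintegral => x _; rewrite mulrC. Qed.

Fact l2_dotP a u v w : l2_dot (a *: u + v) w = a * l2_dot u w + l2_dot v w.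
Proof.
rewrite /l2_dot -RintegralZl//; last exact: L2_mul_integrable.
rewrite -RintegralD//; first last.
- exact: L2_mul_integrable.
- apply: eq_integrable (L2_mul_integrable (a *: u) w) => // x _ /=.
  by rewrite mulrA.
by apply: eq_Rintegral => x _; rewrite /= mulrDl mulrA.
Qed.

Fact l2_dot_ge0 u : 0 <= l2_dot u u.
Proof. by apply: Rintegral_ge0 => x _; rewrite -expr2 sqr_ge0. Qed.

Definition l2_ip := SemiIp l2_dotC l2_dotP l2_dot_ge0.

Lemma l2_dotE u v : (l2_ip u v)%:E = (\int[mu]_x (u x * v x)%:E)%E.
Proof.
rewrite /= /l2_dot /Rintegral fineK//.
by apply: integrable_fin_num => //; exact: L2_mul_integrable.
Qed.

Lemma l2_sqnE u : (sqn l2_ip u)%:E = (\int[mu]_x (u x ^+ 2)%:E)%E.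
Proof. exact: l2_dotE. Qed.

End L2.

Section L2_complete.
Context d (T : measurableType d) (R : realType).
Variable mu : {measure set T -> \bar R}.

(** Cauchy-Schwarz with weights [r ^+ j]: the weighted sum of squared increments is integrable for
    the sequences considered below, so this gives pointwise convergence and a majorant at once. *)
Lemma geometric_telescope (r : R) (a : nat -> R) k n : 0 < r < 1 ->
  (a (n + k)%N - a k) ^+ 2 <= r ^+ k / (1 - r) *
    \sum_(k <= j < n + k) (r ^- j * (a j.+1 - a j) ^+ 2).
Proof.
move=> /andP[r0 r1]; have r1' : 0 < 1 - r by rewrite subr_gt0.
elim: n k => [|n IH] k; first by rewrite add0n subrr expr0n/= big_geq// mulr0.
have kn : (k < n.+1 + k)%N by rewrite addSn ltnS leq_addl.
rewrite (big_ltn kn) addSn; have := IH k.+1; rewrite addnS;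
  set W := \sum_(k.+1 <= j < _) _ => {}IH.
set b := a k.+1 - a k; set D := a (n + k).+1 - a k.+1.
have -> : a (n + k).+1 - a k = b + D by rewrite /b /D; ring.
have rk : r ^+ k != 0 by rewrite expf_neq0// gt_eqF.
rewrite mulrDr.
have -> : r ^+ k / (1 - r) * (r ^- k * b ^+ 2) = b ^+ 2 / (1 - r).
  by field; rewrite gt_eqF// rk.
have h1 : r^-1 * D ^+ 2 <= r ^+ k / (1 - r) * W.
  rewrite mulrC ler_pdivrMr//; apply: (le_trans IH).
  by rewrite exprS le_eqVlt; apply/orP; left; apply/eqP; ring.
apply: (@le_trans _ _ (b ^+ 2 / (1 - r) + r^-1 * D ^+ 2)); last by rewrite lerD2l.
rewrite -subr_ge0.
have -> : b ^+ 2 / (1 - r) + r^-1 * D ^+ 2 - (b + D) ^+ 2 =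
    (r * b - (1 - r) * D) ^+ 2 / (r * (1 - r)).
  by field; rewrite !gt_eqF.
by rewrite divr_ge0 ?sqr_ge0// mulr_ge0// ltW.
Qed.

(** The limit is an explicit pointwise expression in the sequence; hence identities between values
    that hold along the sequence hold for the limit at every point, not only almost everywhere. *)
Theorem L2_geometrically_complete (u : nat -> L2 mu) (C r : R) :
  0 <= r < 1 -> (forall k, sqn (l2_ip mu) (u k.+1 - u k) <= C * r ^+ k) ->
  exists v : L2 mu,
    (forall x, v x = fine (limn_esup (fun k => (u k x)%:E))) /\
    forall e, 0 < e -> exists N, forall k, (N <= k)%N ->
      sqn (l2_ip mu) (u k - v) <= e.
Proof.
move=> /andP[r0 r1] hu.
have C0 : 0 <= C by have := hu 0%N; rewrite expr0 mulr1; apply: le_trans; exact: sqn_ge0.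
(* A rate strictly between [r] and [1]: the weights [s ^- k] still leave a convergent series. *)
have [s [s0 s1 rs]] : exists s, [/\ 0 < s, s < 1 & r < s].
  by exists ((1 + r) / 2); split; lra.
pose w k x := ((s ^- k * (u k.+1 x - u k x) ^+ 2)%:E : \bar R).
have w0 k x : (0 <= w k x)%E.
  by rewrite lee_fin mulr_ge0 ?sqr_ge0// invr_ge0 exprn_ge0// ltW.
have mu_ k : measurable_fun setT (u k) by exact: L2_measurable.
have mw k : measurable_fun setT (w k).
  apply/measurable_EFinP; apply: measurable_funM => //.
  by apply: measurable_funX; exact: measurable_funB.
pose W x := (\sum_(k <oo) w k x)%E.
have W0 x : (0 <= W x)%E by exact: nneseries_ge0.
have mW : measurable_fun setT W by exact: ge0_emeasurable_sum.
pose v x := fine (limn_esup (fun k => (u k x)%:E)).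
have mv : measurable_fun setT v.
  apply: measurableT_comp => //.
  by apply: measurable_fun_limn_esup => k; exact/measurable_EFinP.
have intW : (\int[mu]_x W x <= (C * (1 - r / s)^-1)%:E)%E.
  rewrite integral_nneseries//.
  have q0 : 0 <= r / s by rewrite divr_ge0// ltW.
  have q1 : r / s < 1 by rewrite ltr_pdivrMr// mul1r.
  apply: lime_le.
    by apply: is_cvg_nneseries => k _ _; exact: integral_ge0.
  apply: nearW => n.
  have wE k : (\int[mu]_x w k x <= (C * (r / s) ^+ k)%:E)%E.
    have -> : (\int[mu]_x w k x = (s ^- k * sqn (l2_ip mu) (u k.+1 - u k))%:E)%E.
      rewrite EFinM l2_sqnE -ge0_integralZl//.
      - apply/measurable_EFinP; apply: measurable_funX; exact: L2_measurable.
      - by move=> x _; rewrite lee_fin sqr_ge0.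
      - by rewrite lee_fin invr_ge0 exprn_ge0// ltW.
    rewrite lee_fin; apply: (@le_trans _ _ (s ^- k * (C * r ^+ k))).
      by rewrite ler_wpM2l// invr_ge0 exprn_ge0// ltW.
    by rewrite expr_div_n mulrCA (mulrC (s ^- k)).
  apply: (@le_trans _ _ (\sum_(0 <= k < n) (C * (r / s) ^+ k)%:E)%E).
    by apply: lee_sum => k _.
  rewrite sumEFin lee_fin -mulr_sumr ler_wpM2l//.
  have q1' : 0 < 1 - r / s by rewrite subr_gt0.
  rewrite -[leRHS]mul1r ler_pdivlMr//.
  have -> : (\sum_(0 <= i < n) (r / s) ^+ i) * (1 - r / s) = 1 - (r / s) ^+ n.
    by rewrite big_mkord mulrC -opprB mulNr -subrX1 opprB.
  by rewrite gerBl exprn_ge0.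
have vlim x k : W x \is a fin_num ->
    (((u k x - v x) ^+ 2)%:E <= (s ^+ k / (1 - s))%:E * W x)%E.
  move=> Wfin; pose a j := u j x.
  have ha m j : (a (m + j)%N - a j) ^+ 2 <= s ^+ j / (1 - s) * fine (W x).
    have s01 : 0 < s < 1 by rewrite s0.
    apply: (le_trans (geometric_telescope a j m s01)).
    apply: ler_wpM2l; first by rewrite divr_ge0 ?exprn_ge0 ?subr_ge0// ltW.
    rewrite -lee_fin fineK// -sumEFin.
    have := @nneseries_lim_ge _ (fun i => w i x) predT 0%N (m + j)%N (fun i _ _ => w0 i x).
    by apply: le_trans; rewrite [leRHS](@big_cat_nat _ _ _ j)//= ?leq_addl// leeDr// sume_ge0.
  have cva : cvgn a.
    apply/cauchy_cvgP/cauchy_exP => e e0.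
    have := geometric_small (C := fine (W x) / (1 - s)) (r := s) (e := e ^+ 2 / 4).
    move=> []//.
    - by rewrite divr_ge0 ?subr_ge0 ?fine_ge0// ltW.
    - by rewrite s1 ltW.
    - by rewrite divr_gt0 ?exprn_gt0.
    move=> N hN; exists (a N); exists N => // m /= Nm.
    rewrite /ball/= -(@ltr_pXn2r _ 2)// ?nnegrE//; last exact: ltW.
    rewrite real_normK ?num_real// -[_ ^+ 2]sqrrN opprB.
    rewrite -(subnK Nm); apply: le_lt_trans (ha _ _) _.
    have := hN N (leqnn N).
    rewrite (_ : _ * s ^+ N = s ^+ N / (1 - s) * fine (W x)); last by ring.
    move=> /le_lt_trans; apply.
    by rewrite ltr_pdivrMr// ltr_pMr ?exprn_gt0//; lra.
  have av : a @ \oo --> v x.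
    have /cvg_ex[l al] := cva.
    suff -> : v x = l by [].
    rewrite /v; have /cvg_limn_einf_sup[_ ->//] : (fun k => (u k x)%:E) @ \oo --> l%:E.
    by apply: cvg_EFin; [exact: nearW|exact: al].
  rewrite -(fineK Wfin) -EFinM lee_fin.
  have h : (fun m => (a m - a k) ^+ 2) @ \oo --> (v x - a k) ^+ 2.
    by rewrite expr2; under eq_fun do rewrite expr2; apply: cvgM;
      apply: cvgB => //; exact: cvg_cst.
  rewrite -sqrrN opprB -(cvg_lim _ h)//; apply: limr_le; first exact: cvgP h.
  by exists k => // m /= km; rewrite -(subnK km).
have vk k : (\int[mu]_x ((u k x - v x) ^+ 2)%:E <=
    (s ^+ k / (1 - s) * (C * (1 - r / s)^-1))%:E)%E.
  have c0 : 0 <= s ^+ k / (1 - s) by rewrite divr_ge0 ?exprn_ge0 ?subr_ge0// ltW.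
  rewrite EFinM; apply: (@le_trans _ _ ((s ^+ k / (1 - s))%:E * \int[mu]_x W x)%E); last first.
    by rewrite lee_wpmul2l// lee_fin.
  rewrite -ge0_integralZl//.
  apply: ae_ge0_le_integral => //.
  - by move=> x _; rewrite lee_fin sqr_ge0.
  - by apply/measurable_EFinP; apply: measurable_funX; exact: measurable_funB.
  - by move=> x _; rewrite mule_ge0// lee_fin.
  - exact: measurable_funeM.
  have : {ae mu, forall x, setT x -> W x \is a fin_num}.
    apply: integrable_ae => //; apply/integrableP; split => //.
    rewrite (eq_integral W); first exact: le_lt_trans intW (ltry _).
    by move=> x _; rewrite gee0_abs.
  by apply: filterS => x /(_ I) hx _; exact: vlim.
have vfin : (\int[mu]_x (v x ^+ 2)%:E < +oo)%E.
  apply: (@le_lt_trans _ _ (\int[mu]_x (2%:E * (u 0%N x ^+ 2)%:E +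
      2%:E * ((u 0%N x - v x) ^+ 2)%:E))%E).
    apply: ge0_le_integral => //.
    - by move=> x _; rewrite lee_fin sqr_ge0.
    - by apply/measurable_EFinP; exact: measurable_funX.
    - apply: emeasurable_funD; apply: measurable_funeM; apply/measurable_EFinP.
        exact: measurable_funX.
      by apply: measurable_funX; exact: measurable_funB.
    move=> x _; rewrite -!EFinM -EFinD lee_fin.
    rewrite -subr_ge0.
    have -> : 2 * u 0%N x ^+ 2 + 2 * (u 0%N x - v x) ^+ 2 - v x ^+ 2 =
      (2 * u 0%N x - v x) ^+ 2 by ring.
    exact: sqr_ge0.
  rewrite ge0_integralD//.
  - rewrite !ge0_integralZl//.
    + apply: lte_add_pinfty.
        by rewrite lte_mul_pinfty//; exact: L2_finite.
      by rewrite lte_mul_pinfty//; apply: le_lt_trans (vk 0%N) (ltry _).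
    + by apply/measurable_EFinP; apply: measurable_funX; exact: measurable_funB.
    + by move=> x _; rewrite lee_fin sqr_ge0.
    + by apply/measurable_EFinP; exact: measurable_funX.
    + by move=> x _; rewrite lee_fin sqr_ge0.
  - by move=> x _; rewrite mule_ge0// lee_fin sqr_ge0.
  - by apply: measurable_funeM; apply/measurable_EFinP; exact: measurable_funX.
  - by move=> x _; rewrite mule_ge0// lee_fin sqr_ge0.
  - apply: measurable_funeM; apply/measurable_EFinP.
    by apply: measurable_funX; exact: measurable_funB.
exists (L2mk mv vfin); split=> // e e0.
have K0 : 0 <= (C * (1 - r / s)^-1) / (1 - s).
  apply: divr_ge0; last by rewrite subr_ge0 ltW.
  by rewrite mulr_ge0// invr_ge0 subr_ge0 ler_pdivrMr// mul1r ltW.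
have s01 : 0 <= s < 1 by rewrite s1 ltW.
have [N hN] := geometric_small K0 s01 e0.
exists N => k Nk; rewrite -lee_fin l2_sqnE; apply: (le_trans (vk k)).
rewrite lee_fin; apply: le_trans (hN k Nk).
by rewrite le_eqVlt; apply/orP; left; apply/eqP; ring.
Qed.

End L2_complete.

(** * Integration on products and on countable sets *)

Section Rintegral_extra.
Context d (T : measurableType d) (R : realType).
Variable mu : {measure set T -> \bar R}.

(** If a part of [f] has infinite integral, then the extended integral is infinite and its finite
    part is zero.  Thus the real integral is a total, homogeneous operation on measurable functions,
    and the operators below can be defined pointwise. *)
Lemma Rintegral_nonintegrable (f : T -> R) : measurable_fun setT f ->
  ~ mu.-integrable setT (EFin \o f) -> \int[mu]_x f x = 0.
Proof.
move=> mf nf; rewrite /Rintegral integralE.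
have mf' : measurable_fun setT (EFin \o f) by exact/measurable_EFinP.
have h1 : (0 <= \int[mu]_x (EFin \o f)^\+%E x)%E by exact: integral_ge0.
have h2 : (0 <= \int[mu]_x (EFin \o f)^\-%E x)%E by exact: integral_ge0.
move: h1 h2; rewrite /comp.
set p := (\int[mu]_x _)%E; set n := (\int[mu]_x _)%E => p0 n0.
have [pf|] := boolP (p \is a fin_num); last first.
  by rewrite ge0_fin_numE// -leNgt leye_eq => /eqP ->; case: n {n0}.
have [nfin|] := boolP (n \is a fin_num); last first.
  rewrite ge0_fin_numE// -leNgt leye_eq => /eqP ->.
  by move: pf; case: p {p0}.
exfalso; apply: nf; apply/integrableP; split => //.
under eq_integral do rewrite -/((abse \o (EFin \o f)) _) fune_abse.
rewrite ge0_integralD//; [|exact: measurable_funepos|exact: measurable_funeneg].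
by apply: lte_add_pinfty; rewrite -ge0_fin_numE.
Qed.

Lemma RintegralZl_total (a : R) (f : T -> R) : measurable_fun setT f ->
  \int[mu]_x (a * f x) = a * \int[mu]_x f x.
Proof.
move=> mf; have [->|a0] := eqVneq a 0.
  rewrite mul0r (eq_Rintegral _ (g := cst 0)) ?Rintegral_cst ?mul0r// => x _ /=.
  by rewrite mul0r.
have [fi|nfi] := pselect (mu.-integrable setT (EFin \o f)).
  exact: RintegralZl.
rewrite [in RHS]Rintegral_nonintegrable// mulr0 Rintegral_nonintegrable//.
  exact: measurable_funM.
move=> h; apply: nfi.
have := integrableZl measurableT a^-1 h; apply: eq_integrable => // x _ /=.
by rewrite -EFinM mulrA mulVf// mul1r.
Qed.

Lemma ae_eq_Rintegral (f g : T -> R) : measurable_fun setT f ->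
  measurable_fun setT g -> {ae mu, forall x, f x = g x} ->
  \int[mu]_x f x = \int[mu]_x g x.
Proof.
move=> mf mg fg; rewrite /Rintegral; congr fine; apply: ae_eq_integral => //.
- exact/measurable_EFinP.
- exact/measurable_EFinP.
- by apply: filterS fg => x -> _.
Qed.

End Rintegral_extra.

Section Rfubini.
Context d1 d2 (T1 : measurableType d1) (T2 : measurableType d2) (R : realType).
Variable m1 : {sigma_finite_measure set T1 -> \bar R}.
Variable m2 : {sigma_finite_measure set T2 -> \bar R}.

Lemma measurable_Rintegral1 (g : T1 * T2 -> R) : measurable_fun setT g ->
  measurable_fun setT (fun x => \int[m2]_y g (x, y)).
Proof.
move=> mg; have mg' : measurable_fun setT (EFin \o g) by exact/measurable_EFinP.
have FE : fubini_F m2 (EFin \o g) =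
    (fubini_F m2 (EFin \o g)^\+ \- fubini_F m2 (EFin \o g)^\-)%E.
  apply/funext => x; rewrite [LHS]integralE.
  under eq_integral do rewrite funepos_comp/=.
  by under [X in (_ - X)%E = _]eq_integral do rewrite funeneg_comp/=.
have mF : measurable_fun setT (fubini_F m2 (EFin \o g)).
  by rewrite FE; apply: emeasurable_funB; apply: measurable_fun_fubini_tonelli_F => //;
    [exact: measurable_funepos|exact: measurable_funeneg].
exact: (measurableT_comp _ mF).
Qed.

Lemma Rfubini1 (g : T1 * T2 -> R) : (m1 \x m2)%E.-integrable setT (EFin \o g) ->
  \int[(m1 \x m2)%E]_z g z = \int[m1]_x \int[m2]_y g (x, y).
Proof.
move=> ig; rewrite /Rintegral -integral12_prod_meas1//; congr fine.
have iF := integrable_fubini_F ig.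
apply: ae_eq_integral => //.
- exact: measurable_int iF.
- apply/measurable_EFinP; apply: measurableT_comp => //.
  exact: measurable_int iF.
have := integrable_ae measurableT iF; apply: filterS => x /(_ I) hx _.
by rewrite /= fineK.
Qed.

Lemma integrable_Rintegral1 (g : T1 * T2 -> R) :
  (m1 \x m2)%E.-integrable setT (EFin \o g) ->
  m1.-integrable setT (EFin \o (fun x => \int[m2]_y g (x, y))).
Proof.
move=> ig; apply: le_integrable (integrable_fubini_F ig) => //.
  apply/measurable_EFinP; apply: measurable_Rintegral1.
  by have := measurable_int _ ig; move/measurable_EFinP.
move=> x _; rewrite /fubini_F/= /Rintegral.
by case: (\int[m2]_y (g (x, y))%:E)%E => [r| |] //=; rewrite normr0 ?leey.
Qed.

Lemma Rfubini2 (g : T1 * T2 -> R) : (m1 \x m2)%E.-integrable setT (EFin \o g) ->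
  \int[(m1 \x m2)%E]_z g z = \int[m2]_y \int[m1]_x g (x, y).
Proof.
move=> ig; rewrite /Rintegral -integral21_prod_meas1//; congr fine.
have iG : m2.-integrable setT (fubini_G m1 (EFin \o g)).
  apply/integrableP; split; first exact: (measurable_fubini_G ig).
  have mg := measurable_int _ ig.
  have h := (integrable21ltyP m1 m2 mg).1 ig.
  apply: le_lt_trans h; apply: ge0_le_integral => //.
  - by apply: measurableT_comp => //; exact: (measurable_fubini_G ig).
  - have -> : (fun y => \int[m1]_x `|(EFin \o g) (x, y)|)%E =
        fubini_G m1 (abse \o (EFin \o g)) by [].
    apply: measurable_fun_fubini_tonelli_G => //.
    - exact: (measurableT_comp (@abse_measurable R setT) mg).
    - by move=> z; exact: abse_ge0.
  move=> y _; apply: le_abse_integral => //.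
  by apply: measurableT_comp => //.
apply: ae_eq_integral => //.
- exact: measurable_int iG.
- apply/measurable_EFinP; apply: measurableT_comp => //.
  exact: measurable_int iG.
have := integrable_ae measurableT iG; apply: filterS => x /(_ I) hx _.
by rewrite /= fineK.
Qed.

End Rfubini.

(** A copy of a countable type that carries the discrete sigma-algebra.  The base point makes it a
    pointed type, as measurable types are. *)
Definition disc (I : countType) (i0 : I) : Type := I.

Section discrete.
Variables (I : countType) (i0 : I).
Local Notation disc := (disc i0).

HB.instance Definition _ := Countable.on disc.
HB.instance Definition _ := isPointed.Build disc i0.
HB.instance Definition _ := @isMeasurable.Build default_measure_display
  disc discrete_measurable discrete_measurable0
  discrete_measurableC discrete_measurableU.

Lemma measurable_fun_disc d (T : measurableType d) (f : disc -> T) :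
  measurable_fun setT f.
Proof. by move=> _ A _. Qed.

Definition fiber (n : nat) : set disc := [set i | pickle (i : I) = n].

Lemma bigcup_fiber : \bigcup_n fiber n = setT.
Proof. by apply/seteqP; split => // i _; exists (pickle (i : I)). Qed.

Lemma trivIset_fiber : trivIset setT fiber.
Proof.
apply/trivIsetP => m n _ _ mn; apply/seteqP; split => // i [im jn].
by move: mn; rewrite -im -jn eqxx.
Qed.

Lemma fiberE i n : fiber n i -> fiber n = [set i].
Proof.
move=> ini; apply/seteqP; split => [j jn|j ->//].
by apply: (pcan_inj (@pickleK I)); rewrite [LHS]jn.
Qed.

(** The domain is a countable union of slices, on which only the second variable moves. *)
Lemma measurable_fun_slices d d' (T : measurableType d) (U : measurableType d')
    (f : disc * T -> U) :
  (forall i, measurable_fun setT (fun t => f (i, t))) -> measurable_fun setT f.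
Proof.
move=> mf _ B mB; rewrite setTI.
rewrite (_ : f @^-1` B = \bigcup_n (\bigcup_(i in fiber n)
  ([set i] `*` (fun t => f (i, t)) @^-1` B))); last first.
  apply/seteqP; split => [[i t] /= Bf|[i t] [n _ [j jn]] /= [-> //]].
  by exists (pickle (i : I)) => //; exists i.
apply: bigcupT_measurable => n.
have [[i ini]|nf] := pselect (fiber n !=set0).
  rewrite (fiberE ini).
  rewrite bigcup_set1; apply: measurableX => //.
  by rewrite -[X in measurable X]setTI; exact: mf.
rewrite (_ : fiber n = set0) ?bigcup_set0//.
by apply/seteqP; split => // i hi; apply: nf; exists i.
Qed.

End discrete.

Section weighted_sum.
Variables (R : realType) (I : countType) (i0 : I) (w : I -> R).
Hypothesis w0 : forall i, 0 <= w i.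

Definition wsum (w0 : forall i, 0 <= w i) (A : set (disc i0)) : \bar R :=
  (\esum_(i in A) (w i)%:E)%E.

Let wsum0 : wsum w0 set0 = 0%E. Proof. exact: esum_set0. Qed.
Let wsum_ge0 A : (0 <= wsum w0 A)%E.
Proof. by apply: esum_ge0 => i _; rewrite lee_fin. Qed.
Let wsum_sigma_additive : semi_sigma_additive (wsum w0).
Proof.
move=> F _ tF _; have hw i : (0 <= (w i)%:E)%E by rewrite lee_fin.
rewrite /wsum (@esum_bigcupT _ _ _ _ _ tF hw).
rewrite -nneseries_esumT; last by move=> n; apply: wsum_ge0.
by apply: is_cvg_nneseries => n _ _; exact: wsum_ge0.
Qed.

HB.instance Definition _ := isMeasure.Build _ _ _ (wsum w0)
  wsum0 wsum_ge0 wsum_sigma_additive.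

Lemma wsum_set1 i : wsum w0 [set i] = (w i)%:E.
Proof. by rewrite /wsum esum_set1// lee_fin. Qed.

Let wsum_sigma_finite : sigma_finite setT (wsum w0).
Proof.
exists (@fiber I i0); first by rewrite bigcup_fiber.
move=> n; split => //.
have [[i ini]|nf] := pselect (@fiber I i0 n !=set0).
  by rewrite (fiberE ini) wsum_set1 ltry.
rewrite (_ : fiber n = set0) ?measure0//.
by apply/seteqP; split => // i hi; apply: nf; exists i.
Qed.

HB.instance Definition _ := Measure_isSigmaFinite.Build _ _ _ (wsum w0)
  wsum_sigma_finite.

Lemma integral_wsum (f : disc i0 -> \bar R) : (forall i, 0 <= f i)%E ->
  (\int[wsum w0]_i f i = \esum_(i in [set: I]) ((w i)%:E * f i))%E.
Proof.
move=> f0.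
rewrite -(bigcup_fiber i0) ge0_integral_bigcup//; last exact: trivIset_fiber.
have h i : (0 <= (w i)%:E * f i)%E by rewrite mule_ge0// lee_fin.
rewrite (@esum_bigcupT _ _ _ _ _ (@trivIset_fiber I i0) h).
rewrite nneseries_esumT; last by move=> n; exact: integral_ge0.
apply: eq_esum => n _.
have [[i ini]|nf] := pselect (@fiber I i0 n !=set0).
  rewrite (fiberE ini).
  rewrite esum_set1; last by rewrite mule_ge0// lee_fin.
  rewrite (eq_integral (cst (f i))); last by move=> j; rewrite inE => ->.
  rewrite integral_cst//= ?wsum_set1 1?muleC//.
rewrite (_ : fiber n = set0) ?esum_set0 ?integral_set0//.
by apply/seteqP; split => // i hi; apply: nf; exists i.
Qed.

End weighted_sum.

(** * The unit interval *)

(** The unit interval is a probability on the whole line, so that functions of [t] are total and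
    their values outside the interval never matter. *)
Definition U01 (R : realType) : probability (measurableTypeR R) R :=
  [the probability (measurableTypeR R) R of uniform_prob (@ltr01 R)].

Section unit_interval.
Variable R : realType.
Local Notation mu := (@lebesgue_measure R).
Local Notation U := (U01 R).

Lemma integral_U01 (f : measurableTypeR R -> \bar R) : measurable_fun setT f ->
  (forall x, 0 <= f x)%E -> (\int[U]_x f x = \int[mu]_(x in `[0%R, 1%R]) f x)%E.
Proof. by move=> mf f0; rewrite [LHS]integral_uniform// subr0 invr1 mul1e. Qed.

Lemma Rintegral_U01 (f : measurableTypeR R -> R) : measurable_fun setT f ->
  \int[U]_x f x = \int[mu]_(x in `[0, 1]) f x.
Proof.
move=> mf; rewrite /Rintegral integralE [in RHS]integralE !integral_U01//.
- by apply: measurable_funeneg; exact/measurable_EFinP.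
- by apply: measurable_funepos; exact/measurable_EFinP.
Qed.

Lemma ae_U01 (P : R -> Prop) : (forall t, 0 <= t <= 1 -> P t) ->
  {ae U, forall t, P t}.
Proof.
move=> hP; exists (~` `[0, 1]); split.
- exact: measurableC.
- rewrite /U01/= /uniform_prob integral_uniform_pdf setICl; exact: integral_set0.
- move=> t /= nP; rewrite in_itv/= => t01; exact: nP (hP _ t01).
Qed.

Lemma eq_U01 (f g : measurableTypeR R -> R) : measurable_fun setT f -> measurable_fun setT g ->
  (forall t, 0 <= t <= 1 -> f t = g t) -> \int[U]_x f x = \int[U]_x g x.
Proof. by move=> mf mg fg; apply: ae_eq_Rintegral => //; exact: ae_U01. Qed.

Lemma U01E (A : set R) : measurable A -> U A = mu (A `&` `[0, 1]).
Proof.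
move=> mA; have := @integral_U01 (EFin \o \1_A).
rewrite integral_indic// setIT => ->//.
- by rewrite integral_indic// setIC.
- by apply/measurable_EFinP; exact: measurable_indic.
- by move=> x; rewrite lee_fin.
Qed.

Definition flip (t : R) : R := 1 - t.

Lemma flipK : involutive flip.
Proof. by move=> t; rewrite /flip opprB addrC subrK. Qed.

Lemma measurable_flip : measurable_fun setT flip.
Proof. exact: measurable_funB. Qed.

Lemma flip01 t : 0 <= t <= 1 -> 0 <= flip t <= 1.
Proof. by rewrite /flip => /andP[? ?]; apply/andP; split; lra. Qed.

(** The reflection preserves the length of intervals, which determines Lebesgue measure. *)
Lemma lebesgue_flip (A : set R) : measurable A -> mu (flip @^-1` A) = mu A.
Proof.
move=> mA.
have mflip : measurable_fun setT (flip : measurableTypeR R -> measurableTypeR R).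
  exact: measurable_flip.
apply/esym.
rewrite -/(pushforward mu (flip : measurableTypeR R -> measurableTypeR R) A).
apply: lebesgue_measure_unique => //= _ [[a b]] _ <-.
rewrite /pushforward/=.
have -> : flip @^-1` `]a, b]%classic = `[1 - b, 1 - a[%classic.
  apply/seteqP; split => x /=; rewrite !in_itv/= /flip => /andP[h1 h2];
    by apply/andP; split; lra.
rewrite !lebesgue_measure_itv/= !lte_fin ltrD2l ltrN2.
by case: ifP => // _; rewrite -!EFinB; congr EFin; ring.
Qed.

Lemma U01_flip (A : set R) : measurable A -> U (flip @^-1` A) = U A.
Proof.
move=> mA; have mfA : measurable (flip @^-1` A).
  by rewrite -[X in measurable X]setTI; exact: measurable_flip.
rewrite !U01E// -[RHS]lebesgue_flip; last exact: measurableI.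
congr (mu _); apply/seteqP; split => x /= [Ax]; rewrite !in_itv/= => h; split => //.
  exact: flip01.
by rewrite -(flipK x); exact: flip01.
Qed.

Lemma ge0_integral_U01_flip (f : measurableTypeR R -> \bar R) : measurable_fun setT f ->
  (forall x, 0 <= f x)%E -> (\int[U]_x f (flip x) = \int[U]_x f x)%E.
Proof.
move=> mf f0.
have mflip : measurable_fun setT (flip : measurableTypeR R -> measurableTypeR R).
  exact: measurable_flip.
have := @ge0_integral_pushforward _ _ _ _ _ _ mflip U setT f measurableT mf.
rewrite preimage_setT => <-; last by [].
apply: eq_measure_integral => A mA _.
exact: U01_flip.
Qed.

Lemma Rintegral_U01_flip (f : measurableTypeR R -> R) : measurable_fun setT f ->
  \int[U]_x f (flip x) = \int[U]_x f x.
Proof.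
move=> mf; have mf' : measurable_fun setT (EFin \o f) by exact/measurable_EFinP.
rewrite /Rintegral (_ : (fun x => (f (flip x))%:E) = (EFin \o f) \o flip)//.
rewrite integralE [in RHS]integralE funepos_comp funeneg_comp.
rewrite -[X in _ = fine (X - _)%E]ge0_integral_U01_flip//; last exact: measurable_funepos.
rewrite -[X in _ = fine (_ - X)%E]ge0_integral_U01_flip//; last exact: measurable_funeneg.
Qed.

End unit_interval.

(** * The triangular integral operator *)

Section kernel.
Variable R : realType.
Local Notation U := (U01 R).
Local Notation mR := (measurableTypeR R).

Definition tri (s t : R) : R := if s + t <= 1 then 1 else 0.

Lemma triC s t : tri s t = tri t s.
Proof. by rewrite /tri addrC. Qed.

Lemma tri_sqr_le1 s t : tri s t ^+ 2 <= 1.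
Proof. by rewrite /tri; case: ifP => _; rewrite ?expr1n// expr0n. Qed.

Lemma measurable_tri d (T : measurableType d) (f g : T -> R) :
  measurable_fun setT f -> measurable_fun setT g ->
  measurable_fun setT (fun z => tri (f z) (g z)).
Proof.
move=> mf mg; apply: measurable_fun_ifT => //.
by apply: measurable_fun_ler => //; exact: measurable_funD.
Qed.

(** On the unit interval this is the integral of [h] over [[0, 1 - t]] (see [kintE]); the symmetric
    kernel [tri] makes symmetry of the operator and joint measurability visible. *)
Definition kint (h : mR -> R) (t : R) : R := \int[U]_s (tri s t * h s).

Lemma measurable_kint d (T : measurableType d) (h : T * mR -> R) (f : T -> R) :
  measurable_fun setT h -> measurable_fun setT f ->
  measurable_fun setT (fun z => kint (fun s => h (z, s)) (f z)).
Proof.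
move=> mh mf.
pose g (z : T * mR) := tri z.2 (f z.1) * h (z.1, z.2).
apply: (@measurable_Rintegral1 _ _ T mR R U g).
rewrite /g; apply: measurable_funM.
  by apply: measurable_tri => //; exact: measurableT_comp.
by under eq_fun do rewrite -surjective_pairing.
Qed.

Lemma U01_setT : U setT = 1%E. Proof. exact: probability_setT. Qed.

Lemma U01_cst (c : R) : \int[U]_s c = c.
Proof.
by rewrite Rintegral_cst//= U01_setT mulr1.
Qed.

Lemma kint_sqr_le (h : mR -> R) t : measurable_fun setT h ->
  ((kint h t ^+ 2)%:E <= \int[U]_s (h s ^+ 2)%:E)%E.
Proof.
move=> mh; have [hoo|] := ltP (\int[U]_s (h s ^+ 2)%:E)%E +oo%E; last first.
  by rewrite leye_eq => /eqP ->; rewrite leey.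
have mk : measurable_fun setT (tri ^~ t : mR -> R).
  by apply: measurable_tri => //; exact: measurable_cst.
have hk : (\int[U]_s (tri s t ^+ 2)%:E <= 1)%E.
  have -> : 1%E = (\int[U]_s 1)%E :> \bar R by rewrite integral_cst// mul1e; exact/esym/U01_setT.
  apply: ge0_le_integral => //.
  - by move=> s _; rewrite lee_fin sqr_ge0.
  - by apply/measurable_EFinP; exact: measurable_funX.
  - by move=> s _; rewrite lee_fin tri_sqr_le1.
pose u : L2 U := L2mk mk (le_lt_trans hk (ltry _)).
pose v : L2 U := L2mk mh hoo.
have := cauchy_schwarz (l2_ip U) u v; rewrite -lee_fin => /le_trans; apply.
rewrite EFinM !l2_sqnE/=.
by rewrite -[leRHS]mul1e lee_wpmul2r// integral_ge0// => s _; rewrite lee_fin sqr_ge0.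
Qed.

Lemma L2_U01_integrable (u : L2 U) : U.-integrable setT (EFin \o u).
Proof.
have f1 : (\int[U]_s ((cst 1 : mR -> R) s ^+ 2)%:E < +oo)%E.
  under eq_integral do rewrite expr1n.
  by rewrite integral_cst//= mul1e U01_setT ltry.
have := L2_mul_integrable u (L2mk (mu := U) (f := cst (1 : R)) (measurable_cst (1 : R)) f1).
by apply: eq_integrable => // s _ /=; rewrite mulr1.
Qed.

(** Fubini's theorem for the symmetric kernel [tri]. *)
Lemma kint_sym (u v : L2 U) :
  \int[U]_t (kint u t * v t) = \int[U]_t (u t * kint v t).
Proof.
pose g (z : mR * mR) := tri z.2 z.1 * (u z.2 * v z.1).
have mu_ := L2_measurable u; have mv_ := L2_measurable v.
have mtri t : measurable_fun setT (fun s : mR => tri s t).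
  by apply: measurable_tri; [exact: measurable_id|exact: measurable_cst].
have mg : measurable_fun setT g.
  apply: measurable_funM; first exact: measurable_tri.
  by apply: measurable_funM; exact: measurableT_comp.
have iu := L2_U01_integrable u; have iv := L2_U01_integrable v.
have ig : (U \x U)%E.-integrable setT (EFin \o g).
  apply/(integrable12ltyP U U); first exact/measurable_EFinP.
  have [_ iu2] := integrableP _ _ _ iu; have [_ iv2] := integrableP _ _ _ iv.
  have mau : measurable_fun setT (abse \o (EFin \o u)).
    by apply: measurableT_comp => //; exact/measurable_EFinP.
  have mav : measurable_fun setT (abse \o (EFin \o v)).
    by apply: measurableT_comp => //; exact/measurable_EFinP.
  apply: (@le_lt_trans _ _ (\int[U]_x ((\int[U]_y `|(u y)%:E|) * `|(v x)%:E|))%E).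
    apply: ge0_le_integral; first exact: measurableT.
    - by move=> x _; exact: integral_ge0.
    - apply: (measurable_fun_fubini_tonelli_F (m2 := U) (abse \o (EFin \o g))).
        by apply: measurableT_comp => //; exact/measurable_EFinP.
      by move=> z; exact: abse_ge0.
    - exact: measurable_funeM.
    move=> x _; rewrite muleC -ge0_integralZl//.
    apply: ge0_le_integral => //.
    - apply: measurableT_comp => //; apply/measurable_EFinP.
      exact: measurableT_comp mg _.
    - exact: measurable_funeM.
    move=> y _; rewrite -abseM lee_fin /g/= normrM mulrC (mulrC (v x)).
    by rewrite ler_piMr// /tri; case: ifP => _; rewrite ?normr1 ?normr0.
  rewrite ge0_integralZl//; last exact: integral_ge0.
  by apply: lte_mul_pinfty => //; rewrite ?integral_ge0// ge0_fin_numE// integral_ge0.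
have h1 := Rfubini1 ig; have h2 := Rfubini2 ig; rewrite h1 in h2.
transitivity (\int[U]_x \int[U]_y g (x, y)).
  apply: eq_Rintegral => t _; rewrite mulrC /kint -RintegralZl_total.
    by apply: eq_Rintegral => s _; rewrite /g/=; ring.
  exact: measurable_funM (mtri t) mu_.
rewrite h2; apply: eq_Rintegral => t _; rewrite /kint -RintegralZl_total.
  by apply: eq_Rintegral => s _; rewrite /g/= triC; ring.
exact: measurable_funM (mtri t) mv_.
Qed.

End kernel.

Arguments flip {R}.
Arguments tri {R}.
Arguments kint {R}.

(** * Functions fibered over the unit interval *)

Section unit_interval_operators.
Variable R : realType.
Local Notation U := (U01 R).
Local Notation mR := (measurableTypeR R).

Lemma integral_U01_cst (c : \bar R) : (\int[U]_s c = c)%E.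
Proof. by rewrite integral_cst//= U01_setT mule1. Qed.

Fact kint1_measurable (u : L2 U) : measurable_fun setT (kint u : mR -> R).
Proof.
have mu_ := L2_measurable u.
apply: (@measurable_kint R _ mR (fun z => u z.2) (fun t : mR => t)) => //.
exact: measurableT_comp.
Qed.

Fact kint1_finite (u : L2 U) : (\int[U]_t (kint u t ^+ 2)%:E < +oo)%E.
Proof.
apply: (@le_lt_trans _ _ (\int[U]_t (sqn (l2_ip U) u)%:E)%E).
  apply: ge0_le_integral => //.
  - by move=> t _; rewrite lee_fin sqr_ge0.
  - by apply/measurable_EFinP; apply: measurable_funX; exact: kint1_measurable.
  - by move=> t _; rewrite l2_sqnE; apply: kint_sqr_le; exact: L2_measurable.
by rewrite integral_U01_cst ltry.
Qed.

Definition kint_L2 (u : L2 U) : L2 U := L2mk (kint1_measurable u) (kint1_finite u).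

End unit_interval_operators.

Section fibered.
Context d (T : measurableType d) (R : realType).
Variable m : {sigma_finite_measure set T -> \bar R}.
Local Notation U := (U01 R).
Local Notation mR := (measurableTypeR R).
Local Notation H := (L2 (m \x U)%E).
Implicit Types f g : H.

Lemma tonelli_sqr (h : T * mR -> R) : measurable_fun setT h ->
  (\int[(m \x U)%E]_z (h z ^+ 2)%:E = \int[m]_x \int[U]_t (h (x, t) ^+ 2)%:E)%E.
Proof.
move=> mh; apply: (fubini_tonelli1 (EFin \o (fun z : T * mR => h z ^+ 2))).
  by apply/measurable_EFinP; apply: measurable_funX.
by move=> z; rewrite lee_fin sqr_ge0.
Qed.

Lemma sqn_fiberE f :
  (sqn (l2_ip _) f)%:E = (\int[m]_x \int[U]_t (f (x, t) ^+ 2)%:E)%E.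
Proof. by rewrite l2_sqnE; apply: tonelli_sqr; exact: L2_measurable. Qed.

Lemma dot_fiberE f g :
  l2_ip _ f g = \int[m]_x \int[U]_t (f (x, t) * g (x, t)).
Proof. by rewrite /=/l2_dot Rfubini1//; exact: L2_mul_integrable. Qed.

Lemma measurable_fiber (h : T * mR -> R) x : measurable_fun setT h ->
  measurable_fun setT (fun t : mR => h (x, t)).
Proof. by move=> mh; exact: measurableT_comp mh _. Qed.

(** An element of the product space restricts to a square integrable function on almost every fiber,
    which is how fiberwise statements are lifted. *)
Lemma ae_fiber_finite f :
  {ae m, forall x, (\int[U]_t (f (x, t) ^+ 2)%:E < +oo)%E}.
Proof.
have mf2 : measurable_fun setT (EFin \o (fun z : T * mR => f z ^+ 2)).
  by apply/measurable_EFinP; apply: measurable_funX; exact: L2_measurable.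
have h0 z : (0 <= (EFin \o (fun z : T * mR => (f z ^+ 2)%R)) z)%E by rewrite lee_fin sqr_ge0.
have mF := measurable_fun_fubini_tonelli_F (m2 := U) _ mf2 h0.
have : m.-integrable setT (fubini_F U (EFin \o (fun z : T * mR => f z ^+ 2))).
  apply/integrableP; split => //.
  rewrite (eq_integral (fubini_F U (EFin \o (fun z : T * mR => f z ^+ 2)))); last first.
    by move=> x _; rewrite gee0_abs// integral_ge0.
  by rewrite -fubini_tonelli1//; exact: L2_finite.
move=> /(integrable_ae measurableT); apply: filterS => x /(_ I).
by rewrite ge0_fin_numE// integral_ge0// => t _; rewrite lee_fin sqr_ge0.
Qed.

Definition fiber_L2 f x (hx : (\int[U]_t (f (x, t) ^+ 2)%:E < +oo)%E) : L2 U :=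
  L2mk (measurable_fiber x (L2_measurable f)) hx.

Definition fkint_fun (f : T * mR -> R) (z : T * mR) : R := kint (fun s => f (z.1, s)) z.2.

Fact fkint_fun_measurable (f : T * mR -> R) : measurable_fun setT f ->
  measurable_fun setT (fkint_fun f).
Proof.
move=> mf; apply: (@measurable_kint R _ (T * mR)%type (fun z => f (z.1.1, z.2))) => //.
apply: (measurableT_comp mf); apply: measurable_fun_pair => //.
exact: (measurableT_comp measurable_fst measurable_fst).
Qed.

Lemma fkint_fun_fiber_le (f : T * mR -> R) x : measurable_fun setT f ->
  (\int[U]_t (fkint_fun f (x, t) ^+ 2)%:E <= \int[U]_t (f (x, t) ^+ 2)%:E)%E.
Proof.
move=> mf; rewrite -[leRHS]integral_U01_cst.
apply: ge0_le_integral => //.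
- by move=> t _; rewrite lee_fin sqr_ge0.
- apply/measurable_EFinP; apply: measurable_funX.
  by apply: measurable_fiber; exact: fkint_fun_measurable.
- by move=> t _; apply: kint_sqr_le; exact: measurable_fiber.
Qed.

Lemma fkint_fun_sqr_le (f : T * mR -> R) : measurable_fun setT f ->
  (\int[(m \x U)%E]_z (fkint_fun f z ^+ 2)%:E <= \int[(m \x U)%E]_z (f z ^+ 2)%:E)%E.
Proof.
move=> mf.
have mK := fkint_fun_measurable mf.
have sq (h : T * mR -> R) : measurable_fun setT h -> measurable_fun setT (EFin \o (fun z : T * mR
  => h z ^+ 2)).
  by move=> mh; apply/measurable_EFinP; apply: measurable_funX.
have sq0 (h : T * mR -> R) z : (0 <= (EFin \o (fun z : T * mR => (h z ^+ 2)%R)) z)%E.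
  by rewrite lee_fin sqr_ge0.
rewrite (tonelli_sqr mK) (tonelli_sqr mf); apply: ge0_le_integral; first exact: measurableT.
- by move=> x _; apply: integral_ge0 => t _; rewrite lee_fin sqr_ge0.
- exact: (measurable_fun_fubini_tonelli_F (m2 := U) _ (sq _ mK) (sq0 _)).
- exact: (measurable_fun_fubini_tonelli_F (m2 := U) _ (sq _ mf) (sq0 _)).
- by move=> x _; exact: fkint_fun_fiber_le.
Qed.

Fact fkint_fun_finite f : (\int[(m \x U)%E]_z (fkint_fun f z ^+ 2)%:E < +oo)%E.
Proof. exact: le_lt_trans (fkint_fun_sqr_le (L2_measurable f)) (L2_finite f). Qed.

Definition fkint f : H := L2mk (fkint_fun_measurable (L2_measurable f)) (fkint_fun_finite f).

Lemma fkint_bounded : bounded_op (l2_ip _) fkint 1.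
Proof.
move=> f; rewrite mul1r -lee_fin !l2_sqnE.
exact: (fkint_fun_sqr_le (L2_measurable f)).
Qed.

Lemma fkint_sym : symmetric_op (l2_ip _) fkint.
Proof.
move=> f g; rewrite !dot_fiberE.
have mm (u v : H) : measurable_fun setT (fun x => \int[U]_t (u (x, t) * v (x, t))).
  apply: (@measurable_Rintegral1 _ _ T mR R U (fun z => u z * v z)).
  by apply: measurable_funM; exact: L2_measurable.
apply: ae_eq_Rintegral => //.
have hf := ae_fiber_finite f; have hg := ae_fiber_finite g.
apply: filterS2 hf hg => x hf hg.
exact: (kint_sym (fiber_L2 hf) (fiber_L2 hg)).
Qed.

Definition fflip_fun (f : T * mR -> R) (z : T * mR) : R := f (z.1, flip z.2).

Fact fflip_measurable (f : T * mR -> R) : measurable_fun setT f ->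
  measurable_fun setT (fflip_fun f).
Proof.
move=> mf; apply: (measurableT_comp mf); apply: measurable_fun_pair => //.
exact: (measurableT_comp (@measurable_flip R) measurable_snd).
Qed.

Lemma fflip_sqrE f : (\int[(m \x U)%E]_z (fflip_fun f z ^+ 2)%:E =
  \int[(m \x U)%E]_z (f z ^+ 2)%:E)%E.
Proof.
have mf := L2_measurable f.
rewrite (tonelli_sqr mf) (tonelli_sqr (fflip_measurable mf)).
apply: eq_integral => x _.
apply: (ge0_integral_U01_flip (f := fun t => (f (x, t) ^+ 2)%:E)) => //.
- by apply/measurable_EFinP; apply: measurable_funX; exact: measurable_fiber.
- by move=> t; rewrite lee_fin sqr_ge0.
Qed.

Fact fflip_finite f : (\int[(m \x U)%E]_z (fflip_fun f z ^+ 2)%:E < +oo)%E.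
Proof. by rewrite fflip_sqrE; exact: L2_finite. Qed.

Definition fflip f : H := L2mk (fflip_measurable (L2_measurable f)) (fflip_finite f).

Lemma fflipE f z : fflip f z = f (z.1, flip z.2). Proof. by []. Qed.

Lemma fflip_sqn f : sqn (l2_ip _) (fflip f) = sqn (l2_ip _) f.
Proof. by apply: EFin_inj; rewrite !l2_sqnE; exact: fflip_sqrE. Qed.

Lemma fflip_sym : symmetric_op (l2_ip _) fflip.
Proof.
move=> f g; rewrite !dot_fiberE; apply: eq_Rintegral => x _.
rewrite -[RHS]Rintegral_U01_flip; last first.
  apply: measurable_funM; apply: measurable_fiber; exact: L2_measurable.
by apply: eq_Rintegral => t _; rewrite !fflipE/= flipK.
Qed.

Section tensor.
Variables (g : L2 m) (S : L2 U).

Definition tensor_fun (z : T * mR) : R := g z.1 * S z.2.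

Fact tensor_measurable : measurable_fun setT tensor_fun.
Proof.
have mg := L2_measurable g; have mS := L2_measurable S.
by apply: measurable_funM; exact: measurableT_comp.
Qed.

Lemma tensor_sqrE : (\int[(m \x U)%E]_z (tensor_fun z ^+ 2)%:E =
  (sqn (l2_ip _) g * sqn (l2_ip _) S)%:E)%E.
Proof.
rewrite (tonelli_sqr tensor_measurable).
have mg := L2_measurable g; have mS := L2_measurable S.
rewrite EFinM muleC (l2_sqnE g) -ge0_integralZl//; last 3 first.
- by apply/measurable_EFinP; exact: measurable_funX.
- by move=> x _; rewrite lee_fin sqr_ge0.
- by rewrite lee_fin sqn_ge0.
apply: eq_integral => x _; rewrite (l2_sqnE S) muleC -ge0_integralZl//; last 3 first.
- by apply/measurable_EFinP; exact: measurable_funX.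
- by move=> t _; rewrite lee_fin sqr_ge0.
- by rewrite lee_fin sqr_ge0.
by apply: eq_integral => t _; rewrite exprMn EFinM.
Qed.

Fact tensor_finite : (\int[(m \x U)%E]_z (tensor_fun z ^+ 2)%:E < +oo)%E.
Proof. by rewrite tensor_sqrE ltry. Qed.

Definition tensor : H := L2mk tensor_measurable tensor_finite.

Lemma sqn_tensor : sqn (l2_ip _) tensor = sqn (l2_ip _) g * sqn (l2_ip _) S.
Proof. by apply: EFin_inj; rewrite l2_sqnE; exact: tensor_sqrE. Qed.

Lemma fkint_tensor z : fkint tensor z = g z.1 * kint S z.2.
Proof.
rewrite /fkint/= /fkint_fun /kint -RintegralZl_total; last first.
  apply: measurable_funM; last exact: L2_measurable.
  by apply: measurable_tri => //; exact: measurable_cst.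
by apply: eq_Rintegral => s _; exact: mulrCA.
Qed.

End tensor.
End fibered.

(** * Calculus of the triangular integral operator *)

Section kernel_calculus.
Variable R : realType.
Local Notation U := (U01 R).
Local Notation mR := (measurableTypeR R).
Local Notation mu := (@lebesgue_measure R).

Lemma measurable_tri1 (t : R) : measurable_fun setT (tri ^~ t : mR -> R).
Proof. by apply: measurable_tri => //; exact: measurable_cst. Qed.

Lemma kintE (h : mR -> R) t : measurable_fun setT h -> 0 <= t <= 1 ->
  kint h t = \int[mu]_(s in `[0, 1 - t]) h s.
Proof.
move=> mh /andP[t0 t1]; rewrite /kint Rintegral_U01; last first.
  by apply: measurable_funM => //; exact: measurable_tri1.
rewrite Rintegral_mkcond [RHS]Rintegral_mkcond; apply: eq_Rintegral => s _.
rewrite !patchE; case: ifPn => s01; case: ifPn => s1t.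
- move: s1t s01; rewrite !inE/= !in_itv/= => /andP[s0 s1t] _.
  by rewrite /tri ifT ?mul1r//; lra.
- move: s1t s01; rewrite notin_setE !inE/= !in_itv/= => s1t /andP[s0 s1].
  by rewrite /tri ifF ?mul0r//; apply/negP => h2; apply: s1t; apply/andP; split; lra.
- move: s1t s01; rewrite notin_setE !inE/= !in_itv/= => /andP[s0 s1t] s01.
  by exfalso; apply: s01; apply/andP; split; lra.
- by [].
Qed.

Lemma is_derive_affine (g g' : R -> R) (a b c : R) :
  (forall x : R, is_derive x (1 : R) g (g' x)) ->
  forall x : R, is_derive x (1 : R) (fun s => c * g (a * s + b))
                                   (c * (a * g' (a * x + b))).
Proof.
move=> dg x.
have lin (k l y : R) : is_derive y (1 : R) (fun s : R => k * s + l) k.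
  by apply: is_derive_eq; rewrite /= scaler1 addr0.
have h := @is_derive1_comp R g (fun s : R => a * s + b) x _ _ (dg _) (lin a b x).
have := is_derive1_comp (lin c 0 _) h.
rewrite (_ : _ \o _ = (fun s => c * g (a * s + b))); last first.
  by apply/funext => s /=; rewrite addr0.
by rewrite (mulrC a (g' _)).
Qed.

Lemma is_derive_continuous (F f : R -> R) :
  (forall x : R, is_derive x (1 : R) F (f x)) -> continuous F.
Proof.
move=> dF x; apply: differentiable_continuous; apply/derivable1_diffP.
by have [] := dF x.
Qed.

Lemma kint_FTC (f F : R -> R) t : (forall x : R, is_derive x (1 : R) F (f x)) ->
  continuous f -> 0 <= t <= 1 -> kint f t = F (1 - t) - F 0.
Proof.
move=> dF cf t01; rewrite kintE//; last exact: continuous_measurable_fun.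
have cF := is_derive_continuous dF.
have /andP[t0] := t01; rewrite le_eqVlt => /predU1P[->|t1].
  by rewrite subrr set_itv1 Rintegral_set1 subrr.
rewrite /Rintegral (@continuous_FTC2 _ f F)//.
- by rewrite subr_gt0.
- by apply: continuous_subspaceT.
- split.
  + by move=> x _; have [] := dF x.
  + by apply: cvg_at_right_filter; exact: cF.
  + by apply: cvg_at_left_filter; exact: cF.
- by move=> x _; rewrite derive1E; have [_ ->] := dF x.
Qed.

Lemma ae_U01_neq (x : R) : {ae U, forall s, s != x}.
Proof.
exists [set x]; split => //.
  apply/eqP; rewrite eq_le measure_ge0 andbT [leLHS]U01E//.
  by rewrite -(lebesgue_measure_set1 x) le_measure// inE//; exact: measurableI.
by move=> s /= /negP; rewrite negbK => /eqP.
Qed.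

(** The substitution [s -> 1 - s] turns the second term into the integral over [[1 - t, 1]]. *)
Lemma kint_complement (h : mR -> R) t : measurable_fun setT h ->
  U.-integrable setT (EFin \o h) ->
  kint h t + kint (h \o flip) (flip t) = \int[U]_s h s.
Proof.
move=> mh ih.
have mt (f : mR -> R) u : measurable_fun setT f ->
    measurable_fun setT (fun s => tri (f s) u * h s).
  by move=> mf; apply: measurable_funM => //; apply: measurable_tri.
have it (f : mR -> R) u : measurable_fun setT f ->
    U.-integrable setT (EFin \o (fun s => tri (f s) u * h s)).
  move=> mf; apply: le_integrable ih => //.
    by apply/measurable_EFinP; exact: mt.
  move=> s _ /=; rewrite lee_fin normrM ler_piMl// /tri.
  by case: ifP => _; rewrite ?normr1 ?normr0.
rewrite /kint -(Rintegral_U01_flip (f := fun s => tri s (flip t) * (h \o flip) s)); last first.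
  apply: measurable_funM; first exact: measurable_tri1.
  by apply: measurableT_comp => //; exact: measurable_flip.
under [X in _ + X]eq_Rintegral do rewrite /= flipK.
rewrite -RintegralD//; [|exact: (it id)|exact: (it flip _ (@measurable_flip R))].
apply: ae_eq_Rintegral => //.
  by apply: measurable_funD; [exact: (mt id)|exact: (mt flip _ (@measurable_flip R))].
apply: (@filterS _ _ (ae_filter_ringOfSetsType U) _ _ _ (ae_U01_neq (1 - t))) => s st.
rewrite -mulrDl -[RHS]mul1r; congr (_ * _); rewrite /tri /flip.
have [|] := leP (s + t) 1 => h1; have [|] := leP (1 - s + (1 - t)) 1 => h2; last first.
- lra.
- lra.
- lra.
- by exfalso; move/eqP: st; apply; lra.
Qed.

(** Since [tri] is its own square, Cauchy-Schwarz keeps the domain of integration.  The bound by the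
    integral up to [1 - t] only is what Gronwall's inequality needs. *)
Lemma kint_sqr_local (h : mR -> R) t : measurable_fun setT h ->
  U.-integrable setT (EFin \o (fun s => h s ^+ 2)) ->
  kint h t ^+ 2 <= kint (fun s => h s ^+ 2) t.
Proof.
move=> mh ih; have tt s : tri s t = tri s t ^+ 2.
  by rewrite /tri; case: ifP => _; rewrite ?expr1n ?expr0n.
have -> : kint h t = kint (fun s => tri s t * h s) t.
  by apply: eq_Rintegral => s _; rewrite mulrA -expr2 -tt.
have mth : measurable_fun setT (fun s : mR => tri s t * h s).
  by apply: measurable_funM => //; exact: measurable_tri1.
have mth2 : measurable_fun setT (fun s : mR => tri s t * h s ^+ 2).
  by apply: measurable_funM; [exact: measurable_tri1|exact: measurable_funX].
have ith : U.-integrable setT (EFin \o (fun s : mR => tri s t * h s ^+ 2)).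
  apply: le_integrable ih => //; first exact/measurable_EFinP.
  move=> s _ /=; rewrite lee_fin normrM ler_piMl// /tri.
  by case: ifP => _; rewrite ?normr1 ?normr0.
rewrite -lee_fin; apply: (le_trans (kint_sqr_le _ mth)).
rewrite /kint /Rintegral fineK; last exact: integrable_fin_num.
rewrite le_eqVlt; apply/orP; left; apply/eqP; apply: eq_integral => s _ /=.
by rewrite exprMn -tt.
Qed.

Lemma bounded_integrable_U01 (h : mR -> R) M : measurable_fun setT h ->
  (forall s, `|h s| <= M) -> U.-integrable setT (EFin \o h).
Proof.
move=> mh hM; apply/integrableP; split; first exact/measurable_EFinP.
apply: (@le_lt_trans _ _ (\int[U]_s M%:E)%E).
  apply: ge0_le_integral => //.
  - by apply: measurableT_comp => //; exact/measurable_EFinP.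
  - by move=> s _; rewrite lee_fin.
by rewrite integral_U01_cst ltry.
Qed.

(** In the supremum norm with weight [expR (- (2 * c * t))], the integral term is a contraction with
    factor one half. *)
Lemma gronwall (y : mR -> R) (A c M : R) : measurable_fun setT y -> 0 <= A -> 0 < c ->
  (forall t, 0 <= y t <= M) ->
  (forall t, 0 <= t <= 1 -> y t <= A + c * kint y (flip t)) ->
  forall t, 0 <= t <= 1 -> y t <= 2 * A * expR (2 * c * t).
Proof.
move=> my A0 c0 yM hy.
(* The weight [expR (- (L * t))] makes the contraction factor [c / L] one half. *)
pose L := 2 * c.
have L0 : 0 < L by rewrite mulr_gt0.
pose S := [set expR (- (L * t)) * y t | t in `[(0:R), 1]].
have M0 : 0 <= M by have /andP[? ?] := yM 0; lra.
have S0 : S !=set0 by exists (expR (- (L * 0)) * y 0); exists 0 => //=;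
  rewrite in_itv/= lexx ler01.
have Sb : ubound S M.
  move=> _ [t /= + <-]; rewrite in_itv/= => /andP[t0 t1].
  have /andP[y0 yt] := yM t; rewrite -[leRHS]mul1r ler_pM ?expR_ge0//.
  by rewrite -expR0 ler_expR oppr_le0 mulr_ge0// ltW.
pose m := sup S.
have ym t : 0 <= t <= 1 -> y t <= m * expR (L * t).
  move=> t01; rewrite -ler_pdivrMr ?expR_gt0// -expRN mulrC.
  apply: sup_ubound; first by exists M.
  by exists t => //=; rewrite in_itv.
have m0 : 0 <= m.
  have := ym 0; rewrite mulr0 expR0 mulr1 lexx ler01 => /(_ isT).
  by apply: le_trans; have /andP[] := yM 0.
have mexp : measurable_fun setT (fun s : mR => expR (L * s)).
  by apply: measurableT_comp => //; exact: measurable_funM.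
have hk t : 0 <= t <= 1 -> kint y (flip t) <= m * (expR (L * t) / L).
  move=> t01.
  have dE x : is_derive x (1 : R) (fun s => L^-1 * expR (L * s + 0)) (expR (L * x)).
    have := @is_derive_affine expR expR L 0 L^-1 (@is_derive_expR R) x.
    by rewrite mulrA mulVf ?gt_eqF// mul1r addr0.
  have cE : continuous (fun s => expR (L * s)).
    have dE' x : is_derive x (1 : R) (fun s => 1 * expR (L * s + 0)) (1 * (L * expR (L * x + 0))).
      exact: (@is_derive_affine expR expR L 0 1 (@is_derive_expR R)).
    have := is_derive_continuous dE'.
    by under eq_fun do rewrite mul1r addr0.
  have e1 : kint (fun s => expR (L * s)) (flip t) = expR (L * t) / L - 1 / L.
    rewrite (kint_FTC dE cE); last exact: flip01.
    by rewrite -/(flip (flip t)) flipK mulr0 !addr0 expR0; ring.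
  have tri01 (s u : R) : 0 <= tri s u <= 1.
    by rewrite /tri; case: ifP => _; rewrite lexx ler01.
  apply: (@le_trans _ _ (m * kint (fun s => expR (L * s)) (flip t))); last first.
    by rewrite ler_wpM2l// e1 gerBl divr_ge0// ltW.
  rewrite /kint -RintegralZl_total; last first.
    by apply: measurable_funM => //; exact: measurable_tri1.
  have bnd s : `|tri s (flip t) * y s| <= M.
    have /andP[y0 yM'] := yM s; have /andP[k0 k1] := tri01 s (flip t).
    by rewrite ger0_norm ?mulr_ge0//; apply: le_trans yM'; rewrite ler_piMl.
  have my1 : measurable_fun setT (fun s : mR => tri s (flip t) * y s).
    by apply: measurable_funM => //; exact: measurable_tri1.
  have ext s : 0 <= s <= 1 -> tri s (flip t) * y s <= m * (tri s (flip t) * expR (L * s)).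
    move=> s01; rewrite mulrCA ler_wpM2l ?ym//.
    by have /andP[] := tri01 s (flip t).
  rewrite !Rintegral_U01//; last first.
    apply: measurable_funM => //; apply: measurable_funM => //.
    exact: measurable_tri1.
  have mI : mu `[0, 1]%classic = 1%E.
    by rewrite lebesgue_measure_itv/= lte_fin ltr01 sube0.
  have bI (h : mR -> R) N : measurable_fun setT h -> (forall s, 0 <= s <= 1 -> `|h s| <= N) ->
      mu.-integrable `[0, 1]%classic (EFin \o h).
    move=> mh hN; apply/integrableP; split.
      by apply: measurable_funTS; exact/measurable_EFinP.
    apply: (@le_lt_trans _ _ (\int[mu]_(s in `[0%R, 1%R]) N%:E)%E).
      apply: ge0_le_integral => //.
      by apply: measurable_funTS; apply: measurableT_comp => //; exact/measurable_EFinP.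
    by rewrite integral_cst//= mI mule1 ltry.
  apply: le_Rintegral => //.
  - exact: (bI _ M).
  - apply: (bI _ (m * expR L)).
      apply: measurable_funM => //; apply: measurable_funM => //.
      exact: measurable_tri1.
    move=> s s01; have /andP[k0 k1] := tri01 s (flip t).
    rewrite ger0_norm; last by rewrite !mulr_ge0// expR_ge0.
    rewrite ler_wpM2l//; apply: (@le_trans _ _ (expR (L * s))).
      by rewrite ler_piMl// expR_ge0.
    by rewrite ler_expR ger_pMr//; case/andP: s01.
have : m <= A + m / 2.
  apply: ge_sup => // _ [t /= + <-]; rewrite in_itv/= => t01.
  have h1 := hy t t01; have h2 := hk t t01.
  rewrite mulrC expRN ler_pdivrMr ?expR_gt0//.
  have e1 : 1 <= expR (L * t).
    rewrite -expR0 ler_expR mulr_ge0//; first exact: ltW.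
    by case/andP: t01.
  have h3 : c * kint y (flip t) <= m / 2 * expR (L * t).
    apply: (@le_trans _ _ (c * (m * (expR (L * t) / L)))).
      by rewrite ler_pM2l.
    rewrite /L le_eqVlt; apply/orP; left; apply/eqP; field.
    by rewrite gt_eqF.
  apply: (le_trans h1); rewrite mulrDl lerD// -[leLHS]mulr1 ler_wpM2l//.
move=> mA t t01; apply: (le_trans (ym t t01)).
by rewrite ler_wpM2r ?expR_ge0//; lra.
Qed.

End kernel_calculus.

(** * A priori bound for the fiber problem *)

Section fiber_problem.
Variable R : realType.
Local Notation U := (U01 R).
Local Notation mR := (measurableTypeR R).
Implicit Types (f g : mR -> R) (u v h : L2 U).

Lemma tri_integrable f t : measurable_fun setT f -> U.-integrable setT (EFin \o f) ->
  U.-integrable setT (EFin \o (fun s : mR => tri s t * f s)).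
Proof.
move=> mf fi; apply: le_integrable fi => //.
  by apply/measurable_EFinP; apply: measurable_funM => //; exact: measurable_tri1.
move=> s _ /=; rewrite lee_fin normrM ler_piMl// /tri.
by case: ifP => _; rewrite ?normr1 ?normr0.
Qed.

Lemma kintD f g t : measurable_fun setT f -> U.-integrable setT (EFin \o f) ->
  measurable_fun setT g -> U.-integrable setT (EFin \o g) ->
  kint (fun s => f s + g s) t = kint f t + kint g t.
Proof.
move=> mf fi mg gi; rewrite /kint -RintegralD//; try exact: tri_integrable.
by apply: eq_Rintegral => s _; rewrite mulrDr.
Qed.

Lemma kintZ a f t : measurable_fun setT f ->
  kint (fun s => a * f s) t = a * kint f t.
Proof.
move=> mf; rewrite /kint -RintegralZl_total.
  by apply: eq_Rintegral => s _; exact: mulrCA.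
by apply: measurable_funM => //; exact: measurable_tri1.
Qed.

(** The inequality is only known on the unit interval, so [f] is first replaced by the minimum of
    [f] and [g], which agrees with [f] there. *)
Lemma Rintegral_U01_le f g : measurable_fun setT f -> U.-integrable setT (EFin \o f) ->
  measurable_fun setT g -> U.-integrable setT (EFin \o g) ->
  (forall s, 0 <= s <= 1 -> f s <= g s) ->
  \int[U]_s f s <= \int[U]_s g s.
Proof.
move=> mf fi mg gi fg.
pose f' (s : mR) := Num.min (f s) (g s).
have mf' : measurable_fun setT f' by exact: measurable_minr.
have f'i : U.-integrable setT (EFin \o f').
  have fgi := integrableD measurableT (integrable_abse fi) (integrable_abse gi).
  apply: le_integrable fgi => //; first exact/measurable_EFinP.
  move=> s _; rewrite /= lee_fin [leRHS]ger0_norm ?addr_ge0// /f' /Num.min.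
  by case: ifP => _; rewrite ?lerDl ?lerDr.
rewrite (@eq_U01 _ f f')//; last by move=> s s01; rewrite /f' min_l// fg.
by apply: le_Rintegral => // s _; rewrite /f' ge_min lexx orbT.
Qed.

Lemma kint_le f g t : measurable_fun setT f -> U.-integrable setT (EFin \o f) ->
  measurable_fun setT g -> U.-integrable setT (EFin \o g) ->
  (forall s, 0 <= s <= 1 -> f s <= g s) -> kint f t <= kint g t.
Proof.
move=> mf fi mg gi fg; apply: Rintegral_U01_le.
- by apply: measurable_funM => //; exact: measurable_tri1.
- exact: tri_integrable.
- by apply: measurable_funM => //; exact: measurable_tri1.
- exact: tri_integrable.
- move=> s s01; rewrite ler_wpM2l ?fg// /tri.
  by case: ifP.
Qed.

Lemma kint_bounds f t : measurable_fun setT f -> U.-integrable setT (EFin \o f) ->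
  (forall s, 0 <= f s) -> 0 <= kint f t <= \int[U]_s f s.
Proof.
move=> mf fi f0; apply/andP; split.
  apply: Rintegral_ge0 => s _; rewrite mulr_ge0// /tri.
  by case: ifP.
apply: le_Rintegral => //; first exact: tri_integrable.
by move=> s _; rewrite ler_piMl// /tri; case: ifP.
Qed.

Fact flip_L2_measurable u : measurable_fun setT (fun t : mR => u (flip t)).
Proof. exact: (measurableT_comp (L2_measurable u) (@measurable_flip R)). Qed.

Fact flip_L2_finite u : (\int[U]_t (u (flip t) ^+ 2)%:E < +oo)%E.
Proof.
rewrite (ge0_integral_U01_flip (f := fun t => (u t ^+ 2)%:E)).
- exact: L2_finite.
- by apply/measurable_EFinP; apply: measurable_funX; exact: L2_measurable.
- by move=> x; rewrite lee_fin sqr_ge0.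
Qed.

Definition flip_L2 u : L2 U := L2mk (flip_L2_measurable u) (flip_L2_finite u).

Lemma flip_L2_sym : symmetric_op (l2_ip U) flip_L2.
Proof.
move=> u v; rewrite /=/l2_dot -[RHS]Rintegral_U01_flip; last first.
  apply: measurable_funM; first exact: L2_measurable.
  exact: flip_L2_measurable.
by apply: eq_Rintegral => t _ /=; rewrite flipK.
Qed.

Lemma kint_L2_sym : symmetric_op (l2_ip U) (@kint_L2 R).
Proof. by move=> u v; exact: kint_sym. Qed.

Lemma flip_L2_sqn u : sqn (l2_ip U) (flip_L2 u) = sqn (l2_ip U) u.
Proof.
have -> : sqn (l2_ip U) u = l2_ip U u (flip_L2 (flip_L2 u)).
  by apply: eq_Rintegral => t _ /=; rewrite flipK.
by rewrite -flip_L2_sym.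
Qed.

Fact cst01_finite (c : R) : (\int[U]_t (cst c t ^+ 2)%:E < +oo)%E.
Proof. by rewrite [X in (X < _)%E](integral_U01_cst (c ^+ 2)%:E) ltry. Qed.

Definition cst01 (c : R) : L2 U := L2mk (f := cst c) (measurable_cst c) (cst01_finite c).

Lemma dot_eq01 u v w : (forall t, 0 <= t <= 1 -> u t = v t) ->
  l2_ip U u w = l2_ip U v w.
Proof.
move=> uv; have mu_ := L2_measurable u; have mv := L2_measurable v.
have mw := L2_measurable w.
by apply: eq_U01 => [||t t01]; [exact: measurable_funM|exact: measurable_funM|rewrite uv].
Qed.

Let fiber_sqr_bound (p q phi psi a b y : R) : phi ^+ 2 + psi ^+ 2 <= y ->
  (q - psi + p * phi + a) ^+ 2 + (phi + p * (q - psi) + b) ^+ 2 <=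
  4 * (1 + p ^+ 2) * (q ^+ 2 + y + (a ^+ 2 + b ^+ 2)).
Proof.
have s4 (x1 x2 x3 x4 : R) :
    (x1 + x2 + x3 + x4) ^+ 2 <= 4 * (x1 ^+ 2 + x2 ^+ 2 + x3 ^+ 2 + x4 ^+ 2).
  have := sqr_ge0 (x1 - x2); have := sqr_ge0 (x1 - x3); have := sqr_ge0 (x1 - x4).
  have := sqr_ge0 (x2 - x3); have := sqr_ge0 (x2 - x4); have := sqr_ge0 (x3 - x4).
  lra.
move=> yE.
have b1 := s4 q (- psi) (p * phi) a; have b2 := s4 phi (p * q) (- (p * psi)) b.
have p2 := sqr_ge0 p.
have := mulr_ge0 p2 (sqr_ge0 a); have := mulr_ge0 p2 (sqr_ge0 b).
have : (1 + p ^+ 2) * (phi ^+ 2 + psi ^+ 2) <= (1 + p ^+ 2) * y.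
  by rewrite ler_pM2l// ltr_wpDr.
clear yE p2 s4; lra.
Qed.

(** At [t] and at [1 - t] the equation expresses [h] by the integrals of [h] and of its reflection
    over [[0, t]], by [k] and by the total integral [q] of [h].  Gronwall's inequality for the
    integral of [h(t)^2 + h(1 - t)^2] over [[0, t]] leaves only [q] to be bounded, and pairing the
    equation with [eta] gives [dd q = <eta, k>]. *)
Theorem fiber_problem_bound (l p dd : R) (eta : L2 U) : l != 0 -> dd != 0 ->
  (forall s, 0 <= s <= 1 ->
     l * eta s - kint eta s - p * kint (eta \o flip) s = dd) ->
  exists2 C, 0 < C & forall h k : L2 U,
    (forall t, 0 <= t <= 1 -> l * h t = kint h t + p * kint h (flip t) + k t) ->
    sqn (l2_ip U) h <= C * sqn (l2_ip U) k.
Proof.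
move=> l0 dd0 heta.
pose D := 4 * (1 + p ^+ 2) / l ^+ 2.
have l2 : 0 < l ^+ 2 by rewrite exprn_even_gt0.
have D0 : 0 < D by rewrite divr_gt0// mulr_gt0// ltr_wpDr ?sqr_ge0.
pose E := sqn (l2_ip U) eta / dd ^+ 2.
have dd2 : 0 < dd ^+ 2 by rewrite exprn_even_gt0.
have E0 : 0 <= E by rewrite divr_ge0 ?sqn_ge0// ltW.
exists (2 * D * expR (2 * D) * (E + 2)) => [|h k hk].
  have E2 : 0 < E + 2 by lra.
  by apply: mulr_gt0 => //; apply: mulr_gt0; [exact: mulr_gt0|exact: expR_gt0].
pose q := l2_ip U (cst01 1) h.
have hq : q ^+ 2 <= E * sqn (l2_ip U) k.
  have e1 : dd * q = l2_ip U eta k.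
    rewrite /q -dotZl.
    rewrite (@dot_eq01 _ (l *: eta - kint_L2 eta - p *: kint_L2 (flip_L2 eta))); last first.
      by move=> t t01; transitivity dd; [exact: mulr1|rewrite -(heta t t01)].
    rewrite (dotC _ eta k) (@dot_eq01 k (l *: h - kint_L2 h - p *: flip_L2 (kint_L2 h))).
      rewrite !dotE (kint_L2_sym eta h) (kint_L2_sym (flip_L2 eta) h) (flip_L2_sym eta (kint_L2
        h)).
      by rewrite (dotC _ eta h) (dotC _ eta (kint_L2 h)) (dotC _ eta (flip_L2 (kint_L2 h))).
    move=> t t01; have e := hk t t01.
    transitivity (l * h t - kint h t - p * kint h (flip t)); last by [].
    by rewrite e; ring.
  have := cauchy_schwarz (l2_ip U) eta k; rewrite -e1 exprMn => h1.
  by rewrite /E mulrAC ler_pdivlMr// mulrC.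
have mh := L2_measurable h; have mk := L2_measurable k.
have mhf := flip_L2_measurable h; have mkf := flip_L2_measurable k.
have ih := L2_sqr_integrable h; have ihf := L2_sqr_integrable (flip_L2 h).
have ik := L2_sqr_integrable k; have ikf := L2_sqr_integrable (flip_L2 k).
pose H (s : mR) := h s ^+ 2 + h (flip s) ^+ 2.
pose G (s : mR) := k s ^+ 2 + k (flip s) ^+ 2.
have mH : measurable_fun setT H by apply: measurable_funD; exact: measurable_funX.
have mG : measurable_fun setT G by apply: measurable_funD; exact: measurable_funX.
have iH : U.-integrable setT (EFin \o H) by exact: (integrableD measurableT ih ihf).
have iG : U.-integrable setT (EFin \o G) by exact: (integrableD measurableT ik ikf).
have H0 s : 0 <= H s by rewrite addr_ge0 ?sqr_ge0.
have G0 s : 0 <= G s by rewrite addr_ge0 ?sqr_ge0.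
have intG : \int[U]_s G s = 2 * sqn (l2_ip U) k.
  rewrite (RintegralD _ ik ikf)//.
  by rewrite -[X in _ + X]/(sqn (l2_ip U) (flip_L2 k)) flip_L2_sqn -[X in X + _]/(sqn (l2_ip U)
    k); ring.
(* [y t] is the integral of [h(s)^2 + h(1 - s)^2] over [[0, t]]. *)
pose y (t : mR) := kint H (flip t).
have my : measurable_fun setT y.
  apply: (@measurable_kint R _ mR (fun z => H z.2) (fun t : mR => flip t)).
    exact: measurableT_comp.
  exact: measurable_flip.
have yM t : 0 <= y t <= \int[U]_s H s by exact: kint_bounds.
have iy : U.-integrable setT (EFin \o y).
  apply: (@bounded_integrable_U01 _ _ (\int[U]_s H s)) => // s.
  by have /andP[y0 y1] := yM s; rewrite ger0_norm.
have key t : 0 <= t <= 1 -> H t <= D * (q ^+ 2 + y t + G t).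
  move=> t01; pose phi := kint h (flip t); pose psi := kint (h \o flip) (flip t).
  have qE : kint h t = q - psi.
    have := kint_complement t mh (L2_U01_integrable h).
    rewrite -/psi => e; apply/eqP; rewrite eq_sym subr_eq; apply/eqP; rewrite e.
    by rewrite /q; apply: eq_Rintegral => s _; rewrite /= mul1r.
  have e1 := hk t t01; have e2 := hk (flip t) (flip01 t01).
  rewrite flipK qE -/phi in e1 e2.
  have yE : phi ^+ 2 + psi ^+ 2 <= y t.
    rewrite /y /H kintD//; [|exact: measurable_funX|exact: measurable_funX].
    apply: lerD; first exact: kint_sqr_local.
    exact: (kint_sqr_local _ mhf ihf).
  have -> : H t = ((l * h t) ^+ 2 + (l * h (flip t)) ^+ 2) / l ^+ 2.
    by rewrite /H; field.
  rewrite ler_pdivrMr//.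
  have -> : D * (q ^+ 2 + y t + G t) * l ^+ 2 = 4 * (1 + p ^+ 2) * (q ^+ 2 + y t + G t).
    by rewrite /D; field.
  by rewrite e1 e2; exact: fiber_sqr_bound.
pose A := D * (q ^+ 2 + 2 * sqn (l2_ip U) k).
have A0 : 0 <= A by rewrite mulr_ge0 ?(ltW D0)// addr_ge0 ?sqr_ge0// mulr_ge0 ?sqn_ge0.
have hy t : 0 <= t <= 1 -> y t <= A + D * kint y (flip t).
  move=> t01.
  have m1 : measurable_fun setT (fun s : mR => q ^+ 2 + y s) by exact: measurable_funD.
  have i0 : U.-integrable setT (EFin \o (fun s : mR => q ^+ 2)).
    by apply: (@bounded_integrable_U01 _ _ (q ^+ 2)) => // s; rewrite ger0_norm ?sqr_ge0.
  have i1 : U.-integrable setT (EFin \o (fun s : mR => q ^+ 2 + y s)) by exact: (integrableD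
    measurableT i0 iy).
  have m2 : measurable_fun setT (fun s : mR => q ^+ 2 + y s + G s) by exact: measurable_funD.
  have i2 : U.-integrable setT (EFin \o (fun s : mR => q ^+ 2 + y s + G s)) by exact:
    (integrableD measurableT i1 iG).
  have m3 : measurable_fun setT (fun s : mR => D * (q ^+ 2 + y s + G s)) by exact:
    measurable_funM.
  have i3 : U.-integrable setT (EFin \o (fun s : mR => D * (q ^+ 2 + y s + G s))).
    by exact: (integrableZl measurableT D i2).
  apply: (le_trans (kint_le _ mH iH m3 i3 key)).
  rewrite kintZ// (kintD _ m1 i1 mG iG) (kintD _ _ i0 my iy)//.
  rewrite /A -mulrDr ler_pM2l// -addrA -[leRHS]addrA lerD//.
    have /andP[_] := @kint_bounds (cst (q ^+ 2)) (flip t) (measurable_cst _) i0 (fun=> sqr_ge0 _).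
    by rewrite U01_cst.
  rewrite addrC lerD// -intG.
  by have /andP[] := kint_bounds (flip t) mG iG G0.
have := gronwall my A0 D0 yM hy (t := 1).
rewrite lexx ler01 mulr1 => /(_ isT) y1.
have : sqn (l2_ip U) h <= y 1.
  have -> : y 1 = \int[U]_s H s.
    apply: eq_U01 => //.
      by apply: measurable_funM => //; exact: measurable_tri1.
    by move=> s s01; rewrite /tri /flip subrr addr0; case/andP: s01 => _ ->; rewrite mul1r.
  by apply: le_Rintegral => // s _; rewrite /H -expr2 lerDl sqr_ge0.
move=> /le_trans; apply; apply: (le_trans y1).
rewrite /A (_ : 2 * D * expR (2 * D) * (E + 2) * sqn (l2_ip U) k =
  2 * (D * (E * sqn (l2_ip U) k + 2 * sqn (l2_ip U) k)) * expR (2 * D)); last by ring.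
by rewrite ler_wpM2r ?expR_ge0// ler_pM2l// ler_pM2l// lerD2r.
Qed.

End fiber_problem.

(** * Trigonometric solutions of the fiber problem *)

Section trigonometric_solutions.
Variable R : realType.
Local Notation U := (U01 R).
Local Notation mR := (measurableTypeR R).

Lemma L2_of_bounded01 (f : mR -> R) M : measurable_fun setT f ->
  (forall t, 0 <= t <= 1 -> `|f t| <= M) -> (\int[U]_t (f t ^+ 2)%:E < +oo)%E.
Proof.
move=> mf fM; apply: (@le_lt_trans _ _ (\int[U]_t (M ^+ 2)%:E)%E).
  apply: ae_ge0_le_integral => //.
  - by move=> t _; rewrite lee_fin sqr_ge0.
  - by apply/measurable_EFinP; exact: measurable_funX.
  - by move=> t _; rewrite lee_fin sqr_ge0.
  apply: ae_U01 => t t01 _; rewrite lee_fin -real_normK ?num_real//.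
  have h := fM t t01; rewrite ler_sqr ?nnegrE//; exact: le_trans h.
by rewrite integral_U01_cst ltry.
Qed.

Lemma kint_sin (a b t : R) : a != 0 -> 0 <= t <= 1 ->
  kint (fun u => sin (a * u + b)) t = (cos b - cos (a * (1 - t) + b)) / a.
Proof.
move=> a0 t01.
have dc (x : R) : is_derive x (1 : R) (fun s => - a^-1 * cos (a * s + b)) (sin (a * x + b)).
  have := @is_derive_affine R cos (fun x => - sin x) a b (- a^-1) (@is_derive_cos R) x.
  by rewrite mulrN mulrNN mulrA mulVf// mul1r.
have ds (x : R) : is_derive x (1 : R) (fun s => 1 * sin (a * s + b)) (1 * (a * cos (a * x + b))).
  exact: (@is_derive_affine R sin cos a b 1 (@is_derive_sin R)).
have cs : continuous (fun s => sin (a * s + b)).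
  by have := is_derive_continuous ds; under eq_fun do rewrite mul1r.
by rewrite (kint_FTC dc cs)// mulr0 add0r; field.
Qed.

Lemma kint_affine (a b t : R) : 0 <= t <= 1 ->
  kint (fun u => a * u + b) t = a * (1 - t) ^+ 2 / 2 + b * (1 - t).
Proof.
move=> t01.
have dl (k l y : R) : is_derive y (1 : R) (fun s : R => k * s + l) k.
  by apply: is_derive_eq; rewrite /= scaler1 addr0.
have dq (y : R) : is_derive y (1 : R) (fun s : R => (a / 2 * s + b) * s) (a * y + b).
  have := @is_deriveM R R (fun s : R => a / 2 * s + b) id y 1 _ _ (dl _ _ _) (is_derive_id _ _).
  move=> h; rewrite (_ : a * y + b = (a / 2 * y + b) *: (1 : R) + y *: (a / 2)); first exact: h.
  by rewrite /GRing.scale/=; field.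
have cl : continuous (fun s : R => a * s + b).
  exact: (is_derive_continuous (dl a b)).
by rewrite (kint_FTC dq cl)// mulr0 subr0; field.
Qed.

(** The eigenfunction equation is written for [S \o flip]: then [S 0 = 0] is the condition under
    which the extension of a vertex function in [extension] is continuous at the vertices. *)
Definition fiber_eigen (l p : R) (S : mR -> R) :=
  forall t, 0 <= t <= 1 -> kint (S \o flip) t + p * kint S t = l * S (flip t).

Lemma fiber_eigen_sin (w : R) : w != 0 ->
  fiber_eigen (sin w / w) (cos w) (fun t => sin (w * t + 0)).
Proof.
move=> w0 t t01; rewrite kint_sin//.
have -> : (fun t => sin (w * t + 0)) \o flip = fun t => sin (- w * t + w) :> R.
  by apply/funext => s /=; rewrite /flip; congr sin; ring.
rewrite kint_sin ?oppr_eq0// !addr0 cos0 /flip.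
have -> : - w * (1 - t) + w = w - w * (1 - t) by ring.
rewrite cosB; field.
by [].
Qed.

Lemma fiber_eigen_id : fiber_eigen 1 1 (fun t => 1 * t + 0).
Proof.
move=> t t01; rewrite kint_affine//.
have -> : (fun t => 1 * t + 0) \o flip = fun t => - 1 * t + 1 :> R.
  by apply/funext => s /=; rewrite /flip; ring.
by rewrite kint_affine// /flip; field.
Qed.

(** A constant works for [p = -1] and an affine function for [p = 1].  Otherwise let [p = cos th] and
    take [sin (kap s + b)] with [l kap = sin th]; the phase [b] is chosen so that the left-hand side
    is the constant [- l sin (th + b)].  If this vanishes, then [cos kap = p] and
    [sin kap = sin th = l kap], which is the excluded case. *)
Lemma fiber_dual_exists (l p : R) : l != 0 -> -1 <= p <= 1 ->
  (forall w : R, w != 0 -> cos w = p -> l != sin w / w) -> (p = 1 -> l != 1) ->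
  exists (eta : L2 U) (dd : R), dd != 0 /\ forall s, 0 <= s <= 1 ->
    l * eta s - kint eta s - p * kint (eta \o flip) s = dd.
Proof.
move=> l0 /andP[p1 p1'] hw h1.
have [pE|pN1] := eqVneq p (-1).
  exists (cst01 1), l; split=> // s s01.
  have -> : cst01 1 \o flip = cst01 1 :> (mR -> R) by [].
  by rewrite pE /=; ring.
have [pE|p1n] := eqVneq p 1.
  pose e (s : mR) := 2 * s + - (1 + l) : R.
  have me : measurable_fun setT e.
    by apply: measurable_funD => //; exact: measurable_funM.
  have fe : (\int[U]_t (e t ^+ 2)%:E < +oo)%E.
    apply: (@L2_of_bounded01 _ (3 + `|l|)) => // t /andP[t0 t1].
    rewrite /e; apply: le_trans (ler_normD _ _) _.
    have -> : `|2 * t| = 2 * t by rewrite ger0_norm// mulr_ge0.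
    by rewrite normrN; have := ler_normD 1 l; rewrite normr1; lra.
  exists (L2mk me fe), (l * (1 - l)); split.
    by rewrite mulf_neq0// subr_eq0 eq_sym h1.
  move=> s s01; rewrite [kint (L2mk _ _) s]kint_affine//.
  have -> : L2mk me fe \o flip = (fun t => - 2 * t + (1 - l)) :> (mR -> R).
    by apply/funext => t /=; rewrite /e /flip; ring.
  by rewrite kint_affine// pE /= /e; field.
pose th := acos p.
have cth : cos th = p by rewrite /th acosK// in_itv/= p1.
have sth : sin th != 0.
  apply/negP => /eqP s0; have := cos2Dsin2 th; rewrite s0 cth expr0n addr0.
  move=> /eqP; rewrite sqrf_eq1 => /orP[] /eqP e.
    by rewrite e eqxx in p1n.
  by rewrite e eqxx in pN1.
pose kap := sin th / l.
have kap0 : kap != 0 by rewrite mulf_neq0// invr_neq0.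
have kl : l * kap = sin th by rewrite /kap mulrC divfK.
have [b bE] : exists b, b = - ((kap + th) / 2) by exists (- ((kap + th) / 2)).
pose e (s : mR) := sin (kap * s + b).
have me : measurable_fun setT e.
  apply: measurableT_comp; first exact: (continuous_measurable_fun (@continuous_sin R)).
  by apply: measurable_funD => //; exact: measurable_funM.
have fe : (\int[U]_t (e t ^+ 2)%:E < +oo)%E.
  apply: (@L2_of_bounded01 _ 1) => // t _.
  by rewrite ler_norml sin_geN1 sin_le1.
exists (L2mk me fe), (- l * sin (th + b)); split.
  rewrite mulf_neq0 ?oppr_eq0//; apply/eqP => s0.
  have [x xE] : exists x, x = th + b by exists (th + b).
  rewrite -xE in s0.
  have kE : kap = th - (x + x) by rewrite xE bE; field.
  have := cos2Dsin2 x; rewrite s0 expr0n addr0 => c1.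
  have c2 : cos (x + x) = 1 by rewrite cosD s0 mul0r subr0 -expr2.
  have s2 : sin (x + x) = 0 by rewrite sinD s0 mul0r mulr0 addr0.
  have cE : cos kap = p by rewrite kE cosB c2 s2 mulr1 mulr0 addr0.
  have sE : sin kap = sin th by rewrite kE sinB c2 s2 mulr1 mulr0 subr0.
  by have := hw kap kap0 cE; rewrite sE -kl mulfK// eqxx.
move=> s s01; rewrite [kint (L2mk _ _) s]kint_sin//.
have -> : L2mk me fe \o flip = (fun t => sin (- kap * t + (kap + b))) :> (mR -> R).
  by apply/funext => t /=; rewrite /e /flip; congr sin; ring.
rewrite kint_sin ?oppr_eq0// /= /e.
have [z zE] : exists z, z = kap * s + b by exists (kap * s + b).
rewrite -zE.
have -> : kap * (1 - s) + b = - (z + th) by rewrite zE bE; field.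
have -> : - kap * (1 - s) + (kap + b) = z by rewrite zE; ring.
have -> : kap + b = - (th + b) by rewrite bE; field.
rewrite !cosN; rewrite -[l](mulfK kap0) kl -cth.
have -> : cos b = cos (th + b) * cos th + sin (th + b) * sin th.
  by rewrite -cosB (_ : th + b - th = b)//; ring.
rewrite (cosD z th).
by field.
Qed.

End trigonometric_solutions.

(** * Conductances as measures *)

(** Jensen's inequality for the square. *)
Lemma Rintegral_sqr_le d (T : measurableType d) (R : realType)
    (mu : {measure set T -> \bar R}) (h : T -> R) : (mu setT <= 1)%E ->
  measurable_fun setT h ->
  (((\int[mu]_x h x) ^+ 2)%:E <= \int[mu]_x (h x ^+ 2)%:E)%E.
Proof.
move=> mu1 mh; have [hoo|] := ltP (\int[mu]_s (h s ^+ 2)%:E)%E +oo%E; last first.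
  by rewrite leye_eq => /eqP ->; rewrite leey.
have h1 : (\int[mu]_s (cst (1 : R) s ^+ 2)%:E <= 1)%E.
  by under eq_integral do rewrite expr1n; rewrite integral_cst// mul1e.
pose u : L2 mu := L2mk (measurable_cst (1 : R)) (le_lt_trans h1 (ltry _)).
pose v : L2 mu := L2mk mh hoo.
have -> : \int[mu]_x h x = l2_ip mu u v.
  by apply: eq_Rintegral => x _; rewrite /= mul1r.
have := cauchy_schwarz (l2_ip mu) u v; rewrite -lee_fin => /le_trans; apply.
rewrite EFinM !l2_sqnE/=.
by rewrite -[leRHS]mul1e lee_wpmul2r// integral_ge0// => s _; rewrite lee_fin sqr_ge0.
Qed.

Section network_measures.
Variables (R : realType) (X : countType) (N : network R X) (x0 : X).
Local Notation U := (U01 R).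
Local Notation mR := (measurableTypeR R).

Definition conductance (x y : X) : R := if adj N x y then cond N x y else 0.

Lemma conductance_ge0 x y : 0 <= conductance x y.
Proof. by rewrite /conductance; case: ifPn => // xy; rewrite ltW// cond_gt0. Qed.

Lemma conductance_sym x y : conductance x y = conductance y x.
Proof.
rewrite /conductance (adj_sym N y x); case: ifPn => // xy.
by rewrite cond_sym.
Qed.

Lemma esum_conductance x (f : X -> \bar R) :
  (\esum_(y in [set: X]) ((conductance x y)%:E * f y) =
   \esum_(y in nbhd N x) ((cond N x y)%:E * f y))%E.
Proof.
rewrite [RHS]esum_mkcond; apply: eq_esum => y _; rewrite /conductance.
by case: ifPn => xy; [rewrite ifT// inE|rewrite ifF ?mul0e//; apply/negbTE; rewrite notin_setE;
  exact/negP].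
Qed.

Lemma m0E x : (m0 N x)%:E = (\esum_(y in [set: X]) (conductance x y)%:E)%E.
Proof.
transitivity (\esum_(y in nbhd N x) (cond N x y)%:E)%E.
  rewrite /m0 fineK// ge0_fin_numE; first exact: cond_summable.
  by apply: esum_ge0 => y xy; rewrite lee_fin ltW// cond_gt0.
transitivity (\esum_(y in nbhd N x) ((cond N x y)%:E * 1))%E.
  by apply: eq_esum => y _; rewrite mule1.
by rewrite -(esum_conductance x (cst 1%E)); apply: eq_esum => y _; rewrite mule1.
Qed.

Lemma neighbor_exists x : exists y, adj N x y.
Proof.
have [a [b ab]] := adj_edge N; have [p [xp pa]] := adj_connected N x a.
case: p xp pa => [_ /= ->|y p /= /andP[xy _] _]; first by exists b.
by exists y.
Qed.

Lemma m0_gt0 x : 0 < m0 N x.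
Proof.
have [y xy] := neighbor_exists x.
rewrite -lte_fin m0E; apply: (@lt_le_trans _ _ (conductance x y)%:E).
  by rewrite lte_fin /conductance xy cond_gt0.
have := @le_measure _ _ _ (wsum (i0 := x0) (conductance_ge0 x)) [set y] setT.
by rewrite !inE/= wsum_set1; apply.
Qed.

Definition transition_prob x y : R := conductance x y / m0 N x.

Lemma transition_prob_ge0 x y : 0 <= transition_prob x y.
Proof. by rewrite divr_ge0 ?conductance_ge0// ltW// m0_gt0. Qed.

Lemma m0_ge0 x : 0 <= m0 N x. Proof. exact/ltW/m0_gt0. Qed.

Lemma conductance2_ge0 (e : X * X) : 0 <= conductance e.1 e.2.
Proof. exact: conductance_ge0. Qed.

(** The measure [mu1] on oriented edges is that of a step of the random walk started from [mu0]:
    it disintegrates over [mu0] with the transition kernel [step]. *)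
Definition mu0 : {sigma_finite_measure set (disc x0) -> \bar R} := wsum m0_ge0.
Definition mu1 : {sigma_finite_measure set (disc (x0, x0)) -> \bar R} :=
  wsum conductance2_ge0.
Definition step x : {sigma_finite_measure set (disc x0) -> \bar R} :=
  wsum (transition_prob_ge0 x).

Lemma ge0_disintegration (G : disc (x0, x0) -> \bar R) : (forall e, 0 <= G e)%E ->
  (\int[mu1]_e G e = \int[mu0]_x \int[step x]_y G (x, y))%E.
Proof.
move=> G0; rewrite [LHS]integral_wsum// [RHS]integral_wsum; last first.
  by move=> x; exact: integral_ge0.
transitivity (\esum_(x in [set: X]) \esum_(y in [set: X]) ((conductance x y)%:E * G (x, y)))%E.
  rewrite esum_esum; last by move=> x y _ _; rewrite mule_ge0// lee_fin conductance_ge0.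
  rewrite (_ : _ `*`` _ = setT); last by apply/seteqP.
  by apply: eq_esum => -[x y] _.
apply: eq_esum => x _; rewrite -ge0_integralZl//; last by rewrite lee_fin m0_ge0.
rewrite [RHS]integral_wsum; last by move=> y; rewrite mule_ge0// lee_fin m0_ge0.
apply: eq_esum => y _; rewrite muleA -EFinM /transition_prob divfK//.
by rewrite gt_eqF// m0_gt0.
Qed.

Lemma step_setT x : step x setT = 1%E.
Proof.
have m0n : m0 N x != 0 by rewrite gt_eqF// m0_gt0.
have : ((m0 N x)%:E * step x setT = (m0 N x)%:E)%E.
  transitivity (\int[step x]_y (m0 N x)%:E)%E; first by rewrite integral_cst.
  rewrite [LHS]integral_wsum; last by move=> y; rewrite lee_fin m0_ge0.
  rewrite [RHS]m0E; apply: eq_esum => y _.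
  by rewrite -EFinM /transition_prob divfK.
case: (step x setT) (measure_ge0 (step x) setT) => [r|//|//] _.
- by rewrite -EFinM => -[] /(canRL (mulKf m0n)) ->; rewrite mulVf.
- by rewrite gt0_muley ?lte_fin ?m0_gt0.
- by rewrite gt0_muleNy ?lte_fin ?m0_gt0.
Qed.

(** For almost every [x] both parts of [G] have finite mean, so the difference of the means is the
    mean of the difference. *)
Lemma disintegration (G : disc (x0, x0) -> R) : mu1.-integrable setT (EFin \o G) ->
  \int[mu1]_e G e = \int[mu0]_x \int[step x]_y G (x, y).
Proof.
move=> Gi.
have md d (T : measurableType d) (f : disc x0 -> T) : measurable_fun setT f.
  exact: measurable_fun_disc.
pose Ap x := (\int[step x]_y (EFin \o G)^\+ (x, y))%E.
pose An x := (\int[step x]_y (EFin \o G)^\- (x, y))%E.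
have Ap0 x : (0 <= Ap x)%E by exact: integral_ge0.
have An0 x : (0 <= An x)%E by exact: integral_ge0.
have Gpi := integrable_funepos measurableT Gi.
have Gni := integrable_funeneg measurableT Gi.
have ep : (\int[mu1]_e (EFin \o G)^\+ e = \int[mu0]_x Ap x)%E.
  exact: ge0_disintegration.
have en : (\int[mu1]_e (EFin \o G)^\- e = \int[mu0]_x An x)%E.
  exact: ge0_disintegration.
have fi (f : disc x0 -> \bar R) (g : disc (x0, x0) -> \bar R) : (forall x, 0 <= f x)%E ->
    (forall e, 0 <= g e)%E -> mu1.-integrable setT g ->
    (\int[mu1]_e g e = \int[mu0]_x f x)%E -> mu0.-integrable setT f.
  move=> f0 g0 /integrableP[_ gi] fg; apply/integrableP; split => //.
  rewrite (eq_integral f); last by move=> x _; rewrite gee0_abs.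
  rewrite -fg; apply: le_lt_trans gi; rewrite le_eqVlt; apply/orP; left; apply/eqP.
  by apply: eq_integral => e _; rewrite gee0_abs.
have Api : mu0.-integrable setT Ap by exact: (fi _ _ _ _ Gpi ep).
have Ani : mu0.-integrable setT An by exact: (fi _ _ _ _ Gni en).
rewrite /Rintegral integralE ep en -integralB//; congr fine.
apply: ae_eq_integral => //.
have := integrable_ae measurableT Api; have := integrable_ae measurableT Ani.
apply: filterS2 => x /(_ I) nfin /(_ I) pfin _.
have e : (\int[step x]_y (G (x, y))%:E = Ap x - An x)%E.
  have -> : (fun y => (G (x, y))%:E) = (EFin \o G) \o (fun y => (x, y)) by [].
  by rewrite integralE funepos_comp funeneg_comp.
by rewrite e fineK// fin_numB pfin.
Qed.

End network_measures.

(** * Means over edges *)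

Section network_operators.
Variables (R : realType) (X : countType) (N : network R X) (x0 : X).
Local Notation U := (U01 R).
Local Notation mR := (measurableTypeR R).
Local Notation V := (disc x0).
Local Notation E := (disc (x0, x0)).
Local Notation mu0 := (mu0 N x0).
Local Notation mu1 := (mu1 N x0).
Local Notation step := (step N x0).
Local Notation H0 := (L2 mu0).
Local Notation H1 := (L2 (mu0 \x U)%E).
Local Notation H2 := (L2 (mu1 \x U)%E).
Implicit Types (F : H2) (f h : H1) (g : H0).

Lemma measurable_edge_fiber (F : E * mR -> R) x : measurable_fun setT F ->
  measurable_fun setT (fun z : V * mR => F ((x, z.1), z.2)).
Proof.
move=> mF; apply: (measurableT_comp mF); apply: measurable_fun_pair => //.
have m1 : measurable_fun setT (fun y : V => (x, y) : E) by exact: measurable_fun_disc.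
exact: (measurableT_comp m1 measurable_fst).
Qed.

Definition edge_mean_fun (F : E * mR -> R) (z : V * mR) : R :=
  \int[step z.1]_y F ((z.1, y), z.2).

Fact edge_mean_fun_measurable (F : E * mR -> R) : measurable_fun setT F ->
  measurable_fun setT (edge_mean_fun F).
Proof.
move=> mF; apply: measurable_fun_slices => x.
pose G (z : mR * V) : R := F ((x, z.2), z.1).
apply: (@measurable_Rintegral1 _ _ mR V R (step x) G).
apply: (measurableT_comp mF); apply: measurable_fun_pair => //.
have m1 : measurable_fun setT (fun y : V => (x, y) : E) by exact: measurable_fun_disc.
exact: (measurableT_comp m1 measurable_snd).
Qed.

(** Fiberwise Jensen's inequality, then disintegration of [mu1]. *)
Lemma edge_mean_fun_sqr_le (F : E * mR -> R) : measurable_fun setT F ->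
  (\int[(mu0 \x U)%E]_z (edge_mean_fun F z ^+ 2)%:E <= \int[(mu1 \x U)%E]_z (F z ^+ 2)%:E)%E.
Proof.
move=> mF; rewrite (tonelli_sqr mu0 (edge_mean_fun_measurable mF)) (tonelli_sqr mu1 mF).
rewrite ge0_disintegration; last first.
  by move=> e; apply: integral_ge0 => t _; rewrite lee_fin sqr_ge0.
apply: ge0_le_integral => //.
- by move=> x _; apply: integral_ge0 => t _; rewrite lee_fin sqr_ge0.
move=> x _.
pose G (z : V * mR) : \bar R := ((F ((x, z.1), z.2)) ^+ 2)%:E.
have mG : measurable_fun setT G.
  by apply/measurable_EFinP; apply: measurable_funX; exact: measurable_edge_fiber.
have G0 z : (0 <= G z)%E by rewrite lee_fin sqr_ge0.
rewrite (fubini_tonelli (m1 := step x) (m2 := U) G mG G0).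
apply: ge0_le_integral => //.
- by move=> t _; rewrite lee_fin sqr_ge0.
- apply/measurable_EFinP; apply: measurable_funX.
  by apply: measurable_fiber; exact: edge_mean_fun_measurable.
- exact: (measurable_fun_fubini_tonelli_G (m1 := step x) _ mG G0).
move=> t _; apply: Rintegral_sqr_le; first by rewrite /= step_setT.
exact: measurable_fun_disc.
Qed.

Fact edge_mean_fun_finite F : (\int[(mu0 \x U)%E]_z (edge_mean_fun F z ^+ 2)%:E < +oo)%E.
Proof. exact: le_lt_trans (edge_mean_fun_sqr_le (L2_measurable F)) (L2_finite F). Qed.

Definition edge_mean F : H1 := L2mk (edge_mean_fun_measurable (L2_measurable F))
  (edge_mean_fun_finite F).

Lemma edge_mean_bounded F : sqn (l2_ip _) (edge_mean F) <= sqn (l2_ip _) F.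
Proof. by rewrite -lee_fin !l2_sqnE; exact: (edge_mean_fun_sqr_le (L2_measurable F)). Qed.

Definition lift_src_fun (f : V * mR -> R) (z : E * mR) : R := f (z.1.1, z.2).

Fact lift_src_fun_measurable (f : V * mR -> R) : measurable_fun setT f ->
  measurable_fun setT (lift_src_fun f).
Proof.
move=> mf; apply: (measurableT_comp mf); apply: measurable_fun_pair => //.
have m1 : measurable_fun setT (fun e : E => e.1 : V) by exact: measurable_fun_disc.
exact: (measurableT_comp m1 measurable_fst).
Qed.

Lemma integral_step_cst x (c : \bar R) : (0 <= c)%E -> (\int[step x]_y c = c)%E.
Proof. by move=> c0; rewrite integral_cst//= step_setT mule1. Qed.

Lemma Rintegral_step_cst x (c : R) : \int[step x]_y c = c.
Proof. by rewrite Rintegral_cst//= step_setT mulr1. Qed.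

Lemma lift_src_fun_sqrE f : (\int[(mu1 \x U)%E]_z (lift_src_fun f z ^+ 2)%:E =
  \int[(mu0 \x U)%E]_z (f z ^+ 2)%:E)%E.
Proof.
have mf := L2_measurable f.
rewrite (tonelli_sqr mu0 mf) (tonelli_sqr mu1 (lift_src_fun_measurable mf)).
have i0 (k : R -> R) : (0 <= \int[U]_t (k t ^+ 2)%:E)%E.
  by apply: integral_ge0 => t _; rewrite lee_fin sqr_ge0.
rewrite ge0_disintegration; last by move=> e; exact: i0.
by apply: eq_integral => x _; exact: (integral_step_cst x (i0 (fun t => f (x, t)))).
Qed.

Fact lift_src_fun_finite f : (\int[(mu1 \x U)%E]_z (lift_src_fun f z ^+ 2)%:E < +oo)%E.
Proof. by rewrite lift_src_fun_sqrE; exact: L2_finite. Qed.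

Definition lift_src f : H2 := L2mk (lift_src_fun_measurable (L2_measurable f))
  (lift_src_fun_finite f).

Lemma lift_src_sqn f : sqn (l2_ip _) (lift_src f) = sqn (l2_ip _) f.
Proof. by apply: EFin_inj; rewrite !l2_sqnE; exact: lift_src_fun_sqrE. Qed.

(** Together with weak testing, this adjunction turns the commutation relations of [edge_mean] into
    identities between values of functions. *)
Lemma edge_mean_adjoint F f : l2_ip _ (edge_mean F) f = l2_ip _ F (lift_src f).
Proof.
rewrite !dot_fiberE.
pose Psi (z : E * mR) : R := F z * lift_src f z.
have Psii : (mu1 \x U)%E.-integrable setT (EFin \o Psi) by exact: L2_mul_integrable.
rewrite (disintegration (integrable_Rintegral1 Psii)).
have mPsi : measurable_fun setT Psi.
  by apply: measurable_funM; exact: L2_measurable.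
have hfin : {ae mu0, forall x, (\int[step x]_y \int[U]_t `|(Psi ((x, y), t))%:E| < +oo)%E}.
  pose A (x : V) : \bar R := (\int[step x]_y \int[U]_t `|(Psi ((x, y), t))%:E|)%E.
  have A0 x : (0 <= A x)%E by apply: integral_ge0 => y _; exact: integral_ge0.
  have : mu0.-integrable setT A.
    apply/integrableP; split; first exact: measurable_fun_disc.
    rewrite (eq_integral A); last by move=> x _; rewrite gee0_abs.
    rewrite -(@ge0_disintegration _ _ N x0 (fun e => \int[U]_t `|(Psi (e, t))%:E|)%E); last first.
      by move=> e; exact: integral_ge0.
    have mE : measurable_fun setT (EFin \o Psi) by exact/measurable_EFinP.
    exact: ((integrable12ltyP mu1 U mE).1 Psii).
  move=> /(integrable_ae measurableT); apply: filterS => x /(_ I).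
  by rewrite ge0_fin_numE.
apply: ae_eq_Rintegral; [exact: measurable_fun_disc|exact: measurable_fun_disc|].
apply: (@filterS _ _ (ae_filter_ringOfSetsType mu0) _ _ _ hfin) => x hx.
pose G (z : V * mR) : R := Psi ((x, z.1), z.2).
have mG : measurable_fun setT G by exact: measurable_edge_fiber.
have Gi : (step x \x U)%E.-integrable setT (EFin \o G).
  have mE : measurable_fun setT (EFin \o G) by exact/measurable_EFinP.
  exact: ((integrable12ltyP (step x) U mE).2 hx).
have := Rfubini2 Gi; rewrite Rfubini1// => ->.
apply: eq_Rintegral => t _; rewrite mulrC -RintegralZl_total; last exact: measurable_fun_disc.
by apply: eq_Rintegral => y _; exact: mulrC.
Qed.

End network_operators.

(** * The averaging operator as a composition *)

Section network_operators2.
Variables (R : realType) (X : countType) (N : network R X) (x0 : X).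
Local Notation U := (U01 R).
Local Notation mR := (measurableTypeR R).
Local Notation V := (disc x0).
Local Notation E := (disc (x0, x0)).
Local Notation mu0 := (mu0 N x0).
Local Notation mu1 := (mu1 N x0).
Local Notation step := (step N x0).
Local Notation H0 := (L2 mu0).
Local Notation H1 := (L2 (mu0 \x U)%E).
Local Notation H2 := (L2 (mu1 \x U)%E).
Local Notation b0 := (l2_ip mu0).
Local Notation b1 := (l2_ip (mu0 \x U)%E).
Local Notation b2 := (l2_ip (mu1 \x U)%E).
Implicit Types (F G : H2) (f h : H1) (g : H0).

Definition rev_edge (e : E) : E := (e.2, e.1).

Lemma rev_edgeK : involutive rev_edge. Proof. by case. Qed.

Lemma ge0_integral_rev_edge (G : E -> \bar R) : (forall e, 0 <= G e)%E ->
  (\int[mu1]_e G (rev_edge e) = \int[mu1]_e G e)%E.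
Proof.
move=> G0; rewrite [LHS]integral_wsum// [RHS]integral_wsum//.
rewrite [RHS](@reindex_esum _ _ _ setT setT rev_edge).
  by apply: eq_esum => -[x y] _; rewrite /rev_edge/= conductance_sym.
split => //; first by move=> e e' _ _; apply: (can_inj rev_edgeK).
by move=> e _; exists (rev_edge e) => //; rewrite rev_edgeK.
Qed.

Lemma Rintegral_rev_edge (G : E -> R) :
  \int[mu1]_e G (rev_edge e) = \int[mu1]_e G e.
Proof.
rewrite /Rintegral (_ : (fun e => (G (rev_edge e))%:E) = (EFin \o G) \o rev_edge)//.
rewrite integralE [in RHS]integralE funepos_comp funeneg_comp.
by rewrite (ge0_integral_rev_edge (G := (EFin \o G)^\+%E))// (ge0_integral_rev_edge (G := (EFin
  \o G)^\-%E)).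
Qed.

Definition edge_swap_fun (F : E * mR -> R) (z : E * mR) : R := F (rev_edge z.1, z.2).

Fact edge_swap_fun_measurable (F : E * mR -> R) : measurable_fun setT F ->
  measurable_fun setT (edge_swap_fun F).
Proof.
move=> mF; apply: (measurableT_comp mF); apply: measurable_fun_pair => //.
have m1 : measurable_fun setT rev_edge by exact: measurable_fun_disc.
exact: (measurableT_comp m1 measurable_fst).
Qed.

Lemma edge_swap_fun_sqrE F : (\int[(mu1 \x U)%E]_z (edge_swap_fun F z ^+ 2)%:E =
  \int[(mu1 \x U)%E]_z (F z ^+ 2)%:E)%E.
Proof.
have mF := L2_measurable F.
rewrite (tonelli_sqr mu1 mF) (tonelli_sqr mu1 (edge_swap_fun_measurable mF)).
apply: (ge0_integral_rev_edge (G := fun e => \int[U]_t (F (e, t) ^+ 2)%:E)%E) => e.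
by apply: integral_ge0 => t _; rewrite lee_fin sqr_ge0.
Qed.

Fact edge_swap_fun_finite F : (\int[(mu1 \x U)%E]_z (edge_swap_fun F z ^+ 2)%:E < +oo)%E.
Proof. by rewrite edge_swap_fun_sqrE; exact: L2_finite. Qed.

Definition edge_swap F : H2 := L2mk (edge_swap_fun_measurable (L2_measurable F))
  (edge_swap_fun_finite F).

Lemma edge_swap_sqn F : sqn b2 (edge_swap F) = sqn b2 F.
Proof. by apply: EFin_inj; rewrite !l2_sqnE; exact: edge_swap_fun_sqrE. Qed.

Lemma edge_swap_sym : symmetric_op b2 edge_swap.
Proof.
move=> F G; rewrite !dot_fiberE.
rewrite -[RHS]Rintegral_rev_edge; apply: eq_Rintegral => e _; apply: eq_Rintegral => t _.
by rewrite /edge_swap/= /edge_swap_fun rev_edgeK.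
Qed.

(** The two orientations of an edge give the same point [(xy, t) = (yx, 1 - t)]; functions on the
    skeleton are those invariant under this involution. *)
Definition reversal F : H2 := edge_swap (fflip F).

Lemma reversal_sqn F : sqn b2 (reversal F) = sqn b2 F.
Proof. by rewrite edge_swap_sqn fflip_sqn. Qed.

Lemma reversal_sym : symmetric_op b2 reversal.
Proof.
move=> F G; rewrite /reversal edge_swap_sym fflip_sym; congr (b2 F _).
exact/LfuneqP.
Qed.

(** The transition operator in the vertex variable, with [t] as a parameter. *)
Definition ftrans f : H1 := edge_mean (edge_swap (lift_src f)).

Lemma ftransE f x t : ftrans f (x, t) = \int[step x]_y f (y, t). Proof. by []. Qed.

Lemma ftrans_sym : symmetric_op b1 ftrans.
Proof.
move=> f h; rewrite edge_mean_adjoint edge_swap_sym dotC -edge_mean_adjoint.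
by rewrite -/(ftrans h) dotC.
Qed.

Lemma ftrans_bounded : bounded_op b1 ftrans 1.
Proof.
by move=> f; rewrite mul1r; apply: le_trans (edge_mean_bounded _) _;
  rewrite edge_swap_sqn lift_src_sqn.
Qed.

Lemma edge_mean_lift_src f : edge_mean (lift_src f) = f.
Proof.
apply/LfuneqP => -[x t]; rewrite /edge_mean/= /edge_mean_fun.
exact: (@Rintegral_step_cst R X N x0 x (f (x, t))).
Qed.

Lemma edge_mean_kint F : sqn b1 (edge_mean (fkint F) - fkint (edge_mean F)) = 0.
Proof.
apply/sqn_eqP => h; rewrite (edge_mean_adjoint (fkint F) h) (fkint_sym (edge_mean F) h)
  (edge_mean_adjoint F (fkint h)).
by rewrite (fkint_sym F (lift_src h)); congr (b2 F _); exact/LfuneqP.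
Qed.

Lemma ftrans_kint f : sqn b1 (ftrans (fkint f) - fkint (ftrans f)) = 0.
Proof.
have -> : ftrans (fkint f) = edge_mean (fkint (edge_swap (lift_src f))) by congr edge_mean;
  exact/LfuneqP.
exact: edge_mean_kint.
Qed.

Lemma ftrans_flip f : ftrans (fflip f) = fflip (ftrans f).
Proof. exact/LfuneqP. Qed.

Definition symm h : H2 := lift_src h + reversal (lift_src h).

Lemma symm_sqn_le h : sqn b2 (symm h) <= 4 * sqn b1 h.
Proof.
by apply: le_trans (sqnD_le _ _ _) _; rewrite reversal_sqn lift_src_sqn; lra.
Qed.

(** On reversal-invariant functions, [symm] is twice the adjoint of [edge_mean]. *)
Lemma dot_symm h F : sqn b2 (reversal F - F) = 0 -> b2 (symm h) F = 2 * b1 h (edge_mean F).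
Proof.
move=> hF; rewrite /symm dotDl reversal_sym (dotC _ _ (reversal F)) (dot_eql _ hF).
by rewrite (dotC b2) (dotC b1) edge_mean_adjoint; ring.
Qed.

Lemma edge_mean_symm h : sqn b1 (edge_mean (symm h) - (h + fflip (ftrans h))) = 0.
Proof.
apply/sqn_eqP => k; rewrite edge_mean_adjoint /symm !dotDl -!edge_mean_adjoint edge_mean_lift_src.
congr (_ + b1 _ k); exact/LfuneqP.
Qed.

Definition avg F : H2 := symm (edge_mean (fkint F)).

Lemma avgE F x y t : avg F (x, y, t) =
  \int[step x]_u kint (fun s => F (x, u, s)) t +
  \int[step y]_u kint (fun s => F (y, u, s)) (flip t).
Proof. by []. Qed.

(** On reversal-invariant functions both sides are [2 <m F, k (m G)>], with [m] the mean over edges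
    and [k] the fiberwise integral. *)
Lemma avg_sym F G : sqn b2 (reversal F - F) = 0 -> sqn b2 (reversal G - G) = 0 ->
  b2 (avg F) G = b2 F (avg G).
Proof.
move=> hF hG; rewrite (dot_symm (edge_mean (fkint F)) hG) (dotC b2 F) (dot_symm (edge_mean (fkint
  G)) hF).
rewrite (dot_eql (edge_mean G) (edge_mean_kint F)) (dot_eql (edge_mean F) (edge_mean_kint G)).
by rewrite (fkint_sym (edge_mean F) (edge_mean G)) (dotC b1 (edge_mean F)).
Qed.

Lemma avg_bounded F : sqn b2 (avg F) <= 4 * sqn b2 F.
Proof.
apply: le_trans (symm_sqn_le _) _; rewrite ler_pM2l//.
apply: le_trans (edge_mean_bounded _) _.
by have := fkint_bounded F; rewrite mul1r.
Qed.

(** The operator which [avg] induces on the means over edges, see [edge_mean_avg]. *)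
Definition cavg f : H1 := fkint f + fflip (ftrans (fkint f)).

Lemma edge_mean_avg F : sqn b1 (edge_mean (avg F) - cavg (edge_mean F)) = 0.
Proof.
apply/sqn_eqP => k; rewrite (dot_eql k (edge_mean_symm (edge_mean (fkint F)))) /cavg.
rewrite (dotDl b1 (edge_mean (fkint F))) (dotDl b1 (fkint (edge_mean F))) (dot_eql k
  (edge_mean_kint F)).
rewrite (fflip_sym (ftrans (edge_mean (fkint F))) k) (fflip_sym (ftrans (fkint (edge_mean F))) k).
by rewrite (ftrans_sym (edge_mean (fkint F))) (ftrans_sym (fkint (edge_mean F))) (dot_eql _
  (edge_mean_kint F)).
Qed.

(** If [avg F - l F] is small, then so is its mean over edges, which is [cavg - l] applied to
    [edge_mean F]; hence [edge_mean F] is small, and [avg F] depends on [F] only through it.  As [l]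
    is nonzero, [F] is small. *)
Lemma avg_bounded_below (l : R) : l != 0 ->
  bounded_below b1 (fun f => cavg f - l *: f) ->
  bounded_below b2 (fun F => avg F - l *: F).
Proof.
move=> l0 [d d0 hd].
have l2 : 0 < l ^+ 2 by rewrite exprn_even_gt0.
exists (l ^+ 2 / (8 / d + 2)) => [|F].
  by rewrite divr_gt0// ltr_wpDl// divr_ge0// ltW.
pose G := avg F - l *: F.
have hMF : sqn b1 (edge_mean F) <= sqn b2 G / d.
  rewrite ler_pdivlMr// mulrC; apply: le_trans (hd _) _.
  apply: le_trans (edge_mean_bounded G); rewrite le_eqVlt; apply/orP; left; apply/eqP.
  apply: sqn_eq; apply/sqn_eqP => k.
  rewrite (edge_mean_adjoint G k) /G (dotBl b2) (dotZl b2) -(edge_mean_adjoint (avg F) k)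
    -(edge_mean_adjoint F k).
  by rewrite (dot_eql k (edge_mean_avg F)) (dotBl b1) (dotZl b1).
have havg : sqn b2 (avg F) <= 4 * sqn b1 (edge_mean F).
  apply: (le_trans (symm_sqn_le (edge_mean (fkint F))));
    rewrite ler_pM2l// (sqn_eq (edge_mean_kint F)).
  by have := fkint_bounded (edge_mean F); rewrite mul1r.
have hl : l ^+ 2 * sqn b2 F <= 2 * sqn b2 (avg F) + 2 * sqn b2 G.
  rewrite -sqnZ (_ : l *: F = avg F - G); first exact: sqnB_le.
  by rewrite /G opprB addrC subrK.
rewrite mulrAC ler_pdivrMr; last by rewrite ltr_wpDl// divr_ge0// ltW.
apply: (le_trans hl); rewrite -/G.
have -> : sqn b2 G * (8 / d + 2) = 8 * (sqn b2 G / d) + 2 * sqn b2 G by field; rewrite gt_eqF.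
lra.
Qed.

End network_operators2.

(** * From lower bounds for the transition operator to averaging *)

Section spectral_correspondence.
Variables (R : realType) (X : countType) (N : network R X) (x0 : X).
Local Notation U := (U01 R).
Local Notation mR := (measurableTypeR R).
Local Notation V := (disc x0).
Local Notation E := (disc (x0, x0)).
Local Notation mu0 := (mu0 N x0).
Local Notation mu1 := (mu1 N x0).
Local Notation step := (step N x0).
Local Notation H0 := (L2 mu0).
Local Notation H1 := (L2 (mu0 \x U)%E).
Local Notation H2 := (L2 (mu1 \x U)%E).
Local Notation b0 := (l2_ip mu0).
Local Notation b1 := (l2_ip (mu0 \x U)%E).
Local Notation b2 := (l2_ip (mu1 \x U)%E).
Implicit Types (F : H2) (f h : H1) (g : H0).

Definition vtrans_fun (g : V -> R) (x : V) : R := \int[step x]_y g y.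

Lemma vtrans_sqr_total g :
  (\int[mu0]_x (g x ^+ 2)%:E = \int[mu0]_x \int[step x]_y (g y ^+ 2)%:E)%E.
Proof.
rewrite -(@ge0_disintegration R X N x0 (fun e => (g e.2 ^+ 2)%:E)); last first.
  by move=> e; rewrite lee_fin sqr_ge0.
rewrite -(@ge0_integral_rev_edge R X N x0 (fun e => (g e.2 ^+ 2)%:E)); last first.
  by move=> e; rewrite lee_fin sqr_ge0.
rewrite ge0_disintegration; last by move=> e; rewrite lee_fin sqr_ge0.
apply: eq_integral => x _; apply/esym.
by apply: (@integral_step_cst R X N x0 x (g x ^+ 2)%:E); rewrite lee_fin sqr_ge0.
Qed.

Fact vtrans_fun_finite g : (\int[mu0]_x (vtrans_fun g x ^+ 2)%:E < +oo)%E.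
Proof.
apply: le_lt_trans (L2_finite g); rewrite vtrans_sqr_total.
apply: ge0_le_integral => //.
- by move=> x _; rewrite lee_fin sqr_ge0.
- by move=> x _; apply: Rintegral_sqr_le => //=; rewrite step_setT.
Qed.

Fact measurable_vertex_fun (g : V -> R) : measurable_fun setT (g : V -> R).
Proof. exact: measurable_fun_disc. Qed.

Definition vtrans g : H0 := L2mk (measurable_vertex_fun (vtrans_fun g)) (vtrans_fun_finite g).

Lemma ftrans_tensor g (S : L2 U) : ftrans (tensor g S) = tensor (vtrans g) S :> H1.
Proof.
apply/LfuneqP => -[x t]; rewrite ftransE /= /tensor_fun/= /vtrans_fun mulrC.
rewrite -RintegralZl_total; last exact: measurable_fun_disc.
by apply: eq_Rintegral => y _; exact: mulrC.
Qed.

(** Functions on vertices embed as functions that are constant in [t]; symmetry and the norm bound of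
    the transition operator are inherited in this way. *)
Lemma dot_tensor1 g g' : b1 (tensor g (cst01 1)) (tensor g' (cst01 1)) = b0 g g'.
Proof.
rewrite dot_fiberE; apply: eq_Rintegral => x _.
rewrite (eq_Rintegral _ (g := cst (g x * g' x))) ?U01_cst//.
by move=> t _; rewrite /= /tensor_fun/= !mulr1.
Qed.

Lemma vtrans_sym : symmetric_op b0 vtrans.
Proof.
by move=> g g'; rewrite -!dot_tensor1 -!ftrans_tensor ftrans_sym.
Qed.

Lemma vtrans_bounded : bounded_op b0 vtrans 1.
Proof.
move=> g; have := ftrans_bounded (tensor g (cst01 1) : H1).
by rewrite ftrans_tensor /sqn !dot_tensor1.
Qed.

Lemma tonelli_sqr_swap (k : V * mR -> R) : measurable_fun setT k ->
  (\int[(mu0 \x U)%E]_z (k z ^+ 2)%:E = \int[U]_t \int[mu0]_x (k (x, t) ^+ 2)%:E)%E.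
Proof.
move=> mk; apply: (fubini_tonelli2 (EFin \o (fun z : V * mR => k z ^+ 2))).
  by apply/measurable_EFinP; apply: measurable_funX.
by move=> z; rewrite lee_fin sqr_ge0.
Qed.

(** The bound holds for the vertex functions [f (-, t)] at almost every [t] and is integrated. *)
Lemma ftrans_bounded_below p :
  bounded_below b0 (fun g => vtrans g - p *: g) ->
  bounded_below b1 (fun f => ftrans f - p *: f).
Proof.
move=> [d d0 hd]; exists d => // f.
have mf := L2_measurable f; have mk := L2_measurable (ftrans f - p *: f).
rewrite -lee_fin EFinM !l2_sqnE (tonelli_sqr_swap mf) (tonelli_sqr_swap mk).
have sq (k : H1) : measurable_fun setT (EFin \o (fun z : V * mR => k z ^+ 2)).
  by apply/measurable_EFinP; apply: measurable_funX; exact: L2_measurable.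
have sq0 (k : H1) z : (0 <= (EFin \o (fun z : V * mR => (k z ^+ 2)%R)) z)%E.
  by rewrite lee_fin sqr_ge0.
have mG (k : H1) := measurable_fun_fubini_tonelli_G (m1 := mu0) _ (sq k) (sq0 k).
have G0 (k : H1) t : (0 <= \int[mu0]_x (k (x, t) ^+ 2)%:E)%E.
  by apply: integral_ge0 => x _; rewrite lee_fin sqr_ge0.
rewrite -ge0_integralZl//; last 2 first.
- exact: (mG f).
- by rewrite lee_fin ltW.
apply: ae_ge0_le_integral => //.
- by move=> t _; rewrite mule_ge0// lee_fin ltW.
- by apply: measurable_funeM; exact: (mG f).
- exact: (mG (ftrans f - p *: f)).
have fin : {ae U, forall t, (\int[mu0]_x (f (x, t) ^+ 2)%:E < +oo)%E}.
  have : U.-integrable setT (fubini_G mu0 (EFin \o (fun z : V * mR => f z ^+ 2))).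
    apply/integrableP; split => //.
    rewrite (eq_integral (fubini_G mu0 (EFin \o (fun z : V * mR => f z ^+ 2)))); last first.
      by move=> t _; rewrite gee0_abs//; exact: G0.
    by rewrite -tonelli_sqr_swap//; exact: L2_finite.
  move=> /(integrable_ae measurableT).
  apply: (@filterS _ _ (ae_filter_ringOfSetsType U)) => t /(_ I).
  by rewrite ge0_fin_numE//; exact: G0.
apply: (@filterS _ _ (ae_filter_ringOfSetsType U) _ _ _ fin) => t ft _.
pose gt : H0 := L2mk (measurable_vertex_fun (fun x : V => f (x, t))) ft.
by have := hd gt; rewrite -lee_fin EFinM !l2_sqnE.
Qed.

(** The bound holds for the functions [f (x, -)] at almost every vertex [x] and is integrated. *)
Lemma cavg_fiber_bound (l p C : R) : 0 < C ->
  (forall h k : L2 U,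
    (forall t, 0 <= t <= 1 -> l * h t = kint h t + p * kint h (flip t) + k t) ->
    sqn (l2_ip U) h <= C * sqn (l2_ip U) k) ->
  forall f, sqn b1 f <= C * sqn b1 (l *: f - fkint f - p *: fflip (fkint f)).
Proof.
move=> C0 hC f; pose k : H1 := l *: f - fkint f - p *: fflip (fkint f).
rewrite -/k -lee_fin EFinM !sqn_fiberE -ge0_integralZl//; last 2 first.
- by move=> x _; apply: integral_ge0 => t _; rewrite lee_fin sqr_ge0.
- by rewrite lee_fin ltW.
apply: ae_ge0_le_integral => //.
- by move=> x _; apply: integral_ge0 => t _; rewrite lee_fin sqr_ge0.
- move=> x _; rewrite mule_ge0 ?lee_fin ?(ltW C0)//.
  by apply: integral_ge0 => t _; rewrite lee_fin sqr_ge0.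
apply: (@filterS2 _ _ (ae_filter_ringOfSetsType mu0) _ _ _ _ (ae_fiber_finite f) (ae_fiber_finite
  k)) => x hf hk _.
have := hC (fiber_L2 hf) (fiber_L2 hk); rewrite -lee_fin EFinM !l2_sqnE; apply.
move=> t t01; rewrite /=.
transitivity (fkint f (x, t) + p * fflip (fkint f) (x, t) + (l * f (x, t) - fkint f (x, t) - p *
  fflip (fkint f) (x, t))); last by [].
by ring.
Qed.

Section localize.
Variable l : R.
Let T f := cavg f - l *: f.

Let Tstar f := fkint f + fkint (ftrans (fflip f)) - l *: f.

Let T_adj f w : b1 (T f) w = b1 f (Tstar w).
Proof.
rewrite /T /Tstar /cavg (dotBl b1) (dotDl b1) (dotZl b1) (dotBr b1) (dotDr b1) (dotZr b1).
by rewrite (fkint_sym f w) (fflip_sym (ftrans (fkint f)) w) (ftrans_sym (fkint f) (fflip w))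
  (fkint_sym f).
Qed.

Let q_dot f h := b1 (T f) (T h).
Let q_dotC f h : q_dot f h = q_dot h f. Proof. exact: dotC. Qed.
Let q_dotP a f h w : q_dot (a *: f + h) w = a * q_dot f w + q_dot h w.
Proof. by rewrite /q_dot !T_adj dotP. Qed.
Let q_ge0 f : 0 <= q_dot f f. Proof. exact: dot_ge0. Qed.
Let q := SemiIp q_dotC q_dotP q_ge0.

Let T_P f : sqn b1 (T (ftrans f) - ftrans (T f)) = 0.
Proof.
apply/sqn_eqP => w; rewrite (ftrans_sym (T f) w) /T /cavg !(dotBl b1) !(dotDl b1) !(dotZl b1).
rewrite (ftrans_sym f w) -(ftrans_sym (fkint f) w) -(dot_eql w (ftrans_kint f)).
congr (_ + _ - _).
rewrite -(ftrans_sym (fflip (ftrans (fkint f))) w) ftrans_flip.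
rewrite (fflip_sym (ftrans (fkint (ftrans f))) w) (ftrans_sym (fkint (ftrans f))) -(dot_eql _
  (ftrans_kint f)) -ftrans_sym -fflip_sym.
by [].
Qed.

(** Localization along the transition operator [P], for the form [q f = |(cavg - l) f|^2]:
    when [P f] is close to [p f], the operator [cavg - l] is close to that of the fiber problem with
    parameter [p]. *)
Lemma cavg_bounded_below : l != 0 ->
  (forall p, bounded_below b0 (fun g => vtrans g - p *: g) \/
    exists2 C, 0 < C & forall h k : L2 U,
    (forall t, 0 <= t <= 1 -> l * h t = kint h t + p * kint h (flip t) + k t) ->
    sqn (l2_ip U) h <= C * sqn (l2_ip U) k) ->
  bounded_below b1 T.
Proof.
have le3 (a c e : R) : e <= c -> 2 * e + 2 * a <= (a + c) * 2 by move=> ec; lra.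
move=> l0 hp.
have Pq : bounded_op q (@ftrans R X N x0) 1.
  move=> f; rewrite mul1r -[sqn q _]/(sqn b1 (T (ftrans f))) -[sqn q f]/(sqn b1 (T f)).
  by rewrite (sqn_eq (T_P f)); have := ftrans_bounded (T f); rewrite mul1r.
apply: (spectral_localization (q := q) (@ftrans_sym R X N x0) (@ftrans_bounded R X N x0) Pq) => p.
have [/ftrans_bounded_below[d d0 hd]|[C C0 hC]] := hp p.
  exists d; first exact: d0.
  move=> f; have h1 := hd f; have h2 := sqn_ge0 q f.
  by apply: (le_trans h1); rewrite lerDr.
exists (2 * C)^-1; first by rewrite invr_gt0 mulr_gt0.
move=> f; rewrite mulrC ler_pdivrMr ?mulr_gt0//.
apply: (le_trans (cavg_fiber_bound C0 hC f)).
rewrite [leRHS]mulrA [leRHS]mulrC ler_pM2l//.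
set k := (X in sqn b1 X).
have kE : k = fflip (ftrans (fkint f) - p *: fkint f) - T f.
  apply/LfuneqP => -[x t].
  transitivity (l * f (x, t) - fkint f (x, t) - p * fkint f (x, flip t)); first by [].
  transitivity (ftrans (fkint f) (x, flip t) - p * fkint f (x, flip t) -
    (fkint f (x, t) + ftrans (fkint f) (x, flip t) - l * f (x, t))); last by [].
  ring.
rewrite [X in X <= _](_ : sqn b1 k = sqn b1 (fflip (ftrans (fkint f) - p *: fkint f) - T f));
  last by rewrite kE.
apply: le_trans (sqnB_le _ _ _) _; rewrite fflip_sqn.
have -> : sqn b1 (ftrans (fkint f) - p *: fkint f) = sqn b1 (fkint (ftrans f - p *: f)).
  apply: sqn_eq; apply/sqn_eqP => w.
  rewrite (fkint_sym (ftrans f - p *: f) w) (dotBl b1) (dotZl b1) (dotBl b1) (dotZl b1).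
  by rewrite (dot_eql w (ftrans_kint f)) (fkint_sym (ftrans f)) (fkint_sym f).
have := fkint_bounded (ftrans f - p *: f); rewrite mul1r => hK.
exact: (le3 (sqn b1 (T f)) _ _ hK).
Qed.

End localize.
End spectral_correspondence.

(** * From lower bounds for averaging to the transition operator *)

Fact combine_bounds (R : realType) (l d a c k s g : R) : 0 < d -> 0 <= c ->
  d * a <= 4 * (c * k) -> l ^+ 2 * (g * s) <= 2 * a + 2 * (c * k) ->
  d * (l ^+ 2 * s) * g <= c * (8 * k + 2 * d * k + 1).
Proof. by move=> d0 c0 h1 /(ler_wpM2l (ltW d0)) h2; lra. Qed.

Fact centred_interval_flip (R : realType) (e t : R) :
  (1 / 2 - e <= 1 - t <= 1 / 2 + e) = (1 / 2 - e <= t <= 1 / 2 + e).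
Proof. by apply/andP/andP => -[? ?]; split; lra. Qed.

Section glued_functions.
Variables (R : realType) (X : countType) (N : network R X) (x0 : X).
Local Notation U := (U01 R).
Local Notation mR := (measurableTypeR R).
Local Notation V := (disc x0).
Local Notation E := (disc (x0, x0)).
Local Notation mu0 := (mu0 N x0).
Local Notation mu1 := (mu1 N x0).
Local Notation step := (step N x0).
Local Notation H0 := (L2 mu0).
Local Notation H1 := (L2 (mu0 \x U)%E).
Local Notation H2 := (L2 (mu1 \x U)%E).
Local Notation b0 := (l2_ip mu0).
Local Notation b1 := (l2_ip (mu0 \x U)%E).
Local Notation b2 := (l2_ip (mu1 \x U)%E).
Implicit Types (F : H2) (f h : H1) (g : H0).

Lemma sqn_eq0_fiber d (T : measurableType d) (m : {sigma_finite_measure set T -> \bar R})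
    (f : L2 (m \x U)%E) :
  {ae m, forall x, forall t, 0 <= t <= 1 -> f (x, t) = 0} -> sqn (l2_ip _) f = 0.
Proof.
move=> f0; apply: EFin_inj; rewrite sqn_fiberE -[RHS](integral0 m setT).
apply: ae_eq_integral => //.
  have mf2 : measurable_fun setT (EFin \o (fun z : T * mR => f z ^+ 2)).
    by apply/measurable_EFinP; apply: measurable_funX; exact: L2_measurable.
  apply: (measurable_fun_fubini_tonelli_F (m2 := U) _ mf2) => z.
  by rewrite lee_fin sqr_ge0.
apply: (@filterS _ _ (ae_filter_ringOfSetsType m) _ _ _ f0) => x fx _.
rewrite -[RHS](integral0 U setT); apply: ae_eq_integral => //.
  apply/measurable_EFinP; apply: measurable_funX; apply: measurable_fiber.
  exact: L2_measurable.
have := ae_U01 fx; apply: (@filterS _ _ (ae_filter_ringOfSetsType U)) => t /= -> _.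
by rewrite expr0n.
Qed.

Lemma sqn_eq0_01 d (T : measurableType d) (m : {sigma_finite_measure set T -> \bar R})
    (f : L2 (m \x U)%E) :
  (forall x t, 0 <= t <= 1 -> f (x, t) = 0) -> sqn (l2_ip _) f = 0.
Proof. by move=> f0; apply: sqn_eq0_fiber; exact: (aeW m f0). Qed.

(** Pairs of vertices that are not adjacent form a null set, so conditions on edges suffice. *)
Lemma ae_adj : {ae mu1, forall e, adj N e.1 e.2}.
Proof.
exists [set e : E | ~~ adj N e.1 e.2]; split => //.
  apply: esum1 => e /= /negbTE ne; by rewrite /conductance ne.
by move=> e /= /negP.
Qed.

Definition glued (F : X * X * R -> R) :=
  (forall x y t, adj N x y -> 0 <= t <= 1 -> F (x, y, t) = F (y, x, 1 - t)) /\
  (forall x y z, adj N x y -> adj N x z -> F (x, y, 0) = F (x, z, 0)).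

Lemma glued_reversal F : glued F -> sqn b2 (reversal F - F) = 0.
Proof.
move=> [Fsym _]; apply: sqn_eq0_fiber.
apply: (@filterS _ _ (ae_filter_ringOfSetsType mu1) _ _ _ ae_adj) => -[x y] /= xy t t01.
apply/eqP; rewrite -/(_ - _) subr_eq0 eq_sym; apply/eqP; exact: Fsym.
Qed.

Lemma kint1 (u : mR -> R) : measurable_fun setT u -> kint u 1 = 0.
Proof.
move=> mu_; rewrite kintE ?ler01 ?lexx// subrr set_itv1.
by rewrite Rintegral_set1.
Qed.

Lemma measurable_edge F x u : measurable_fun setT (fun s : mR => F (x, u, s)).
Proof. by apply: (measurable_fiber (h := F)); exact: L2_measurable. Qed.

(** At [t = 0] the integral from the far end of the edge is over a point, so the value is the same on
    all edges at [x]. *)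
Lemma avg_glued F : glued (avg F).
Proof.
have k1 x : \int[step x]_u kint (fun s => F (x, u, s)) 1 = 0.
  rewrite (eq_Rintegral _ (g := cst 0)); first by rewrite Rintegral_cst ?mul0r.
  by move=> u _; rewrite kint1//; exact: measurable_edge.
split=> [x y t _ _|x y z _ _]; first by rewrite !avgE -/(flip t) flipK addrC.
by rewrite !avgE /flip subr0 !k1.
Qed.

Section vertex_extension.
Variables (l p : R) (S : L2 U).
Hypotheses (l0 : l != 0) (S0 : S 0 = 0) (S1 : S 1 != 0) (eS : fiber_eigen l p S).

Let Sb := flip_L2 S.

Let sqnS_gt0 : 0 < sqn (l2_ip U) S.
Proof.
rewrite lt_neqAle sqn_ge0 andbT eq_sym; apply/eqP => h.
have kint0 (u : L2 U) t : sqn (l2_ip U) u = 0 -> kint u t = 0.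
  move=> u0; have := kint_sqr_le t (L2_measurable u).
  rewrite -l2_sqnE u0 lee_fin => h2; apply/eqP; rewrite -sqrf_eq0 eq_le h2 sqr_ge0//.
have := eS (t := 0); rewrite lexx ler01 => /(_ isT).
rewrite (kint0 S)// (kint0 Sb) ?flip_L2_sqn// mulr0 addr0 /flip subr0 => /esym/eqP.
by rewrite mulf_eq0 (negbTE l0) (negbTE S1).
Qed.

(** Its value at [(x, y, t)] is [g x * S (1 - t) + g y * S t]. *)
Definition extension g : H2 := symm (tensor g Sb).

Lemma extension_glued g : glued (extension g).
Proof.
have e x y t : extension g (x, y, t) = g x * S (1 - t) + g y * S t.
  by rewrite -[X in _ = _ + _ * S X]flipK.
split=> [x y t _ _|x y z _ _]; rewrite !e.
  by rewrite [1 - (1 - t)](_ : _ = t) 1?addrC//; ring.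
by rewrite S0 subr0 !mulr0.
Qed.

(** Up to symmetrization, this says that [avg - l] maps the extension of [g] to the product of
    [P g - p g] and a fixed function of [t], by the eigenfunction equation for [S]. *)
Lemma extension_defect g :
  sqn b1 (edge_mean (fkint (extension g)) - l *: tensor g Sb
    - tensor (vtrans g - p *: g) (kint_L2 S)) = 0.
Proof.
pose h : H1 := tensor g Sb.
have e1 w : b1 (edge_mean (fkint (extension g))) w = b1 (fkint h + fkint (fflip (ftrans h))) w.
  rewrite (dot_eql w (edge_mean_kint (extension g))) (fkint_sym (edge_mean (extension g)) w).
  by rewrite (dot_eql (fkint w) (edge_mean_symm h)) (dotDl b1) (dotDl b1 (fkint h)) (fkint_sym h
    w) (fkint_sym (fflip (ftrans h)) w).
have e2 : sqn b1 (fkint h + fkint (fflip (ftrans h)) - l *: h - tensor (vtrans g - p *: g)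
  (kint_L2 S)) = 0.
  apply: sqn_eq0_01 => x t t01.
  transitivity (fkint h (x, t) + fkint (fflip (ftrans h)) (x, t) - l * (g x * S (flip t)) -
    (vtrans g x - p * g x) * kint S t); first by [].
  have -> : fflip (ftrans h) = tensor (vtrans g) S.
    by rewrite /h ftrans_tensor; apply/LfuneqP => -[y s] /=;
      rewrite /tensor_fun/= /fflip_fun/= flipK.
  rewrite !fkint_tensor/=.
  have := eS t01; rewrite (_ : S \o flip = Sb)// => e.
  transitivity (g x * (kint Sb t + p * kint S t - l * S (flip t))); first by ring.
  by rewrite e subrr mulr0.
apply/sqn_eq0P => w; rewrite -[RHS](dot_eq0l w e2).
by rewrite !(dotBl b1) e1.
Qed.

(** A lower bound for [avg - l] bounds the extension of [g] by [P g - p g] through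
    [extension_defect]; the same lemma bounds [l g] by the extension and by [P g - p g]. *)
Lemma vtrans_bounded_below :
  (exists2 d, 0 < d & forall F, glued F -> d * sqn b2 F <= sqn b2 (avg F - l *: F)) ->
  bounded_below b0 (fun g => vtrans g - p *: g).
Proof.
move=> [d d0 hd].
pose s := sqn (l2_ip U) S; pose k := sqn (l2_ip U) (kint_L2 S).
have k0 : 0 <= k by exact: sqn_ge0.
have l2 : 0 < l ^+ 2 by rewrite exprn_even_gt0.
have c0 : 0 < 8 * k + 2 * d * k + 1.
  have : 0 <= d * k by rewrite mulr_ge0// ltW.
  lra.
exists (d * (l ^+ 2 * s) / (8 * k + 2 * d * k + 1)).
  by rewrite divr_gt0// mulr_gt0// mulr_gt0//; exact: sqnS_gt0.
move=> g; pose r := vtrans g - p *: g; pose h : H1 := tensor g Sb.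
pose F := extension g; pose v := edge_mean (fkint F) - l *: h.
have vE : sqn b1 v = sqn b0 r * k.
  by rewrite (sqn_eq (extension_defect g)) sqn_tensor.
have hE : sqn b1 h = sqn b0 g * s by rewrite sqn_tensor flip_L2_sqn.
have le1 : d * sqn b2 F <= 4 * (sqn b0 r * k).
  apply: (le_trans (hd F (extension_glued g))); rewrite -vE.
  have -> : avg F - l *: F = symm v.
    apply/LfuneqP => -[[x y] t].
    transitivity (edge_mean (fkint F) (x, t) + edge_mean (fkint F) (y, flip t) - l * (h (x, t) +
      h (y, flip t))); first by [].
    transitivity (edge_mean (fkint F) (x, t) - l * h (x, t) + (edge_mean (fkint F) (y, flip t) -
      l * h (y, flip t))); last by [].
    by move: (edge_mean _ _) (edge_mean _ _) (h _) (h _) => m1 m2 h1 h2; ring.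
  exact: symm_sqn_le.
have le2 : l ^+ 2 * (sqn b0 g * s) <= 2 * sqn b2 F + 2 * (sqn b0 r * k).
  rewrite -hE -(sqnZ b1) (_ : l *: h = edge_mean (fkint F) - v); last first.
    by rewrite /v opprB addrC subrK.
  apply: le_trans (sqnB_le _ _ _) _; rewrite vE lerD2r ler_pM2l//.
  apply: le_trans (edge_mean_bounded _) _; have := fkint_bounded F; by rewrite mul1r.
have r0 : 0 <= sqn b0 r := sqn_ge0 b0 r.
rewrite -/r mulrAC ler_pdivrMr//.
exact: (combine_bounds d0 r0 le1 le2).
Qed.

End vertex_extension.

(** On the indicator function of an interval of length [s] inside an edge, the square of the norm is
    of order [s], whereas integration along the edge makes it of order [s ^+ 2]. *)
Lemma avg_not_bounded_below d : 0 < d ->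
  exists2 F : H2, glued F & sqn b2 (avg F) < d * sqn b2 F.
Proof.
move=> d0.
have [a [b ab]] := adj_edge N.
have sq1 d' (T : measurableType d') (A : set T) t : (\1_A t : R) ^+ 2 = \1_A t.
  by rewrite indicE; case: (_ \in _); rewrite ?expr1n ?expr0n.
pose A : set E := [set (a, b)] `|` [set (b, a)].
have iA : (\int[mu1]_e (\1_A e ^+ 2)%:E = mu1 A)%E.
  by under eq_integral do rewrite sq1; rewrite integral_indic// setIT.
have mu1E e : mu1 [set e] = (conductance N e.1 e.2)%:E by exact: wsum_set1.
have muA : (mu1 A < +oo)%E.
  apply: (@le_lt_trans _ _ (mu1 [set (a, b)] + mu1 [set (b, a)])%E).
    exact: measureU2.
  by rewrite !mu1E -EFinD ltry.
have mA : measurable_fun setT (\1_A : E -> R) by exact: measurable_fun_disc.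
pose u : L2 mu1 := L2mk mA (eq_ind_r (fun z => (z < +oo)%E) muA iA).
have u0 : 0 < sqn (l2_ip mu1) u.
  rewrite -lte_fin l2_sqnE iA; apply: (@lt_le_trans _ _ (mu1 [set (a, b)])).
    by rewrite mu1E lte_fin /conductance ab cond_gt0.
  by apply: le_measure; rewrite ?inE//; left.
(* The interval has length [2 * e] and center [1 / 2]; the norms compare as [4 * (2 * e) ^+ 2] to
   [d * (2 * e)]. *)
have [e [e0 e4 ed]] : exists e : R, [/\ 0 < e, e <= 1 / 4 & 16 * e <= d].
  exists (Num.min (1 / 4) (d / 16)); split.
  - by rewrite lt_min; apply/andP; split; lra.
  - by rewrite ge_min lexx.
  - by have : Num.min (1 / 4) (d / 16) <= d / 16; [rewrite ge_min lexx orbT|lra].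
pose I : set R := [set` `[1 / 2 - e, 1 / 2 + e] ].
have mI : measurable (I : set mR) by exact: measurable_itv.
have UI : U I = (2 * e)%:E.
  rewrite U01E// setIidl; last first.
    move=> t; rewrite /I/= !in_itv/= => /andP[h1 h2]; apply/andP; split; lra.
  rewrite lebesgue_measure_itv/= lte_fin ifT; last by lra.
  by rewrite -EFinB; congr EFin; ring.
have m1 : measurable_fun setT (\1_I : mR -> R) by exact: measurable_indic.
have i1 : (\int[U]_t (\1_I t ^+ 2)%:E = (2 * e)%:E)%E.
  under eq_integral do rewrite sq1.
  by rewrite integral_indic// setIT.
have f1 : (\int[U]_t (\1_I t ^+ 2)%:E < +oo)%E by rewrite i1 ltry.
pose S : L2 U := L2mk m1 f1.
have sS : sqn (l2_ip U) S = 2 * e by apply: EFin_inj; rewrite l2_sqnE -i1.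
have kS : sqn (l2_ip U) (kint_L2 S) <= (2 * e) ^+ 2.
  rewrite -lee_fin l2_sqnE -[leRHS](@integral_U01_cst R).
  apply: ge0_le_integral => //.
  - by move=> t _; rewrite lee_fin sqr_ge0.
  - by apply/measurable_EFinP; apply: measurable_funX; exact: L2_measurable.
  have S0 t : 0 <= S t by rewrite /S/= indicE.
  have Si : \int[U]_t S t = 2 * e.
    rewrite -sS /sqn/= /l2_dot; apply: eq_Rintegral => t _.
    by rewrite -expr2 sq1.
  have kb t := kint_bounds t (L2_measurable S) (L2_U01_integrable S) S0.
  move=> t _; rewrite lee_fin; have /andP[k0 k1] := kb t.
  by rewrite lerXn2r ?nnegrE// -?Si//; exact: le_trans k1.
have h1 : sqn b2 (avg (tensor u S)) <= 4 * sqn b2 (fkint (tensor u S)).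
  by apply: le_trans (symm_sqn_le _) _; rewrite ler_pM2l//; exact: edge_mean_bounded.
have h2 : fkint (tensor u S) = tensor u (kint_L2 S) :> H2.
  by apply/LfuneqP => z; rewrite fkint_tensor.
exists (tensor u S); last first.
  apply: (le_lt_trans h1); rewrite h2 !sqn_tensor sS.
  rewrite mulrCA [ltRHS]mulrCA ltr_pM2l//.
  apply: (@le_lt_trans _ _ (4 * (2 * e) ^+ 2)); first by rewrite ler_pM2l.
  have -> : 4 * (2 * e) ^+ 2 = 16 * e * e by ring.
  have : 16 * e * e <= d * e by rewrite ler_pM2r.
  have : 0 < d * e by rewrite mulr_gt0.
  lra.
have uC x y : u (x, y) = u (y, x).
  rewrite /u/= !indicE; congr (_%:R); congr nat_of_bool.
  apply/idP/idP; rewrite !inE /A/=; move=> [[-> ->]|[-> ->]]; by [left|right].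
have SC t : S (1 - t) = S t.
  by rewrite /S/= !indicE !mem_setE !in_itv/= centred_interval_flip.
have S0 : S 0 = 0.
  rewrite /S/= indicE memNset// /I/= in_itv/= => /andP[]; lra.
split=> [x y t _ _|x y z _ _].
  by transitivity (u (x, y) * S t); [by []|rewrite uC -SC].
have z0 e' : tensor u S (e', 0) = 0 by transitivity (u e' * S 0); [by []|rewrite S0 mulr0].
by rewrite !z0.
Qed.

End glued_functions.

(** * Unordered sums as integrals *)

Section matching.
Variables (R : realType) (X : countType) (N : network R X) (x0 : X).
Local Notation U := (U01 R).
Local Notation mR := (measurableTypeR R).
Local Notation V := (disc x0).
Local Notation E := (disc (x0, x0)).
Local Notation mu0 := (mu0 N x0).
Local Notation mu1 := (mu1 N x0).
Local Notation step := (step N x0).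
Local Notation H0 := (L2 mu0).
Local Notation H1 := (L2 (mu0 \x U)%E).
Local Notation H2 := (L2 (mu1 \x U)%E).
Local Notation b0 := (l2_ip mu0).
Local Notation b1 := (l2_ip (mu0 \x U)%E).
Local Notation b2 := (l2_ip (mu1 \x U)%E).
Implicit Types (F : H2) (f h : H1) (g : H0).

Lemma step_esum x (k : V -> \bar R) : (forall y, 0 <= k y)%E ->
  ((m0 N x)%:E * \int[step x]_y k y = \esum_(y in nbhd N x) ((cond N x y)%:E * k y))%E.
Proof.
move=> k0; rewrite -ge0_integralZl//; last by rewrite lee_fin m0_ge0.
rewrite [LHS]integral_wsum; last by move=> y; rewrite mule_ge0// lee_fin m0_ge0.
rewrite -esum_conductance; apply: eq_esum => y _.
by rewrite muleA -EFinM /transition_prob divfK// gt_eqF// m0_gt0.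
Qed.

Lemma step_integrable x (k : V -> R) : (\int[step x]_y (k y ^+ 2)%:E < +oo)%E ->
  (step x).-integrable setT (EFin \o k).
Proof.
move=> kf; pose u : L2 (step x) := L2mk (measurable_vertex_fun k) kf.
have f1 : (\int[step x]_y ((cst 1 : V -> R) y ^+ 2)%:E < +oo)%E.
  under eq_integral do rewrite expr1n.
  by rewrite [X in (X < _)%E](@integral_step_cst R X N x0 x 1%E) ?ltry.

pose v : L2 (step x) := L2mk (measurable_cst (1 : R)) f1.
by have := L2_mul_integrable u v; apply: eq_integrable => // y _ /=; rewrite mulr1.
Qed.

(** Square integrability makes both unordered sums finite, and then their difference is the
    integral. *)
Lemma rsum_step x (k : V -> R) : (\int[step x]_y (k y ^+ 2)%:E < +oo)%E ->
  (m0 N x)^-1 * rsum (nbhd N x) (fun y => cond N x y * k y) = \int[step x]_y k y.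
Proof.
move=> kf; have ki := step_integrable kf.
have mn : m0 N x != 0 by rewrite gt_eqF// m0_gt0.
rewrite /rsum.
have ep : (esum (nbhd N x) (fun y => (cond N x y * k y)%:E)^\+ =
    (m0 N x)%:E * \int[step x]_y (EFin \o k)^\+ y)%E.
  rewrite step_esum//; apply: eq_esum => y xy.
  by rewrite !funeposE maxe_pMr ?mule0// lee_fin ltW// cond_gt0.
have en : (esum (nbhd N x) (fun y => (cond N x y * k y)%:E)^\- =
    (m0 N x)%:E * \int[step x]_y (EFin \o k)^\- y)%E.
  rewrite step_esum//; apply: eq_esum => y xy.
  by rewrite !funenegE maxe_pMr ?mule0 ?muleN// lee_fin ltW// cond_gt0.
have fp := integrable_fin_num measurableT (integrable_funepos measurableT ki).
have fn := integrable_fin_num measurableT (integrable_funeneg measurableT ki).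
rewrite ep en !fineM// -mulrBr mulKf// /Rintegral [in RHS]integralE.
by rewrite (fineB fp fn).
Qed.

Lemma csum_step x (k1 k2 : V -> R) (h : X -> R[i]) :
  (forall y, adj N x y -> h y = k1 y +i* k2 y) ->
  (\int[step x]_y (k1 y ^+ 2)%:E < +oo)%E -> (\int[step x]_y (k2 y ^+ 2)%:E < +oo)%E ->
  ((m0 N x)^-1)%:C * csum (nbhd N x) (fun y => (cond N x y)%:C * h y) =
  (\int[step x]_y k1 y) +i* (\int[step x]_y k2 y).
Proof.
move=> hk f1 f2; rewrite -(rsum_step f1) -(rsum_step f2) /csum.
have e1 : rsum (nbhd N x) (fun y => complex.Re ((cond N x y)%:C * h y)) =
    rsum (nbhd N x) (fun y => cond N x y * k1 y).
  rewrite /rsum; congr (fine _ - fine _); apply: eq_esum => y xy;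
  by rewrite ?funeposE ?funenegE hk//= mul0r subr0.
have e2 : rsum (nbhd N x) (fun y => complex.Im ((cond N x y)%:C * h y)) =
    rsum (nbhd N x) (fun y => cond N x y * k2 y).
  rewrite /rsum; congr (fine _ - fine _); apply: eq_esum => y xy;
  by rewrite ?funeposE ?funenegE hk//= mul0r addr0.
by rewrite e1 e2; apply/eqP; rewrite eq_complex/= !mul0r subr0 addr0 !eqxx.
Qed.

(** Every vertex has positive mass, so what is finite almost everywhere is finite everywhere. *)
Lemma atom_finite (k : V -> \bar R) x : (forall y, 0 <= k y)%E ->
  (\int[mu0]_y k y < +oo)%E -> (k x < +oo)%E.
Proof.
move=> k0; rewrite integral_wsum// => kf.
have wk0 y : (0 <= (m0 N y)%:E * k y)%E by rewrite mule_ge0// lee_fin m0_ge0.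
have sk : summable [set: X] (fun y => (m0 N y)%:E * k y)%E.
  apply: le_lt_trans kf; rewrite le_eqVlt; apply/orP; left; apply/eqP.
  by apply: eq_esum => y _; exact: (gee0_abs (wk0 y)).
have := summable_pinfty sk (x := x) I; rewrite (gee0_abs (wk0 x)).
have [kx|] := ltP (k x) +oo%E; first by [].
by rewrite leye_eq => /eqP ->; rewrite gt0_muley// lte_fin m0_gt0.
Qed.

Lemma step_fiber_finite g x : (\int[step x]_y (g y ^+ 2)%:E < +oo)%E.
Proof.
apply: (@atom_finite (fun x => \int[step x]_y (g y ^+ 2)%:E)%E) => [y|].
  by apply: integral_ge0 => z _; rewrite lee_fin sqr_ge0.
rewrite -vtrans_sqr_total; exact: L2_finite.
Qed.

Lemma step_kint_finite F x t : (\int[step x]_u (kint (fun s => F (x, u, s)) t ^+ 2)%:E < +oo)%E.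
Proof.
apply: (@le_lt_trans _ _ (\int[step x]_u \int[U]_s (F (x, u, s) ^+ 2)%:E)%E).
  apply: ge0_le_integral => //.
  - by move=> u _; rewrite lee_fin sqr_ge0.
  - by move=> u _; apply: kint_sqr_le; exact: measurable_edge.
have i0 x' u : (0 <= \int[U]_s (F (x', u, s) ^+ 2)%:E)%E.
  by apply: integral_ge0 => s _; rewrite lee_fin sqr_ge0.
apply: (@atom_finite (fun x => \int[step x]_u \int[U]_s (F (x, u, s) ^+ 2)%:E)%E) => [y|].
  exact: integral_ge0.
rewrite -(@ge0_disintegration R X N x0 (fun e => \int[U]_s (F (e, s) ^+ 2)%:E)%E); last first.
  by case=> y u; exact: i0.
by rewrite -tonelli_sqr; [exact: L2_finite|exact: L2_measurable].
Qed.

Lemma normc_sqr (a b : R) : Normc.normc (a +i* b) ^+ 2 = a ^+ 2 + b ^+ 2.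
Proof. by rewrite /= sqr_sqrtr// addr_ge0// sqr_ge0. Qed.

End matching.

(** * Norms as integrals *)

Section function_spaces.
Variables (R : realType) (X : countType) (N : network R X) (x0 : X).
Local Notation U := (U01 R).
Local Notation mR := (measurableTypeR R).
Local Notation V := (disc x0).
Local Notation E := (disc (x0, x0)).
Local Notation mu0 := (mu0 N x0).
Local Notation mu1 := (mu1 N x0).
Local Notation step := (step N x0).
Local Notation H0 := (L2 mu0).
Local Notation H1 := (L2 (mu0 \x U)%E).
Local Notation H2 := (L2 (mu1 \x U)%E).
Local Notation b0 := (l2_ip mu0).
Local Notation b1 := (l2_ip (mu0 \x U)%E).
Local Notation b2 := (l2_ip (mu1 \x U)%E).
Implicit Types (F : H2) (f h : H1) (g : H0).

Lemma poweR_sqrt (r : R) : 0 <= r -> (r%:E `^ 2^-1 = (Num.sqrt r)%:E)%E.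
Proof. by move=> r0; rewrite poweR_EFin powR12_sqrt. Qed.

Lemma poweR_half_lty (x : \bar R) : (0 <= x)%E -> (x `^ 2^-1 < +oo)%E -> (x < +oo)%E.
Proof.
have [//|] := ltP x +oo%E; rewrite leye_eq => /eqP -> _.
by rewrite poweRyr ?ltxx// invr_neq0// pnatr_eq0.
Qed.

Lemma l2_normE (u v : V -> R) (g : X -> R[i]) : (forall x, g x = u x +i* v x) ->
  l2_norm N g = ((\int[mu0]_x (u x ^+ 2)%:E + \int[mu0]_x (v x ^+ 2)%:E) `^ 2^-1)%E.
Proof.
move=> gE; rewrite /l2_norm; congr (_ `^ _)%E.
have sq0 (w : V -> R) x : (0 <= (w x ^+ 2)%:E)%E by rewrite lee_fin sqr_ge0.
rewrite -ge0_integralD//.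
rewrite integral_wsum; last by move=> x; rewrite adde_ge0.
apply: eq_esum => x _; rewrite gE normc_sqr -EFinD -EFinM mulrC//.
Qed.

Definition on_skeleton (p : X * X * R) : Prop := adj N p.1.1 p.1.2 /\ 0 <= p.2 <= 1.

Lemma L2_normE (u v : E * mR -> R) (f : X * X * R -> R[i]) :
  measurable_fun setT u -> measurable_fun setT v ->
  (forall p, on_skeleton p -> f p = u p +i* v p) ->
  L2_norm N f = (((2^-1)%:E *
    (\int[mu1 \x U]_z (u z ^+ 2)%:E + \int[mu1 \x U]_z (v z ^+ 2)%:E)) `^ 2^-1)%E.
Proof.
move=> mu_ mv fE; rewrite /L2_norm; congr ((_ * _) `^ _)%E.
have sq0 (w : R) : (0 <= (w ^+ 2)%:E)%E by rewrite lee_fin sqr_ge0.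
have i0 (w : E * mR -> R) e : (0 <= \int[U]_t (w (e, t) ^+ 2)%:E)%E by exact: integral_ge0.
rewrite (tonelli_sqr mu1 mu_) (tonelli_sqr mu1 mv) -ge0_integralD//.
rewrite [RHS]integral_wsum; last by move=> e; rewrite adde_ge0.
transitivity (\esum_(x in [set: X]) \esum_(y in [set: X]) ((conductance N x y)%:E *
   (\int[U]_t (u (x, y, t) ^+ 2)%:E + \int[U]_t (v (x, y, t) ^+ 2)%:E)))%E; last first.
  rewrite esum_esum; last first.
    move=> x y _ _; apply: mule_ge0; first by rewrite lee_fin conductance_ge0.
    by apply: adde_ge0; [exact: (i0 u (x, y))|exact: (i0 v (x, y))].
  rewrite (_ : _ `*`` _ = setT); last by apply/seteqP.
  by apply: eq_esum => -[x y] _.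
apply: eq_esum => x _; rewrite esum_conductance; apply: eq_esum => y xy.
congr (_ * _)%E.
have ms (w : E * mR -> R) : measurable_fun setT w ->
    measurable_fun setT (fun t : mR => (w (x, y, t) ^+ 2)%:E).
  move=> mw; apply/measurable_EFinP; apply: measurable_funX.
  exact: (measurable_fiber (h := w)).
rewrite -ge0_integralD//; try exact: ms.
rewrite integral_U01//; last 2 first.
- by apply: emeasurable_funD; exact: ms.
- by move=> t; rewrite adde_ge0.
apply: eq_integral => t; rewrite inE/= in_itv/= => t01.
by rewrite fE// normc_sqr.
Qed.

(** Values off the skeleton are arbitrary and need not depend measurably on [t]; they are erased
    before a function is viewed as an element of an L2 space. *)
Definition skeleton_part (k : X * X * R -> R) (p : X * X * R) : R :=
  if adj N p.1.1 p.1.2 && (0 <= p.2 <= 1) then k p else 0.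

Lemma measurable_skeleton_part (k : X * X * R -> R) :
  (forall x y, adj N x y -> measurable_fun `[(0 : R), 1] (fun t => k (x, y, t))) ->
  measurable_fun setT (skeleton_part k : E * mR -> R).
Proof.
move=> mk; apply: measurable_fun_slices => -[x y].
rewrite /skeleton_part/=; have [xy|xy] := boolP (adj N x y); last first.
  exact: measurable_cst.
have -> : (fun t : mR => if true && (0 <= t <= 1) then k (x, y, t) else 0) =
    (fun t => k (x, y, t)) \_ `[0, 1].
  by apply/funext => t; rewrite patchE mem_setE in_itv.
have m01 : measurable (`[0, 1]%classic : set mR) by exact: measurable_itv.
exact: (measurable_restrictT (fun t : mR => k (x, y, t)) m01).1 (mk x y xy).
Qed.

End function_spaces.

(** * The spectrum of the transition operator *)

Section spectra.
Variables (R : realType) (X : countType) (N : network R X) (x0 : X).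
Local Notation U := (U01 R).
Local Notation mR := (measurableTypeR R).
Local Notation V := (disc x0).
Local Notation E := (disc (x0, x0)).
Local Notation mu0 := (mu0 N x0).
Local Notation mu1 := (mu1 N x0).
Local Notation step := (step N x0).
Local Notation H0 := (L2 mu0).
Local Notation H1 := (L2 (mu0 \x U)%E).
Local Notation H2 := (L2 (mu1 \x U)%E).
Local Notation b0 := (l2_ip mu0).
Local Notation b1 := (l2_ip (mu0 \x U)%E).
Local Notation b2 := (l2_ip (mu1 \x U)%E).
Implicit Types (F : H2) (h : H1).

Let repH0 (u : H0) (x : X) : R := u x.
Let repH0P a u v x : repH0 (a *: u + v) x = a * repH0 u x + repH0 v x.
Proof. by []. Qed.

Let l2_represents (g : X -> R[i]) (uv : H0 * H0) : represents repH0 setT g uv ->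
  forall x, g x = uv.1 x +i* uv.2 x.
Proof. by move=> h x; exact: h. Qed.

Let l2_normP (g : X -> R[i]) (uv : H0 * H0) : represents repH0 setT g uv ->
  fnorm (l2X0 N) g = (Num.sqrt (sqn b0 uv.1 + sqn b0 uv.2))%:E.
Proof.
move=> /l2_represents gE; rewrite -poweR_sqrt ?addr_ge0 ?sqn_ge0//.
rewrite [LHS](@l2_normE R X N x0 _ _ _ gE) -!l2_sqnE.
by congr (_ `^ _)%E.
Qed.

Let l2_memP (g : X -> R[i]) : fmem (l2X0 N) g <-> exists uv, represents repH0 setT g uv.
Proof.
split=> [|[uv /l2_normP]]; last by rewrite /= => ->; exact: ltry.
rewrite /= => gf; pose u (x : V) := complex.Re (g x); pose v (x : V) := complex.Im (g x).
have gE x : g x = u x +i* v x by rewrite /u /v; case: (g x).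
have i0 (w : V -> R) : (0 <= \int[mu0]_x (w x ^+ 2)%:E)%E.
  by apply: integral_ge0 => x _; rewrite lee_fin sqr_ge0.
move: gf; rewrite (@l2_normE R X N x0 _ _ _ gE) => /poweR_half_lty-/(_ (adde_ge0 (i0 u) (i0 v)))
  uvf.
have uf : (\int[mu0]_x (u x ^+ 2)%:E < +oo)%E by apply: le_lt_trans uvf; rewrite leeDl.
have vf : (\int[mu0]_x (v x ^+ 2)%:E < +oo)%E by apply: le_lt_trans uvf; rewrite leeDr.
exists (L2mk (measurable_vertex_fun u) uf, L2mk (measurable_vertex_fun v) vf) => x _.
exact: gE.
Qed.

Let transitionP (g : X -> R[i]) (uv : H0 * H0) : represents repH0 setT g uv ->
  represents repH0 setT (transition N g) (vtrans uv.1, vtrans uv.2).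
Proof.
move=> /l2_represents gE x _; apply: csum_step => [y _| |]; first exact: gE.
- exact: step_fiber_finite.
- exact: step_fiber_finite.
Qed.

Lemma H0_complete : geometrically_complete b0.
Proof.
move=> u C r r01 hu; have [v [_ hv]] := L2_geometrically_complete r01 hu.
by exists v.
Qed.

Lemma specP_real z : specP N z <->
  complex.Im z = 0 /\ ~ bounded_below b0 (fun g => vtrans g - complex.Re z *: g).
Proof.
exact: (spec_symmetricP repH0P l2_memP l2_normP transitionP (@vtrans_sym R X N x0)
  (@vtrans_bounded R X N x0) H0_complete).
Qed.

End spectra.

(** * The spectrum of the averaging operator *)

Section glued_space.
Variables (R : realType) (X : countType) (N : network R X) (x0 : X).
Local Notation U := (U01 R).
Local Notation mR := (measurableTypeR R).
Local Notation V := (disc x0).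
Local Notation E := (disc (x0, x0)).
Local Notation mu0 := (mu0 N x0).
Local Notation mu1 := (mu1 N x0).
Local Notation step := (step N x0).
Local Notation H0 := (L2 mu0).
Local Notation H1 := (L2 (mu0 \x U)%E).
Local Notation H2 := (L2 (mu1 \x U)%E).
Local Notation b0 := (l2_ip mu0).
Local Notation b1 := (l2_ip (mu0 \x U)%E).
Local Notation b2 := (l2_ip (mu1 \x U)%E).

Definition glued_pred : {pred H2} := fun F => `[< glued N (F : X * X * R -> R) >].

Fact glued_submod_closed : submod_closed glued_pred.
Proof.
split=> [|a F G /asboolP[F1 F2] /asboolP[G1 G2]]; apply/asboolP.
  by split.
split=> [x y t xy t01|x y z xy xz].
  transitivity (a * F (x, y, t) + G (x, y, t)); first by [].
  by rewrite (F1 x y t xy t01) (G1 x y t xy t01).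
transitivity (a * F (x, y, 0) + G (x, y, 0)); first by [].
by rewrite (F2 x y z xy xz) (G2 x y z xy xz).
Qed.

HB.instance Definition _ := GRing.isSubmodClosed.Build R H2 glued_pred glued_submod_closed.

Record gluedL2 := GluedL2 { glued_val :> H2; _ : glued_val \in glued_pred }.

HB.instance Definition _ := [isSub for glued_val].
HB.instance Definition _ := [Choice of gluedL2 by <:].
HB.instance Definition _ := [SubChoice_isSubLmodule of gluedL2 by <:].

Lemma gluedP (F : gluedL2) : glued N (glued_val F : X * X * R -> R).
Proof. by case: F => F /= /asboolP. Qed.

Fact glue_subproof (F : H2) : glued N (F : X * X * R -> R) -> F \in glued_pred.
Proof. by move=> gF; apply/asboolP. Qed.

Definition glue (F : H2) (gF : glued N (F : X * X * R -> R)) : gluedL2 :=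
  GluedL2 (glue_subproof gF).

(** Each edge occurs in both orientations, whence the factor one half. *)
Definition glued_dot (F G : gluedL2) : R := 2^-1 * b2 (glued_val F) (glued_val G).

Fact glued_dotC F G : glued_dot F G = glued_dot G F.
Proof. by rewrite /glued_dot (dotC b2). Qed.
Fact glued_dotP a F G W : glued_dot (a *: F + G) W = a * glued_dot F W + glued_dot G W.
Proof.
rewrite /glued_dot (_ : glued_val (a *: F + G) = a *: glued_val F + glued_val G)//.
by rewrite (dotP b2) mulrDr mulrCA.
Qed.
Fact glued_dot_ge0 F : 0 <= glued_dot F F.
Proof. by rewrite mulr_ge0// dot_ge0. Qed.

Definition glued_ip := SemiIp glued_dotC glued_dotP glued_dot_ge0.

Lemma glued_sqnE F : sqn glued_ip F = 2^-1 * sqn b2 (glued_val F).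
Proof. by []. Qed.

Definition glued_avg (F : gluedL2) : gluedL2 := glue (avg_glued (glued_val F)).

Lemma glued_avg_sym : symmetric_op glued_ip glued_avg.
Proof.
move=> F G; rewrite /=/glued_dot; congr (_ * _).
by apply: avg_sym; apply: glued_reversal; exact: gluedP.
Qed.

Lemma glued_avg_bounded : bounded_op glued_ip glued_avg 4.
Proof.
move=> F; rewrite !glued_sqnE mulrCA ler_pM2l ?invr_gt0//.
exact: avg_bounded.
Qed.

(** The gluing conditions are identities between values, which the limit provided by
    [L2_geometrically_complete] inherits. *)
Lemma glued_complete : geometrically_complete glued_ip.
Proof.
move=> u C r r01 hu.
have hu' k : sqn b2 (glued_val (u k.+1) - glued_val (u k)) <= (2 * C) * r ^+ k.
  have := hu k; rewrite glued_sqnE.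
  rewrite (_ : glued_val (u k.+1 - u k) = glued_val (u k.+1) - glued_val (u k))//.
  by rewrite mulrC ler_pdivrMr// mulrC mulrA.
have [v [vE hv]] := L2_geometrically_complete r01 hu'.
have gv : glued N (v : X * X * R -> R).
  split=> [x y t xy t01|x y z xy xz]; rewrite !vE; congr (fine (limn_esup _)).
    by apply/funext => k; rewrite ((gluedP (u k)).1 x y t xy t01).
  by apply/funext => k; rewrite ((gluedP (u k)).2 x y z xy xz).
exists (glue gv) => e e0; have [n hn] := hv e e0; exists n => k nk.
rewrite glued_sqnE (_ : glued_val (u k - glue gv) = glued_val (u k) - v)//.
apply: le_trans (hn k nk); rewrite -[leRHS]mul1r ler_wpM2r ?sqn_ge0//.
by rewrite invf_le1// ler1n.
Qed.

Local Notation D := (on_skeleton N).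
Let rep (u : gluedL2) (p : X * X * R) : R := glued_val u p.
Let repP a u v p : rep (a *: u + v) p = a * rep u p + rep v p.
Proof. by []. Qed.

Let L2_normP (f : X * X * R -> R[i]) (uv : gluedL2 * gluedL2) : represents rep D f uv ->
  fnorm (L2X1 N) f = (Num.sqrt (sqn glued_ip uv.1 + sqn glued_ip uv.2))%:E.
Proof.
move=> fE; rewrite -poweR_sqrt ?addr_ge0 ?sqn_ge0//.
have m1 := L2_measurable (glued_val uv.1); have m2 := L2_measurable (glued_val uv.2).
rewrite [LHS](@L2_normE R X N x0 _ _ _ m1 m2 fE) -!l2_sqnE !glued_sqnE -mulrDr.
by congr (_ `^ _)%E.
Qed.

Let L2_memP (f : X * X * R -> R[i]) : fmem (L2X1 N) f <-> exists uv, represents rep D f uv.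
Proof.
split=> [[[fsym fglue] fmeas ff]|[uv fE]]; last first.
  have fE' x y t : adj N x y -> 0 <= t <= 1 ->
      f (x, y, t) = rep uv.1 (x, y, t) +i* rep uv.2 (x, y, t).
    by move=> xy t01; exact: fE.
  have [s1 g1] := gluedP uv.1; have [s2 g2] := gluedP uv.2.
  have t0 : 0 <= (0 : R) <= 1 by rewrite lexx ler01.
  split.
  - split=> [x y t xy t01|x y z xy xz].
      rewrite (fE' x y t)// (fE' y x (1 - t)) ?(adj_sym N y x)//; last exact: flip01.
      by rewrite /rep (s1 x y t)// (s2 x y t).
    by rewrite (fE' x y 0)// (fE' x z 0)// /rep (g1 x y z)// (g2 x y z).
  - move=> x y xy; split.
      apply: (eq_measurable_fun (fun t : mR => rep uv.1 (x, y, t))).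
        by move=> t; rewrite inE/= in_itv/= => t01; rewrite fE'.
      apply: (measurable_funS measurableT) => //; exact: measurable_edge.
    apply: (eq_measurable_fun (fun t : mR => rep uv.2 (x, y, t))).
      by move=> t; rewrite inE/= in_itv/= => t01; rewrite fE'.
    apply: (measurable_funS measurableT) => //; exact: measurable_edge.
  - by rewrite -[L2_norm N f]/(fnorm (L2X1 N) f) (L2_normP fE) ltry.
pose u : E * mR -> R := skeleton_part N (fun p => complex.Re (f p)).
pose v : E * mR -> R := skeleton_part N (fun p => complex.Im (f p)).
have mu_ : measurable_fun setT u.
  by apply: measurable_skeleton_part => x y xy; have [] := fmeas x y xy.
have mv : measurable_fun setT v.
  by apply: measurable_skeleton_part => x y xy; have [] := fmeas x y xy.
have fE p : D p -> f p = u p +i* v p.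
  by move=> [p1 p2]; rewrite /u /v /skeleton_part p1 p2; case: (f p).
have i0 (w : E * mR -> R) : (0 <= \int[mu1 \x U]_x (w x ^+ 2)%:E)%E.
  by apply: integral_ge0 => x _; rewrite lee_fin sqr_ge0.
move: ff; rewrite (@L2_normE R X N x0 _ _ _ mu_ mv fE).
have half0 : (0 <= (2^-1)%:E :> \bar R)%E by rewrite lee_fin.
move=> /(poweR_half_lty (mule_ge0 half0 (adde_ge0 (i0 u) (i0 v)))) uvf.
have {}uvf : (\int[mu1 \x U]_z (u z ^+ 2)%:E + \int[mu1 \x U]_z (v z ^+ 2)%:E < +oo)%E.
  have [//|] := ltP (\int[mu1 \x U]_z (u z ^+ 2)%:E + \int[mu1 \x U]_z (v z ^+ 2)%:E)%E +oo%E.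
  by rewrite leye_eq => /eqP e; move: uvf; rewrite e gt0_muley// lte_fin invr_gt0.
have uf : (\int[mu1 \x U]_x (u x ^+ 2)%:E < +oo)%E by apply: le_lt_trans uvf; rewrite leeDl.
have vf : (\int[mu1 \x U]_x (v x ^+ 2)%:E < +oo)%E by apply: le_lt_trans uvf; rewrite leeDr.
have gl (k : R[i] -> R) : glued N (skeleton_part N (k \o f)).
  split=> [x y t xy t01|x y z xy xz].
    have t01' : 0 <= 1 - t <= 1 by exact: flip01.
    by rewrite /skeleton_part/= (adj_sym N y x) xy t01 t01'/= fsym.
  by rewrite /skeleton_part/= xy xz lexx ler01/= (fglue x y z).
have gu : glued N (L2mk mu_ uf : X * X * R -> R) by exact: gl.
have gv : glued N (L2mk mv vf : X * X * R -> R) by exact: gl.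
by exists (glue gu, glue gv) => p Dp; exact: fE.
Qed.

Let cint_edge (f : X * X * R -> R[i]) (uv : gluedL2 * gluedL2) x y t :
  represents rep D f uv -> adj N x y -> 0 <= t <= 1 ->
  cint 0 (1 - t) (fun s => f (x, y, s)) =
  kint (fun s => rep uv.1 (x, y, s)) t +i* kint (fun s => rep uv.2 (x, y, s)) t.
Proof.
move=> fE xy t01; rewrite /cint !kintE//; try exact: measurable_edge.
have s01 s : s \in `[0, 1 - t]%classic -> 0 <= s <= 1.
  rewrite inE/= in_itv/= => /andP[h1 h2]; have /andP[h3 h4] := t01.
  by apply/andP; split; lra.
by congr (_ +i* _); apply: eq_Rintegral => s /s01 hs; rewrite fE.
Qed.

Let averagingP (f : X * X * R -> R[i]) (uv : gluedL2 * gluedL2) : represents rep D f uv ->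
  represents rep D (averaging N f) (glued_avg uv.1, glued_avg uv.2).
Proof.
move=> fE [[x y] t] [/= xy t01].
rewrite (@csum_step R X N x0 x (fun u => kint (fun s => rep uv.1 (x, u, s)) t)
  (fun u => kint (fun s => rep uv.2 (x, u, s)) t)); last 3 first.
- by move=> u xu; exact: cint_edge.
- exact: step_kint_finite.
- exact: step_kint_finite.
rewrite (@csum_step R X N x0 y (fun u => kint (fun s => rep uv.1 (y, u, s)) (flip t))
  (fun u => kint (fun s => rep uv.2 (y, u, s)) (flip t))); last 3 first.
- by move=> u yu; rewrite -[X in cint 0 X]flipK; apply: cint_edge => //; exact: flip01.
- exact: step_kint_finite.
- exact: step_kint_finite.
by [].
Qed.

Lemma specA_real z : specA N z <->
  complex.Im z = 0 /\ ~ bounded_below glued_ip (fun F => glued_avg F - complex.Re z *: F).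
Proof.
exact: (spec_symmetricP repP L2_memP L2_normP averagingP glued_avg_sym
  glued_avg_bounded glued_complete).
Qed.

Lemma glued_avg_bounded_belowP (l : R) :
  bounded_below glued_ip (fun F => glued_avg F - l *: F) <->
  exists2 d, 0 < d & forall F : H2, glued N (F : X * X * R -> R) ->
    d * sqn b2 F <= sqn b2 (avg F - l *: F).
Proof.
have half0 : 0 < 2^-1 :> R by rewrite invr_gt0.
have e F : sqn glued_ip (glued_avg F - l *: F) =
  2^-1 * sqn b2 (avg (glued_val F) - l *: glued_val F) by [].
split=> -[d d0 hd]; exists d => // F; last first.
  by rewrite e glued_sqnE mulrCA (ler_pM2l half0); apply: hd; exact: gluedP.
move=> gF; have := hd (glue gF).
by rewrite e glued_sqnE mulrCA (ler_pM2l half0).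
Qed.

End glued_space.

(** * The spectral correspondence *)

Section spectral_inclusions.
Variables (R : realType) (X : countType) (N : network R X) (x0 : X).
Local Notation U := (U01 R).
Local Notation mR := (measurableTypeR R).
Local Notation mu0 := (mu0 N x0).
Local Notation mu1 := (mu1 N x0).
Local Notation b0 := (l2_ip mu0).
Local Notation b2 := (l2_ip (mu1 \x U)%E).
Local Notation gip := (glued_ip N x0).
Local Notation gavg := (@glued_avg R X N x0).

Lemma specP_realC (p : R) : specP N p%:C <->
  ~ bounded_below b0 (fun g => vtrans g - p *: g).
Proof. by split=> [/(specP_real N x0)[]//|h]; apply/(specP_real N x0). Qed.

Lemma specA_realC (l : R) : specA N l%:C <->
  ~ exists2 d, 0 < d & forall F : L2 (mu1 \x U)%E, glued N (F : X * X * R -> R) ->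
    d * sqn b2 F <= sqn b2 (avg F - l *: F).
Proof.
split=> [/(specA_real N x0)[_ h] /glued_avg_bounded_belowP//|h].
by apply/(specA_real N x0); split => // /glued_avg_bounded_belowP.
Qed.

Lemma specA_0 : specA N 0%:C.
Proof.
apply/specA_realC => -[d d0 hd].
have [F gF] := avg_not_bounded_below N x0 d0; rewrite ltNge.
by have := hd F gF; rewrite scale0r subr0 => ->.
Qed.

Lemma specA_of_fiber_eigen (l p : R) (S : L2 U) : l != 0 -> S 0 = 0 -> S 1 != 0 ->
  fiber_eigen l p S -> specP N p%:C -> specA N l%:C.
Proof.
move=> l0 S0 S1 eS /specP_realC hp; apply/specA_realC => hA; apply: hp.
exact: (vtrans_bounded_below l0 S0 S1 eS hA).
Qed.

(** If [sin w = 0] the point is [0], which is in the spectrum anyway. *)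
Lemma specA_sin (w : R) : w != 0 -> specP N (cos w)%:C -> specA N (sin w / w)%:C.
Proof.
move=> w0 hw; have [sw|sw] := eqVneq (sin w) 0.
  by rewrite sw mul0r; exact: specA_0.
have mS : measurable_fun setT (fun t : mR => sin (w * t + 0)).
  apply: continuous_measurable_fun.
  apply: (@is_derive_continuous _ _ (fun x => 1 * (w * cos (w * x + 0)))) => x.
  have := @is_derive_affine R sin cos w 0 1 (@is_derive_sin R) x.
  by under eq_fun do rewrite mul1r.
have fS : (\int[U]_t (sin (w * t + 0) ^+ 2)%:E < +oo)%E.
  by apply: (@L2_of_bounded01 _ _ 1 mS) => t _; rewrite ler_norml sin_geN1 sin_le1.
apply: (@specA_of_fiber_eigen _ (cos w) (L2mk mS fS)) => //=.
- by rewrite mulf_neq0// invr_neq0.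
- by rewrite mulr0 addr0 sin0.
- by rewrite mulr1 addr0.
- exact: fiber_eigen_sin.
Qed.

Lemma specA_1 : specP N 1%:C -> specA N 1%:C.
Proof.
move=> h1.
have mS : measurable_fun setT (fun t : mR => 1 * t + 0).
  by apply: measurable_funD => //; exact: measurable_funM.
have fS : (\int[U]_t ((1 * t + 0) ^+ 2)%:E < +oo)%E.
  apply: (@L2_of_bounded01 _ _ 1 mS) => t /andP[t0 t1].
  by rewrite mul1r addr0 ger0_norm.
apply: (@specA_of_fiber_eigen 1 1 (L2mk mS fS)) => //=.
- by rewrite mulr0 addr0.
- exact: fiber_eigen_id.
Qed.

(** A number [p] with [P - p] not bounded below lies in the interval [[-1, 1]] and in the spectrum of
    the transition operator; as [l] avoids the values attached to it, the fiber problem is solvable. *)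
Lemma specA_sub (l : R) : l != 0 ->
  (forall w, w != 0 -> specP N (cos w)%:C -> l != sin w / w) ->
  (specP N 1%:C -> l != 1) -> ~ specA N l%:C.
Proof.
move=> l0 hw h1 /specA_realC; apply.
suff [d d0 hd] : bounded_below b2 (fun F => avg F - l *: F) by exists d.
apply: (avg_bounded_below l0); apply: (cavg_bounded_below l0) => p.
have [|/specP_realC hp] := pselect (bounded_below b0 (fun g => vtrans g - p *: g)); first by left.
right; have p1 : -1 <= p <= 1.
  rewrite -ler_norml leNgt; apply/negP => /(contraction_bounded_below (@vtrans_bounded R X N x0)).
  by move/specP_realC: hp.
have [eta [dd [dd0 heta]]] := fiber_dual_exists l0 p1
  (fun w w0 cw => hw w w0 (eq_ind_r (fun q => specP N q%:C) hp cw))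
  (fun pe => h1 (eq_ind p (fun q => specP N q%:C) hp _ pe)).
exact: (fiber_problem_bound l0 dd0 heta).
Qed.

End spectral_inclusions.

Theorem theorem1p3 (R : realType) (X : countType) (N : network R X) :
  specA N =
    [set 0] `|`
    [set (sin w / w)%:C | w in [set w : R | w != 0 /\ specP N (cos w)%:C]] `|`
    [set z | z = 1 /\ specP N 1].
Proof.
have [x0 _] := adj_edge N; apply/seteqP; split => [z zA|z].
  have zE : z = (complex.Re z)%:C.
    by have /(specA_real N x0)[] := zA; case: z {zA} => a b /= ->.
  apply: contrapT => nz; rewrite zE in zA nz; apply: specA_sub zA => //.
  - by apply/eqP => e; apply: nz; left; left; rewrite e.
  - by move=> w w0 hw; apply/eqP => e; apply: nz; left; right; exists w; rewrite ?e.
  - by move=> h1; apply/eqP => e; apply: nz; right; rewrite e.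
move=> [[->|[w [w0 hw] <-]]|[-> h1]].
- exact: (@specA_0 R X N x0).
- exact: (specA_sin x0 w0 hw).
- exact: (specA_1 x0 h1).
Qed.
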